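(* Let $K$, $D$, $N\ge2$, $\mu$, $m=e^{2\pi i\mu}$ be as in the context. Let $(b_i)$ be a solution of the segment equations of $D$ with meridian eigenvalue $m$, with $b=1$ on the boundary segment of the closure, all $b_i\neq0$, and such that no shape parameter $z$ satisfies $|z|=1$ or $z\in\{0,\infty\}$. Let $\beta\in\mathbb{C}^E$ with $e^{2\pi i\beta_i}=b_i$. Define $$\mathrm Z_N=\frac{1}{N^{(|E|+1)/2}}\sum_{n\in\{0,1,\dots,N-1\}^E}W_{D,\mu}\!\left(\tfrac{\beta+n}{N}\right)$$ and, for $k\in\mathbb{Z}^E$, the state integrals $$I_N(k)=\int_{[0,1]^E}W_{D,\mu}\!\left(t+\tfrac{\beta}{N}\right)e^{-2\pi i N\,k\cdot t}\,dt .$$ Then the series $\sum_{k\in\mathbb{Z}^E}I_N(k)$ converges and $$\mathrm Z_N=N^{(|E|-1)/2}\sum_{k\in\mathbb{Z}^E}I_N(k).$$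
   Context: Open diagram, segments, crossing labels, sign and segment equations: $D$ is an oriented blackboard-framed 1-1 tangle diagram whose closure is $K$; segments are edges of the underlying 4-valent graph; the two segments meeting the boundary are boundary segments (joined into one segment in the closure); $E$ is the set of internal segments. At a crossing with both strands oriented left to right: incoming top-left $1$, incoming bottom-left $2$, outgoing bottom-right $1'$ (continuation of $1$), outgoing top-right $2'$ (continuation of $2$); sign $\epsilon=+1$ if $1\to1'$ is over, $-1$ if $2\to2'$ is over. Shape parameters: $z_{\mathrm N}=(b_{2'}/b_1)^\epsilon$, $z_{\mathrm S}=(b_2/b_{1'})^\epsilon$, $z_{\mathrm W}=(b_2/(mb_1))^\epsilon$, $z_{\mathrm E}=(mb_{2'}/b_{1'})^\epsilon$. Segment values $a_1=m^\epsilon\frac{1-z_{\mathrm W}}{1-z_{\mathrm N}}$, $a_{2'}=m^{-\epsilon}\frac{1-z_{\mathrm E}}{1-z_{\mathrm N}}$, $a_2=m^{-\epsilon}\frac{1-z_{\mathrm S}}{1-z_{\mathrm W}}$, $a_{1'}=m^{\epsilon}\frac{1-z_{\mathrm S}}{1-z_{\mathrm E}}$; the segment equations require the two values assigned to each segment of the closure (from its two end crossings) to agree. Quantum dilogarithm: for $\mathsf b>0$ let $c_{\mathsf b}=\frac i2(\mathsf b+\mathsf b^{-1})$ and $\Phi_{\mathsf b}(z)=\exp\int_{\mathbb{R}+i0}\frac{e^{-2izw}}{4\sinh(w\mathsf b)\sinh(w/\mathsf b)}\frac{dw}{w}$ for $|\operatorname{Im}z|<|\operatorname{Im}c_{\mathsf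 b}|$, extended to a meromorphic function on $\mathbb{C}$ (Faddeev's noncompact quantum dilogarithm). Set $E_N(t)=\Phi_{\sqrt N}(i\sqrt N\,t-c_{\sqrt N}+i/\sqrt N)$; it satisfies $E_N(t)=E_N(t-1/N)/(1-e^{2\pi i t})$, and its zeros and poles lie in $\frac1N\mathbb{Z}$. Crossing weights: for a positive crossing $\Lambda^+(t_1,t_2,t_{1'},t_{2'})=\dfrac{E_N(t_{2'}-t_1)\,E_N(t_2-t_{1'})}{E_N(t_2-t_1-\mu/N+1-1/N)\,E_N(t_{2'}-t_{1'}+\mu/N)}\,e^{2\pi i(1-N)(t_2-t_1-\mu/N)+2\pi i\mu(t_2+t_{1'}-t_1-t_{2'})}$; for a negative crossing $\Lambda^-(t_1,t_2,t_{1'},t_{2'})=\dfrac{E_N(t_1-t_2+\mu/N)\,E_N(t_{1'}-t_{2'}-\mu/N+1-1/N)}{E_N(t_1-t_{2'}+1-1/N)\,E_N(t_{1'}-t_2+1-1/N)}\,e^{-2\pi i(1-N)(t_2-t_1-\mu/N)-2\pi i\mu(t_2+t_{1'}-t_1-t_{2'})}$. Weight of the diagram: draw $D$ so that at every crossing both strands point left to right, with finitely many turning points (points of vertical tangent, away from crossings). A turning point that is a leftmost point traversed clockwise or a rightmost point traversed counterclockwise has shift $0$; a leftmost point traversed counterclockwise has shift $1/N-1$; a rightmost point traversed clockwise has shift $1-1/N$. Assign a variable $t_i\in\mathbb{C}$ to each $i\in E$ and $0$ to each boundary segment; this is the value at the segment's initial end, and the value at its final end is this plus the sum of the shifts of the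 turning points along the segment. At each crossing insert the values at the ends meeting it into $\Lambda^{\epsilon}$ (incoming segments $1,2$ and outgoing $1',2'$). Define the meromorphic function $W_{D,\mu}(t)=\prod_{\text{crossings}}\Lambda^{\epsilon}(\dots)$ on $\mathbb{C}^E$; it equals $\exp(N\,\mathcal S_{D,\mu}(t))$ for the action $\mathcal S_{D,\mu}=\frac1N\sum_{\text{crossings}}\log\Lambda^\epsilon$. The quantity $\mathrm Z_N$ is the state-sum formula for the invariant $\mathrm Z_N^{\psi}(K,\rho,\mu)$ of the decorated representation $\rho$ determined by $(b_i)$. *)

(* Defs.v *)
From Stdlib Require Import Reals ZArith List Lia.
From Coquelicot Require Import Coquelicot.
Import ListNotations.
Open Scope R_scope.

Definition cexp (z : C) : C :=
  (exp (Re z) * cos (Im z), exp (Re z) * sin (Im z)).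
Definition csinh (w : C) : C := ((cexp w - cexp (- w)) / 2)%C.
Definition twopii : C := (2 * PI * Ci)%C.

(* The contour R + i0 (passing above the pole at 0) is realised as the *)
(* horizontal line Im w = delta_b, with 0 < delta_b below the first    *)
(* pole of the integrand in the upper half plane (pi*min(b,1/b)).      *)
(* This defines Phi_b on the strip |Im z| < |Im c_b|.                  *)
Definition c_b (b : R) : C := (Ci * RtoC ((b + / b) / 2))%C.
Definition delta_b (b : R) : R := Rmin (PI * b) (PI / b) / 2.
Definition faddeev_integrand (b : R) (z : C) (x : R) : C :=
  let w : C := (x, delta_b b) in
  (cexp (- (2 * Ci * z * w)) / (4 * csinh (w * b) * csinh (w / b)) / w)%C.
Definition Phi_strip (b : R) (z : C) : C :=
  cexp (RInt_gen (V := C_R_CompleteNormedModule) (faddeev_integrand b z) (Rbar_locally m_infty) (Rbar_locally p_infty)).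

(* E_N(t) = Phi_{sqrt N}(i sqrt N t - c_{sqrt N} + i / sqrt N), directly given by
   the integral for -1/N < Re t < 1, and extended to C (meromorphically) by the
   functional equation E_N(t) = E_N(t - 1/N) / (1 - e^{2 pi i t}).  At the
   (real) poles the value is junk (division by zero). *)
Definition E_strip (N : nat) (t : C) : C :=
  let sN := sqrt (INR N) in
  Phi_strip sN (Ci * sN * t - c_b sN + Ci / sN)%C.

Fixpoint cprod_range (n : nat) (f : nat -> C) : C :=
  match n with O => 1%C | S n' => (cprod_range n' f * f n')%C end.
Fixpoint csum_range (n : nat) (f : nat -> C) : C :=
  match n with O => 0%C | S n' => (csum_range n' f + f n')%C end.

Definition E_N (N : nat) (t : C) : C :=
  let x := Re t in
  let NR := INR N in
  if Rlt_dec x 1 then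
    if Rlt_dec (- / NR) x then E_strip N t
    else
      let j := Z.to_nat (Int_part (- NR * x)) in
      (E_strip N (t + RtoC (INR j / NR)) *
       cprod_range j (fun l => 1 - cexp (twopii * (t + RtoC (INR (S l) / NR)))))%C
  else
    let j := S (Z.to_nat (Int_part (NR * (x - 1)))) in
    (E_strip N (t - RtoC (INR j / NR)) /
     cprod_range j (fun l => 1 - cexp (twopii * (t - RtoC (INR l / NR)))))%C.

Definition Lambda_pos (N : nat) (mu t1 t2 t1' t2' : C) : C :=
  let NR := RtoC (INR N) in
  (E_N N (t2' - t1) * E_N N (t2 - t1') /
   (E_N N (t2 - t1 - mu / NR + 1 - 1 / NR) * E_N N (t2' - t1' + mu / NR)) *
   cexp (twopii * (1 - NR) * (t2 - t1 - mu / NR)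
         + twopii * mu * (t2 + t1' - t1 - t2')))%C.

Definition Lambda_neg (N : nat) (mu t1 t2 t1' t2' : C) : C :=
  let NR := RtoC (INR N) in
  (E_N N (t1 - t2 + mu / NR) * E_N N (t1' - t2' - mu / NR + 1 - 1 / NR) /
   (E_N N (t1 - t2' + 1 - 1 / NR) * E_N N (t1' - t2 + 1 - 1 / NR)) *
   cexp (- (twopii * (1 - NR) * (t2 - t1 - mu / NR))
         - twopii * mu * (t2 + t1' - t1 - t2')))%C.

Definition Lambda (eps : bool) N mu t1 t2 t1' t2' : C :=
  if eps then Lambda_pos N mu t1 t2 t1' t2' else Lambda_neg N mu t1 t2 t1' t2'.

(* Oriented 1-1 tangle diagrams drawn with all crossings pointing left  *)
(* to right and finitely many turning points, encoded by a Morse       *)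
(* ("slice") presentation read from left to right.  Between two        *)
(* consecutive events the diagram meets a vertical line in finitely    *)
(* many points, listed from top (position 0) to bottom, each with its  *)
(* direction (true = pointing right, false = pointing left).           *)
(*  - Cross k eps : the strands at positions k, k+1 (both pointing     *)
(*    right) cross; incoming top-left = 1, bottom-left = 2, outgoing   *)
(*    bottom-right = 1' (continuation of 1), top-right = 2'.  eps=true *)
(*    (sign +1) iff 1 -> 1' is the over strand.                        *)
(*  - Cap k o : a leftmost turning point creating strands at positions *)
(*    k, k+1; o = true iff the upper one points right (then the point  *)
(*    is traversed clockwise).                                         *)
(*  - Cup k : a rightmost turning point joining positions k, k+1.      *)
Local Open Scope nat_scope.
Inductive event := Cross (k : nat) (eps : bool) | Cap (k : nat) (o : bool) | Cup (k : nat).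

Definition apply_ev (s : list bool) (e : event) : list bool :=
  match e with
  | Cross _ _ => s
  | Cap k o => firstn k s ++ o :: negb o :: skipn k s
  | Cup k => firstn k s ++ skipn (k + 2) s
  end.

Definition ev_ok (s : list bool) (e : event) : Prop :=
  match e with
  | Cross k _ => (k + 1 < length s)%nat /\ nth k s false = true /\ nth (k + 1) s false = true
  | Cap k _ => (k <= length s)%nat
  | Cup k => (k + 1 < length s)%nat /\ nth k s false <> nth (k + 1) s false
  end.

(* one strand enters on the left pointing right, one leaves on the right *)
Fixpoint word_ok (s : list bool) (w : list event) : Prop :=
  match w with
  | [] => s = [true]
  | e :: w' => ev_ok s e /\ word_ok (apply_ev s e) w'
  end.

Definition state (w : list event) (j : nat) : list bool :=
  fold_left apply_ev (firstn j w) [true].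

(* Markers of a step along the curve: passing a crossing, passing a turning
   point whose shift is z * (1 - 1/N) (z = 1: rightmost clockwise,
   z = -1: leftmost counterclockwise, z = 0: the other two kinds). *)
Inductive mark := MNone | MCross | MTurn (z : Z).

(* a slot (j, p): position p of the vertical slice between events j-1 and j *)
Definition slot := (nat * nat)%type.

Definition step (w : list event) (sl : slot) : slot * mark :=
  let (j, p) := sl in
  let s := state w j in
  if nth p s false then
    match nth_error w j with
    | Some (Cross k _) =>
        if Nat.eqb p k then ((S j, k + 1), MCross)
        else if Nat.eqb p (k + 1) then ((S j, k), MCross)
        else ((S j, p), MNone)
    | Some (Cap k _) => ((S j, if Nat.ltb p k then p else p + 2), MNone)
    | Some (Cup k) =>
        let z : Z := if nth k s false then 1%Z else 0%Z in
        if Nat.eqb p k then ((j, k + 1), MTurn z)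
        else if Nat.eqb p (k + 1) then ((j, k), MTurn z)
        else ((S j, if Nat.ltb p k then p else p - 2), MNone)
    | None => ((j, p), MNone)
    end
  else
    match j with
    | O => ((j, p), MNone)
    | S j' =>
      match nth_error w j' with
      | Some (Cap k o) =>
          let z : Z := if o then 0%Z else (-1)%Z in
          if Nat.eqb p k then ((j, k + 1), MTurn z)
          else if Nat.eqb p (k + 1) then ((j, k), MTurn z)
          else ((j', if Nat.ltb p k then p else p - 2), MNone)
      | Some (Cup k) => ((j', if Nat.ltb p k then p else p + 2), MNone)
      | Some (Cross _ _) => ((j', p), MNone)
      | None => ((j, p), MNone)
      end
    end.

Definition slot_eqb (a b : slot) : bool := Nat.eqb (fst a) (fst b) && Nat.eqb (snd a) (snd b).

Definition nslots (w : list event) : nat :=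
  fold_right Nat.add O (map (fun j => length (state w j)) (seq 0 (S (length w)))).

Fixpoint trace_aux (w : list event) (fuel : nat) (sl : slot) : list (slot * mark) :=
  match fuel with
  | O => []
  | S f =>
      if slot_eqb sl (length w, 0%nat) then [(sl, MNone)]
      else let (sl', m) := step w sl in (sl, m) :: trace_aux w f sl'
  end.

Definition trace (w : list event) : list (slot * mark) := trace_aux w (nslots w) (0%nat, 0%nat).

(* D is an oriented 1-1 tangle diagram whose closure is a knot: the word is a
   valid drawing, the traversal reaches the right boundary, and it passes
   through every slot (no further closed components). *)
Definition knot_diagram (w : list event) : Prop :=
  word_ok [true] w /\
  In ((length w, 0%nat), MNone) (trace w) /\
  (forall j p, (j <= length w)%nat -> (p < length (state w j))%nat ->
     exists m, In ((j, p), m) (trace w)).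

Definition is_cross (m : mark) : bool := match m with MCross => true | _ => false end.

(* segments are numbered 0, 1, ..., 2c along the traversal (c = number of
   crossings); 0 and 2c are the boundary segments, 1..2c-1 the internal ones *)
Fixpoint seg_go (tr : list (slot * mark)) (sl : slot) (c : nat) : nat :=
  match tr with
  | [] => c
  | (s', m) :: tr' => if slot_eqb sl s' then c else seg_go tr' sl (if is_cross m then S c else c)
  end.
Definition seg_of (w : list event) (sl : slot) : nat := seg_go (trace w) sl 0.

Fixpoint turn_go (tr : list (slot * mark)) (sg c : nat) : Z :=
  match tr with
  | [] => 0%Z
  | (_, m) :: tr' =>
      ((match m with MTurn z => if Nat.eqb c sg then z else 0%Z | _ => 0%Z end)
       + turn_go tr' sg (if is_cross m then S c else c))%Z
  end.
Definition seg_turn (w : list event) (sg : nat) : Z := turn_go (trace w) sg 0.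

Definition ncross (w : list event) : nat :=
  length (filter (fun e => match e with Cross _ _ => true | _ => false end) w).

Definition nE (w : list event) : nat := (2 * ncross w - 1)%nat.
Definition internal (w : list event) (sg : nat) : bool := Nat.leb 1 sg && Nat.leb sg (nE w).

Local Open Scope R_scope.
(* variable t_i for internal segment i is x (i-1); value at initial end *)
Definition v_init (w : list event) (x : nat -> C) (sg : nat) : C :=
  if internal w sg then x (sg - 1)%nat else 0%C.
Definition v_final (w : list event) (N : nat) (x : nat -> C) (sg : nat) : C :=
  (v_init w x sg + RtoC (IZR (seg_turn w sg) * (1 - / INR N)))%C.

Definition seg1 w j k := seg_of w (j, k).
Definition seg2 w j k := seg_of w (j, k + 1)%nat.
Definition seg1' w j k := seg_of w (S j, k + 1)%nat.
Definition seg2' w j k := seg_of w (S j, k).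

Definition cross_weight (w : list event) (N : nat) (mu : C) (x : nat -> C) (j : nat) : C :=
  match nth_error w j with
  | Some (Cross k eps) =>
      Lambda eps N mu (v_final w N x (seg1 w j k)) (v_final w N x (seg2 w j k))
                      (v_init w x (seg1' w j k)) (v_init w x (seg2' w j k))
  | _ => 1%C
  end.

Definition Wdiag (w : list event) (N : nat) (mu : C) (x : nat -> C) : C :=
  cprod_range (length w) (cross_weight w N mu x).

Definition epow (eps : bool) (z : C) : C := if eps then z else (/ z)%C.

Definition bseg (w : list event) (b : nat -> C) (sg : nat) : C :=
  if internal w sg then b (sg - 1)%nat else 1%C.

Definition zN eps (m b1 b2 b1' b2' : C) := epow eps (b2' / b1)%C.
Definition zS eps (m b1 b2 b1' b2' : C) := epow eps (b2 / b1')%C.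
Definition zW eps (m b1 b2 b1' b2' : C) := epow eps (b2 / (m * b1))%C.
Definition zE eps (m b1 b2 b1' b2' : C) := epow eps (m * b2' / b1')%C.

Definition merid (mu : C) : C := cexp (twopii * mu).

Definition shapes (w : list event) (mu : C) (b : nat -> C) (j k : nat) (eps : bool) : list C :=
  let m := merid mu in
  let b1 := bseg w b (seg1 w j k) in let b2 := bseg w b (seg2 w j k) in
  let b1' := bseg w b (seg1' w j k) in let b2' := bseg w b (seg2' w j k) in
  [zN eps m b1 b2 b1' b2'; zS eps m b1 b2 b1' b2'; zW eps m b1 b2 b1' b2'; zE eps m b1 b2 b1' b2'].

(* segment values: role true = 1 (incoming) / 1' (outgoing), false = 2 / 2' *)
Definition a_in (w : list event) (mu : C) (b : nat -> C) (j k : nat) (eps : bool) (r : bool) : C :=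
  let m := merid mu in
  let b1 := bseg w b (seg1 w j k) in let b2 := bseg w b (seg2 w j k) in
  let b1' := bseg w b (seg1' w j k) in let b2' := bseg w b (seg2' w j k) in
  let zn := zN eps m b1 b2 b1' b2' in let zs := zS eps m b1 b2 b1' b2' in
  let zw := zW eps m b1 b2 b1' b2' in
  if r then (epow eps m * (1 - zw) / (1 - zn))%C
  else (epow (negb eps) m * (1 - zs) / (1 - zw))%C.

Definition a_out (w : list event) (mu : C) (b : nat -> C) (j k : nat) (eps : bool) (r : bool) : C :=
  let m := merid mu in
  let b1 := bseg w b (seg1 w j k) in let b2 := bseg w b (seg2 w j k) in
  let b1' := bseg w b (seg1' w j k) in let b2' := bseg w b (seg2' w j k) in
  let zn := zN eps m b1 b2 b1' b2' in let zs := zS eps m b1 b2 b1' b2' in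
  let ze := zE eps m b1 b2 b1' b2' in
  if r then (epow eps m * (1 - zs) / (1 - ze))%C
  else (epow (negb eps) m * (1 - ze) / (1 - zn))%C.

Definition seg_in (w : list event) (j k : nat) (r : bool) : nat :=
  if r then seg1 w j k else seg2 w j k.
Definition seg_out (w : list event) (j k : nat) (r : bool) : nat :=
  if r then seg1' w j k else seg2' w j k.

(* segment of the closure: the two boundary segments 0 and 2c are joined *)
Definition closure_seg (w : list event) (sg : nat) : nat :=
  if Nat.eqb sg (2 * ncross w) then 0%nat else sg.

(* segment equations: for every segment of the closure, the value assigned at
   its final-end crossing (as 1 or 2) equals that at its initial-end crossing
   (as 1' or 2') *)
Definition segment_equations (w : list event) (mu : C) (b : nat -> C) : Prop :=
  forall j k eps j' k' eps' r r',
    nth_error w j = Some (Cross k eps) ->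
    nth_error w j' = Some (Cross k' eps') ->
    closure_seg w (seg_in w j k r) = closure_seg w (seg_out w j' k' r') ->
    a_in w mu b j k eps r = a_out w mu b j' k' eps' r'.

(* no shape parameter is 0, infinity (impossible here since b_i <> 0, m <> 0)
   or on the unit circle *)
Definition shapes_generic (w : list event) (mu : C) (b : nat -> C) : Prop :=
  forall j k eps, nth_error w j = Some (Cross k eps) ->
    forall z, In z (shapes w mu b j k eps) -> z <> 0%C /\ Cmod z <> 1.

Definition upd {A : Type} (g : nat -> A) (i : nat) (v : A) : nat -> A :=
  fun l => if Nat.eqb l i then v else g l.

Fixpoint box_sum (N d : nat) (F : (nat -> nat) -> C) (g : nat -> nat) : C :=
  match d with
  | O => F g
  | S d' => csum_range N (fun a => box_sum N d' F (upd g d' a))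
  end.

Fixpoint cube_sumZ (M d : nat) (F : (nat -> Z) -> C) (g : nat -> Z) : C :=
  match d with
  | O => F g
  | S d' => csum_range (2 * M + 1) (fun a => cube_sumZ M d' F (upd g d' (Z.of_nat a - Z.of_nat M)%Z))
  end.

(* integral over [0,1]^d (as an iterated integral; the integrands below are
   continuous on the closed cube) *)
Fixpoint cube_int (d : nat) (F : (nat -> R) -> C) (g : nat -> R) : C :=
  match d with
  | O => F g
  | S d' => RInt (V := C_R_CompleteNormedModule)
              (fun y => cube_int d' F (upd g d' y)) 0 1
  end.

Definition Z_N (w : list event) (N : nat) (mu : C) (beta : nat -> C) : C :=
  (RtoC (/ Rpower (INR N) ((INR (nE w) + 1) / 2)) *
   box_sum N (nE w)
     (fun n => Wdiag w N mu (fun i => (beta i + RtoC (INR (n i))) / RtoC (INR N))%C)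
     (fun _ => O))%C.

Definition I_N (w : list event) (N : nat) (mu : C) (beta : nat -> C) (k : nat -> Z) : C :=
  cube_int (nE w)
    (fun t => Wdiag w N mu (fun i => RtoC (t i) + beta i / RtoC (INR N))%C *
              cexp (- (twopii * RtoC (INR N) *
                       csum_range (nE w) (fun i => RtoC (IZR (k i) * t i)))))%C
    (fun _ => 0).

(* Main.v *)
(** The integrand F(t) = W(t + beta/N) is not 1-periodic in the real variables t_i: shifting t_i by 1 multiplies F by a ratio of the two values of segment i with each b_j replaced by b_j e^(2 pi i N t_j).  On the lattice t in (1/N)Z^E these are the original values, so there the segment equations make F periodic, and this suffices: by Dirichlet's theorem on [0,1] the cube partial sums of the series converge to N^(-|E|) times the lattice sum in which endpoints carry half weights, and the half weights recombine by periodicity.  In several variables the convergence is uniform for functions whose mixed first differences are bounded; these are stable under products, so F qualifies as soon as E_N is C^2 and nonzero on horizontal lines off the real axis.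

The functional equation of E_N on its strip reads exp(H(t)) (1 - e^(2 pi i t)) = 1, with H a convergent integral over the contour.  Its left-hand side is constant on vertical lines and tends to 1 at +i infinity; the derivative is the integral of e^(ax)/cosh x, which a geometric expansion turns into the partial fraction series of pi/sin(pi t), and that series is again an instance of Dirichlet's theorem. *)

Require Import Defs.
From Stdlib Require Import Reals ZArith List Lia Lra Psatz FunctionalExtensionality.
From Coquelicot Require Import Coquelicot.
Import ListNotations.
Open Scope R_scope.

(** * Complex-valued functions of a real variable *)

(** The one-variable theorem cannot simply be iterated: once the other variables are integrated
    against Dirichlet kernels, the function of the last variable depends on the cutoff [M], and
    these kernels are unbounded. This is why the error estimate [dirichlet_err M * L] is linear in
    the Lipschitz constant, and why mixed differences are controlled: the induction hypothesis has
    to apply to the difference of two slices.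

    Real translations do not change imaginary parts, and a shape parameter of modulus different from
    1 forces the corresponding dilogarithm argument off the real axis. So each argument stays on one
    horizontal line, where [E_N] is regular and invertible although it is patched from translates of
    a strip.

    For [b = sqrt N] the contour height [delta_b b] is [PI / (2 b)], exactly where [sinh (w b)]
    becomes [i cosh (b x)]; no contour has to be moved to reach the secant integral. *)

Definition Cint (f : R -> C) (a b : R) : C := RInt (V := C_R_CompleteNormedModule) f a b.

Ltac cont_of_derive :=
  apply (ex_derive_continuous (K := R_AbsRing) (V := R_NormedModule)); auto_derive; auto.

Lemma C_ext (z w : C) : Re z = Re w -> Im z = Im w -> z = w.
Proof. destruct z, w; simpl; intros; subst; reflexivity. Qed.

Lemma cexp_add (z w : C) : cexp (z + w) = (cexp z * cexp w)%C.
Proof.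
  apply C_ext; unfold cexp; simpl; rewrite exp_plus.
  - rewrite cos_plus; unfold Re, Im; ring.
  - rewrite sin_plus; unfold Re, Im; ring.
Qed.

Lemma cexp_0 : cexp 0 = 1%C.
Proof. apply C_ext; unfold cexp; simpl; rewrite ?exp_0, ?cos_0, ?sin_0; ring. Qed.

Lemma Cmod_cexp (z : C) : Cmod (cexp z) = exp (Re z).
Proof.
  unfold cexp, Cmod; simpl.
  replace (_ + _) with (exp (Re z) * exp (Re z) * (Rsqr (sin (Im z)) + Rsqr (cos (Im z))))
    by (unfold Rsqr; ring).
  rewrite sin2_cos2, Rmult_1_r. apply sqrt_square. left; apply exp_pos.
Qed.

Lemma cexp_neq_0 (z : C) : cexp z <> 0%C.
Proof. apply Cmod_gt_0. rewrite Cmod_cexp. apply exp_pos. Qed.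

Lemma cexp_opp (z : C) : cexp (- z) = (/ cexp z)%C.
Proof.
  pose proof (cexp_neq_0 z) as Hz.
  assert (H : (cexp z * cexp (- z) = 1)%C).
  { rewrite <- cexp_add. replace (z + - z)%C with (RtoC 0) by ring. apply cexp_0. }
  rewrite <- (Cmult_1_l (/ cexp z)), <- H. field. exact Hz.
Qed.

Lemma cexp_minus (z w : C) : cexp (z - w) = (cexp z / cexp w)%C.
Proof. unfold Cminus, Cdiv. rewrite cexp_add, cexp_opp. reflexivity. Qed.

Lemma cexp_RtoC (x : R) : cexp (RtoC x) = RtoC (exp x).
Proof. apply C_ext; unfold cexp; simpl; rewrite ?cos_0, ?sin_0; ring. Qed.

Lemma Re_twopii_mult (z : C) : Re (twopii * z)%C = - (2 * PI * Im z).
Proof. unfold twopii. destruct z; simpl. ring. Qed.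

Lemma Im_twopii_mult (z : C) : Im (twopii * z)%C = 2 * PI * Re z.
Proof. unfold twopii. destruct z; simpl. ring. Qed.

Lemma cexp_twopii_IZR (n : Z) : cexp (twopii * RtoC (IZR n)) = 1%C.
Proof.
  unfold cexp. rewrite Re_twopii_mult, Im_twopii_mult. simpl.
  replace (- (2 * PI * 0)) with 0 by ring. rewrite exp_0.
  assert (H1 : cos (2 * PI * IZR n) = 1 /\ sin (2 * PI * IZR n) = 0).
  { split.
    - replace (2 * PI * IZR n) with (2 * (PI * IZR n)) by ring.
      rewrite cos_2a_sin.
      rewrite (sin_eq_0_1 (PI * IZR n)); [ring | exists n; ring].
    - apply sin_eq_0_1. exists (2 * n)%Z. rewrite mult_IZR. ring. }
  destruct H1 as [H1 H2]; rewrite H1, H2. apply C_ext; simpl; ring.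
Qed.

Lemma Ceq_minus (z w : C) : (z - w = 0)%C -> z = w.
Proof. intros H. replace z with ((z - w) + w)%C by ring. rewrite H. ring. Qed.

Lemma Cmod_Re_Im (z : C) : Cmod z <= Rabs (Re z) + Rabs (Im z).
Proof.
  assert (E : z = (RtoC (Re z) + Ci * RtoC (Im z))%C) by (apply C_ext; simpl; ring).
  rewrite E at 1.
  eapply Rle_trans; [apply Cmod_triangle|].
  rewrite Cmod_mult, Cmod_Ci, !Cmod_R, Rmult_1_l. lra.
Qed.

Lemma im_le_Cmod (z : C) : Rabs (Im z) <= Cmod z.
Proof. eapply Rle_trans; [|apply Rmax_Cmod]. apply Rmax_r. Qed.

Lemma Cmod_RtoC_mult (x : R) (z : C) : Cmod (RtoC x * z) = Rabs x * Cmod z.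
Proof. rewrite Cmod_mult, Cmod_R. reflexivity. Qed.

Lemma Cmod_minus_sym (z w : C) : Cmod (z - w) = Cmod (w - z).
Proof. rewrite <- Cmod_opp. f_equal. ring. Qed.

Lemma Cmod_triangle_minus (z w : C) : Cmod (z - w) <= Cmod z + Cmod w.
Proof. unfold Cminus. rewrite <- (Cmod_opp w). apply Cmod_triangle. Qed.

(** Continuity and derivatives are tested on real and imaginary parts, so that the calculus of real
    functions applies directly. [Ccont_continuous] returns to the product structure on which
    integrals are defined. *)
Definition Ccont (f : R -> C) (x : R) : Prop :=
  continuous (fun u => Re (f u)) x /\ continuous (fun u => Im (f u)) x.

Definition Cderiv (f : R -> C) (x : R) (l : C) : Prop :=
  is_derive (fun u => Re (f u)) x (Re l) /\ is_derive (fun u => Im (f u)) x (Im l).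

Lemma Cderiv_Ccont f x l : Cderiv f x l -> Ccont f x.
Proof.
  intros [H1 H2]; split; apply (ex_derive_continuous (K := R_AbsRing) (V := R_NormedModule));
    eexists; eassumption.
Qed.

Lemma Ccont_continuous f x : Ccont f x -> continuous (U := C_R_CompleteNormedModule) f x.
Proof.
  intros [H1 H2].
  apply (continuous_ext (fun u => (Re (f u), Im (f u)))).
  - intros u. destruct (f u); reflexivity.
  - apply (filterlim_pair (F := locally x) (G := locally (Re (f x))) (H := locally (Im (f x))) (fun u => Re (f u)) (fun u => Im (f u))) in H2; [|exact H1].
    refine (filterlim_filter_le_2 _ _ H2).
    intros P [eps HP]. exists (fun y => ball (Re (f x)) eps y) (fun y => ball (Im (f x)) eps y).
    + exists eps; auto.
    + exists eps; auto.
    + intros a b Ha Hb. apply HP. split; assumption.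
Qed.

Lemma Ccont_ext f g x : (forall u, f u = g u) -> Ccont f x -> Ccont g x.
Proof.
  intros E [H1 H2]; split;
    [eapply continuous_ext; [|exact H1] | eapply continuous_ext; [|exact H2]];
    intros u; simpl; rewrite E; reflexivity.
Qed.

Lemma Cderiv_ext f g x l : (forall u, f u = g u) -> Cderiv f x l -> Cderiv g x l.
Proof.
  intros E [H1 H2]; split;
    [eapply is_derive_ext; [|exact H1] | eapply is_derive_ext; [|exact H2]];
    intros u; simpl; rewrite E; reflexivity.
Qed.

Lemma Cderiv_ext_loc f g x l : locally x (fun u => f u = g u) -> Cderiv f x l -> Cderiv g x l.
Proof.
  intros E [H1 H2]; split;
    [eapply is_derive_ext_loc; [|exact H1] | eapply is_derive_ext_loc; [|exact H2]];
    (eapply filter_imp; [|exact E]); intros u Hu; simpl; rewrite Hu; reflexivity.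
Qed.

Lemma Cderiv_eq f x l l' : l = l' -> Cderiv f x l -> Cderiv f x l'.
Proof. intros ->; auto. Qed.

Lemma Ccont_const (c : C) x : Ccont (fun _ => c) x.
Proof. split; apply continuous_const. Qed.

Lemma Ccont_RtoC (f : R -> R) x : continuous f x -> Ccont (fun u => RtoC (f u)) x.
Proof. intros H; split; simpl; [exact H | apply continuous_const]. Qed.

Lemma Ccont_plus f g x : Ccont f x -> Ccont g x -> Ccont (fun u => f u + g u)%C x.
Proof.
  intros [F1 F2] [G1 G2]; split; simpl.
  - apply (continuous_plus (V := R_NormedModule) (fun u => Re (f u)) (fun u => Re (g u))); auto.
  - apply (continuous_plus (V := R_NormedModule) (fun u => Im (f u)) (fun u => Im (g u))); auto.
Qed.

Lemma Ccont_opp f x : Ccont f x -> Ccont (fun u => - f u)%C x.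
Proof.
  intros [F1 F2]; split; simpl.
  - apply (continuous_opp (V := R_NormedModule) (fun u => Re (f u))); auto.
  - apply (continuous_opp (V := R_NormedModule) (fun u => Im (f u))); auto.
Qed.

Lemma Ccont_minus f g x : Ccont f x -> Ccont g x -> Ccont (fun u => f u - g u)%C x.
Proof. intros. apply Ccont_plus; [|apply Ccont_opp]; auto. Qed.

Lemma Ccont_mult f g x : Ccont f x -> Ccont g x -> Ccont (fun u => f u * g u)%C x.
Proof.
  intros [F1 F2] [G1 G2]; split; simpl.
  - apply (continuous_minus (V := R_NormedModule) (fun u => Re (f u) * Re (g u)) (fun u => Im (f u) * Im (g u))).
    + apply (continuous_mult (K := R_AbsRing) (fun u => Re (f u)) (fun u => Re (g u))); auto.
    + apply (continuous_mult (K := R_AbsRing) (fun u => Im (f u)) (fun u => Im (g u))); auto.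
  - apply (continuous_plus (V := R_NormedModule) (fun u => Re (f u) * Im (g u)) (fun u => Im (f u) * Re (g u))).
    + apply (continuous_mult (K := R_AbsRing) (fun u => Re (f u)) (fun u => Im (g u))); auto.
    + apply (continuous_mult (K := R_AbsRing) (fun u => Im (f u)) (fun u => Re (g u))); auto.
Qed.

Lemma Ccont_cexp f x : Ccont f x -> Ccont (fun u => cexp (f u)) x.
Proof.
  intros [F1 F2]; split; simpl.
  - apply (continuous_mult (K := R_AbsRing) (fun u => exp (Re (f u))) (fun u => cos (Im (f u)))).
    + apply (continuous_comp (fun u => Re (f u)) exp); auto. apply continuous_exp.
    + apply (continuous_comp (fun u => Im (f u)) cos); auto. apply continuous_cos.
  - apply (continuous_mult (K := R_AbsRing) (fun u => exp (Re (f u))) (fun u => sin (Im (f u)))).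
    + apply (continuous_comp (fun u => Re (f u)) exp); auto. apply continuous_exp.
    + apply (continuous_comp (fun u => Im (f u)) sin); auto. apply continuous_sin.
Qed.

Lemma Csqnorm_neq_0 (z : C) : z <> 0%C -> Re z * Re z + Im z * Im z <> 0.
Proof.
  intros Hz H. apply Hz. assert (Re z = 0 /\ Im z = 0) as [H1 H2] by (split; nra).
  apply C_ext; auto.
Qed.

Lemma Re_inv (z : C) : Re (/ z)%C = Re z * / (Re z * Re z + Im z * Im z).
Proof. destruct z; unfold Cinv; simpl. rewrite !Rmult_1_r. reflexivity. Qed.
Lemma Im_inv (z : C) : Im (/ z)%C = - Im z * / (Re z * Re z + Im z * Im z).
Proof. destruct z; unfold Cinv; simpl. rewrite !Rmult_1_r. reflexivity. Qed.

Lemma Ccont_inv f x : Ccont f x -> f x <> 0%C -> Ccont (fun u => / f u)%C x.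
Proof.
  intros [F1 F2] Hn. apply Csqnorm_neq_0 in Hn.
  assert (HI : continuous (fun u => / (Re (f u) * Re (f u) + Im (f u) * Im (f u))) x).
  { apply continuous_Rinv_comp; [|exact Hn].
    apply (continuous_plus (V := R_NormedModule) (fun u => Re (f u) * Re (f u)) (fun u => Im (f u) * Im (f u))).
    + apply (continuous_mult (K := R_AbsRing) (fun u => Re (f u)) (fun u => Re (f u))); auto.
    + apply (continuous_mult (K := R_AbsRing) (fun u => Im (f u)) (fun u => Im (f u))); auto. }
  split.
  - apply (continuous_ext (fun u => Re (f u) * / (Re (f u) * Re (f u) + Im (f u) * Im (f u)))).
    { intros u. symmetry; apply Re_inv. }
    apply (continuous_mult (K := R_AbsRing) (fun u => Re (f u))); auto.
  - apply (continuous_ext (fun u => - Im (f u) * / (Re (f u) * Re (f u) + Im (f u) * Im (f u)))).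
    { intros u. symmetry; apply Im_inv. }
    apply (continuous_mult (K := R_AbsRing) (fun u => - Im (f u))); auto.
    apply (continuous_opp (V := R_NormedModule) (fun u => Im (f u))); auto.
Qed.

Lemma Ccont_div f g x : Ccont f x -> Ccont g x -> g x <> 0%C -> Ccont (fun u => f u / g u)%C x.
Proof. intros. apply Ccont_mult; auto. apply Ccont_inv; auto. Qed.

Lemma Cderiv_const (c : C) x : Cderiv (fun _ => c) x 0%C.
Proof. split; simpl; apply (is_derive_const (K := R_AbsRing) (V := R_NormedModule)). Qed.

Lemma Cderiv_RtoC (f : R -> R) x l : is_derive f x l -> Cderiv (fun u => RtoC (f u)) x (RtoC l).
Proof. intros H; split; simpl; [exact H | apply (is_derive_const (K := R_AbsRing) (V := R_NormedModule))]. Qed.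

Lemma Cderiv_id x : Cderiv (fun u => RtoC u) x 1%C.
Proof. apply (Cderiv_RtoC (fun u => u)). apply (is_derive_id (K := R_AbsRing)). Qed.

Lemma Cderiv_plus f g x l m : Cderiv f x l -> Cderiv g x m -> Cderiv (fun u => f u + g u)%C x (l + m)%C.
Proof.
  intros [F1 F2] [G1 G2]; split; simpl.
  - apply (is_derive_plus (V := R_NormedModule) (fun u => Re (f u)) (fun u => Re (g u))); auto.
  - apply (is_derive_plus (V := R_NormedModule) (fun u => Im (f u)) (fun u => Im (g u))); auto.
Qed.

Lemma Cderiv_opp f x l : Cderiv f x l -> Cderiv (fun u => - f u)%C x (- l)%C.
Proof.
  intros [F1 F2]; split; simpl.
  - apply (is_derive_opp (V := R_NormedModule) (fun u => Re (f u))); auto.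
  - apply (is_derive_opp (V := R_NormedModule) (fun u => Im (f u))); auto.
Qed.

Lemma Cderiv_minus f g x l m : Cderiv f x l -> Cderiv g x m -> Cderiv (fun u => f u - g u)%C x (l - m)%C.
Proof. intros. apply Cderiv_plus; [|apply Cderiv_opp]; auto. Qed.

Lemma is_derive_eq (f : R -> R) x (l l' : R) : l = l' -> is_derive f x l -> is_derive f x l'.
Proof. intros ->; auto. Qed.

Lemma Cderiv_mult f g x l m :
  Cderiv f x l -> Cderiv g x m -> Cderiv (fun u => f u * g u)%C x (l * g x + f x * m)%C.
Proof.
  intros [F1 F2] [G1 G2]; split.
  - eapply is_derive_eq; [|apply (is_derive_minus (V := R_NormedModule)
      (fun u => Re (f u) * Re (g u)) (fun u => Im (f u) * Im (g u)));
      apply Derive.is_derive_mult; eassumption].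
    unfold minus, plus, opp, Re, Im; simpl. ring.
  - eapply is_derive_eq; [|apply (is_derive_plus (V := R_NormedModule)
      (fun u => Re (f u) * Im (g u)) (fun u => Im (f u) * Re (g u)));
      apply Derive.is_derive_mult; eassumption].
    unfold plus, Re, Im; simpl. ring.
Qed.

Lemma Cderiv_cexp f x l : Cderiv f x l -> Cderiv (fun u => cexp (f u)) x (l * cexp (f x))%C.
Proof.
  intros [F1 F2].
  assert (E : is_derive (fun u => exp (Re (f u))) x (Re l * exp (Re (f x)))).
  { apply (is_derive_comp exp (fun u => Re (f u))); auto. apply is_derive_exp. }
  split; simpl.
  - eapply is_derive_eq; [|apply Derive.is_derive_mult; [exact E|]].
    2:{ apply (is_derive_comp cos (fun u => Im (f u))); [apply is_derive_cos|exact F2]. }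
    unfold scal; simpl; unfold mult; simpl. unfold Re, Im; ring.
  - eapply is_derive_eq; [|apply Derive.is_derive_mult; [exact E|]].
    2:{ apply (is_derive_comp sin (fun u => Im (f u))); [apply is_derive_sin|exact F2]. }
    unfold scal; simpl; unfold mult; simpl. unfold Re, Im; ring.
Qed.

Lemma Cderiv_inv f x l : Cderiv f x l -> f x <> 0%C -> Cderiv (fun u => / f u)%C x (- l / (f x * f x))%C.
Proof.
  intros [F1 F2] Hn0. pose proof (Csqnorm_neq_0 _ Hn0) as Hn.
  pose (q := fun u => Re (f u) * Re (f u) + Im (f u) * Im (f u)).
  assert (Q : is_derive q x (2 * (Re (f x) * Re l + Im (f x) * Im l))).
  { eapply is_derive_eq; [|apply (is_derive_plus (V := R_NormedModule)
      (fun u => Re (f u) * Re (f u)) (fun u => Im (f u) * Im (f u)));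
      apply Derive.is_derive_mult; eassumption].
    unfold plus; simpl; ring. }
  assert (HQ : is_derive (fun u => / q u) x (- (2 * (Re (f x) * Re l + Im (f x) * Im l)) / (q x) ^ 2)).
  { apply is_derive_inv; auto. }
  assert (E : (- l / (f x * f x))%C = (- l * (/ f x * / f x))%C) by (field; exact Hn0).
  rewrite E.
  assert (Hq : q x <> 0) by exact Hn.
  split.
  - apply (is_derive_ext (fun u => Re (f u) * / q u)).
    { intros u. symmetry; apply Re_inv. }
    eapply is_derive_eq; [|apply Derive.is_derive_mult; [exact F1|exact HQ]].
    pose proof (Re_inv (f x)) as R1. pose proof (Im_inv (f x)) as R2. fold (q x) in R1, R2.
    destruct (/ f x)%C as [p r]. simpl in R1, R2. subst p r. destruct l as [l1 l2]. simpl.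
    unfold q in *. destruct (f x) as [a b]; simpl in *. field. auto.
  - apply (is_derive_ext (fun u => - Im (f u) * / q u)).
    { intros u. symmetry; apply Im_inv. }
    eapply is_derive_eq; [|apply Derive.is_derive_mult; [|exact HQ]].
    2:{ apply (is_derive_opp (V := R_NormedModule) (fun u => Im (f u))). exact F2. }
    pose proof (Re_inv (f x)) as R1. pose proof (Im_inv (f x)) as R2. fold (q x) in R1, R2.
    destruct (/ f x)%C as [p r]. simpl in R1, R2. subst p r. destruct l as [l1 l2]. simpl.
    unfold q, opp in *; simpl. destruct (f x) as [a b]; simpl in *. field. auto.
Qed.

Lemma Cderiv_comp_lin f a b x l :
  Cderiv f (a * x + b) l -> Cderiv (fun u => f (a * u + b)) x (RtoC a * l)%C.
Proof.
  intros [F1 F2].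
  assert (E : is_derive (fun u => a * u + b) x a) by (auto_derive; auto; ring).
  split.
  - eapply is_derive_eq; [|apply (is_derive_comp (fun u => Re (f u)) (fun u => a * u + b)); [exact F1|exact E]].
    unfold scal; simpl; unfold mult; simpl. unfold Re; simpl; ring.
  - eapply is_derive_eq; [|apply (is_derive_comp (fun u => Im (f u)) (fun u => a * u + b)); [exact F2|exact E]].
    unfold scal; simpl; unfold mult; simpl. unfold Im; simpl; ring.
Qed.

(** * Integrals of continuous complex functions on an interval *)

Definition Ccont_on (f : R -> C) (a b : R) : Prop := forall x, a <= x <= b -> Ccont f x.

Lemma Ccont_on_ex_RInt f a b : a <= b -> Ccont_on f a b -> ex_RInt (V := C_R_CompleteNormedModule) f a b.
Proof.
  intros Hab H. apply (ex_RInt_continuous (V := C_R_CompleteNormedModule)). intros z Hz.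
  rewrite Rmin_left, Rmax_right in Hz by lra. apply Ccont_continuous. auto.
Qed.

Lemma Cint_Re_Im (f : R -> C) a b : ex_RInt (V := C_R_CompleteNormedModule) f a b ->
  Re (Cint f a b) = RInt (fun x => Re (f x)) a b /\ Im (Cint f a b) = RInt (fun x => Im (f x)) a b.
Proof.
  intros H. apply (RInt_correct (V := C_R_CompleteNormedModule)) in H. split; symmetry.
  - apply is_RInt_unique. apply (is_RInt_fct_extend_fst (U := R_NormedModule) (V := R_NormedModule)) in H. exact H.
  - apply is_RInt_unique. apply (is_RInt_fct_extend_snd (U := R_NormedModule) (V := R_NormedModule)) in H. exact H.
Qed.

Lemma Cint_ext (f g : R -> C) a b : a <= b -> (forall x, a < x < b -> f x = g x) -> Cint f a b = Cint g a b :> C.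
Proof.
  intros Hab H. apply (RInt_ext (V := C_R_CompleteNormedModule)).
  intros x Hx. rewrite Rmin_left, Rmax_right in Hx by lra. auto.
Qed.

Lemma Cint_point (f : R -> C) a : Cint f a a = 0%C.
Proof. apply (RInt_point (V := C_R_CompleteNormedModule)). Qed.

Lemma Cint_plus (f g : R -> C) a b : a <= b -> Ccont_on f a b -> Ccont_on g a b ->
  Cint (fun x => f x + g x)%C a b = (Cint f a b + Cint g a b)%C.
Proof.
  intros Hab Hf Hg. apply (RInt_plus (V := C_R_CompleteNormedModule)); apply Ccont_on_ex_RInt; auto.
Qed.

Lemma Ccont_on_mult f g a b : Ccont_on f a b -> Ccont_on g a b -> Ccont_on (fun x => f x * g x)%C a b.
Proof. intros F G x Hx. apply Ccont_mult; auto. Qed.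
Lemma Ccont_on_const c a b : Ccont_on (fun _ => c) a b.
Proof. intros x Hx. apply Ccont_const. Qed.
Lemma Ccont_on_Re_ex f a b : a <= b -> Ccont_on f a b -> ex_RInt (fun x => Re (f x)) a b.
Proof.
  intros Hab H. apply (ex_RInt_continuous (V := R_CompleteNormedModule)). intros z Hz.
  rewrite Rmin_left, Rmax_right in Hz by lra. apply H. auto.
Qed.
Lemma Ccont_on_Im_ex f a b : a <= b -> Ccont_on f a b -> ex_RInt (fun x => Im (f x)) a b.
Proof.
  intros Hab H. apply (ex_RInt_continuous (V := R_CompleteNormedModule)). intros z Hz.
  rewrite Rmin_left, Rmax_right in Hz by lra. apply H. auto.
Qed.

Lemma RInt_lin (g h : R -> R) (p q a b : R) : ex_RInt g a b -> ex_RInt h a b ->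
  RInt (fun x => p * g x + q * h x) a b = p * RInt g a b + q * RInt h a b.
Proof.
  intros Hg Hh. apply is_RInt_unique.
  apply (is_RInt_plus (V := R_NormedModule) (fun x => p * g x) (fun x => q * h x)).
  - apply (is_RInt_scal (V := R_NormedModule) g). apply (RInt_correct (V := R_CompleteNormedModule)); auto.
  - apply (is_RInt_scal (V := R_NormedModule) h). apply (RInt_correct (V := R_CompleteNormedModule)); auto.
Qed.

Lemma Cint_scal (c : C) (f : R -> C) a b : a <= b -> Ccont_on f a b -> Cint (fun x => c * f x)%C a b = (c * Cint f a b)%C.
Proof.
  intros Hab Hf.
  assert (Hcf : Ccont_on (fun x => c * f x)%C a b) by (apply Ccont_on_mult; [apply Ccont_on_const|exact Hf]).
  pose proof (Cint_Re_Im _ _ _ (Ccont_on_ex_RInt _ _ _ Hab Hf)) as [R1 I1].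
  pose proof (Cint_Re_Im _ _ _ (Ccont_on_ex_RInt _ _ _ Hab Hcf)) as [R2 I2].
  pose proof (Ccont_on_Re_ex _ _ _ Hab Hf) as XR. pose proof (Ccont_on_Im_ex _ _ _ Hab Hf) as XI.
  destruct c as [p q]. remember (Cint f a b) as z eqn:Ez. destruct z as [z1 z2].
  simpl in R1, I1. subst z1 z2. clear Ez.
  apply C_ext.
  - rewrite R2. simpl. unfold Rminus. rewrite Ropp_mult_distr_l, <- RInt_lin; auto.
    apply RInt_ext. intros x _. unfold Re, Im. simpl. lra.
  - rewrite I2. simpl. rewrite <- RInt_lin; auto.
Qed.

Lemma Cint_minus (f g : R -> C) a b : a <= b -> Ccont_on f a b -> Ccont_on g a b ->
  Cint (fun x => f x - g x)%C a b = (Cint f a b - Cint g a b)%C.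
Proof.
  intros Hab Hf Hg. apply (RInt_minus (V := C_R_CompleteNormedModule)); apply Ccont_on_ex_RInt; auto.
Qed.

Lemma Cint_Chasles (f : R -> C) a b c : a <= b -> b <= c -> Ccont_on f a c ->
  (Cint f a b + Cint f b c)%C = Cint f a c.
Proof.
  intros Hab Hbc Hf. apply (RInt_Chasles (V := C_R_CompleteNormedModule)); apply Ccont_on_ex_RInt; auto;
  intros x Hx; apply Hf; lra.
Qed.

Lemma Cint_norm_le (f : R -> C) (g : R -> R) a b : a <= b -> Ccont_on f a b -> ex_RInt g a b ->
  (forall x, a <= x <= b -> Cmod (f x) <= g x) -> Cmod (Cint f a b) <= RInt g a b.
Proof.
  intros Hab Hf Hg H.
  (* The norm of the product module is Euclidean, hence it is the modulus. *)
  replace (Cmod (Cint f a b)) with (norm (V := C_R_CompleteNormedModule) (Cint f a b)).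
  - apply (norm_RInt_le (V := C_R_CompleteNormedModule) f g a b); auto.
    + intros x Hx. specialize (H x Hx).
      replace (norm (V := C_R_CompleteNormedModule) (f x)) with (Cmod (f x)); auto.
      unfold norm; simpl. unfold prod_norm, norm; simpl. unfold Cmod, abs; simpl.
      f_equal. rewrite !Rmult_1_r, <- !Rabs_mult, !Rabs_pos_eq; nra.
    + apply (RInt_correct (V := C_R_CompleteNormedModule)). apply Ccont_on_ex_RInt; auto.
    + apply (RInt_correct (V := R_CompleteNormedModule)); auto.
  - unfold norm; simpl. unfold prod_norm, norm; simpl. unfold Cmod, abs; simpl.
    f_equal. rewrite !Rmult_1_r, <- !Rabs_mult, !Rabs_pos_eq; nra.
Qed.

Lemma Cint_norm_le_const (f : R -> C) M a b : a <= b -> Ccont_on f a b ->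
  (forall x, a <= x <= b -> Cmod (f x) <= M) -> Cmod (Cint f a b) <= (b - a) * M.
Proof.
  intros Hab Hf H.
  replace ((b - a) * M) with (RInt (fun _ => M) a b).
  - apply Cint_norm_le; auto. apply ex_RInt_const.
  - rewrite RInt_const. reflexivity.
Qed.

Lemma Cint_FTC (F f : R -> C) a b : a <= b -> (forall x, a <= x <= b -> Cderiv F x (f x)) -> Ccont_on f a b ->
  Cint f a b = (F b - F a)%C.
Proof.
  intros Hab HF Hf.
  pose proof (Cint_Re_Im _ _ _ (Ccont_on_ex_RInt _ _ _ Hab Hf)) as [R1 I1].
  apply C_ext.
  - rewrite R1. apply is_RInt_unique.
    apply (is_RInt_derive (V := R_CompleteNormedModule) (fun x => Re (F x))); intros x Hx;
      rewrite Rmin_left, Rmax_right in Hx by lra; [apply HF|apply Hf]; auto.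
  - rewrite I1. apply is_RInt_unique.
    apply (is_RInt_derive (V := R_CompleteNormedModule) (fun x => Im (F x))); intros x Hx;
      rewrite Rmin_left, Rmax_right in Hx by lra; [apply HF|apply Hf]; auto.
Qed.

Lemma Cint_const (c : C) a b : Cint (fun _ => c) a b = (RtoC (b - a) * c)%C.
Proof.
  rewrite (RInt_const (V := C_R_CompleteNormedModule)).
  destruct c. unfold scal; simpl. unfold prod_scal, scal; simpl. unfold mult; simpl.
  apply C_ext; simpl; ring.
Qed.

Lemma Cint_comp_lin (f : R -> C) (u v a b : R) : 0 < u -> a <= b -> Ccont_on f (u * a + v) (u * b + v) ->
  (RtoC u * Cint (fun y => f (u * y + v)%R) a b)%C = Cint f (u * a + v) (u * b + v).
Proof.
  intros Hu Hab Hf.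
  assert (Hl : u * a + v <= u * b + v) by nra.
  transitivity (Cint (fun y => RtoC u * f (u * y + v)%R)%C a b).
  - symmetry. apply Cint_scal; auto.
    intros x Hx. assert (Hx' : Ccont f (u * x + v)) by (apply Hf; nra).
    assert (E : continuous (fun y => u * y + v) x).
    { cont_of_derive. }
    destruct Hx' as [H1 H2]. split.
    + apply (continuous_comp (fun y => u * y + v) (fun y => Re (f y))); auto.
    + apply (continuous_comp (fun y => u * y + v) (fun y => Im (f y))); auto.
  - etransitivity; [|apply (RInt_comp_lin (V := C_R_CompleteNormedModule) f u v a b); apply Ccont_on_ex_RInt; auto].
    apply Cint_ext; auto. intros x Hx. destruct (f (u * x + v)). unfold scal; simpl.
    unfold prod_scal, scal; simpl. unfold mult; simpl. apply C_ext; simpl; ring.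
Qed.

Lemma Ccont_comp_R (f : R -> C) (g : R -> R) x : continuous g x -> Ccont f (g x) -> Ccont (fun u => f (g u)) x.
Proof.
  intros Hg [H1 H2]. split.
  - apply (continuous_comp g (fun y => Re (f y))); auto.
  - apply (continuous_comp g (fun y => Im (f y))); auto.
Qed.

(** * The Dirichlet kernel on an interval *)

Fixpoint dirichlet (M : nat) (s : R) : R :=
  match M with O => 1 | S m => dirichlet m s + 2 * cos (2 * PI * INR (S m) * s) end.

(** The sawtooth [1/2 - s] minus the [M]-th partial sum of its Fourier series. It is an
    antiderivative of minus the Dirichlet kernel, and its values [1/2] at 0 and [-1/2] at 1 are the
    source of the half weights at the endpoints. *)
Fixpoint sawtooth_err (M : nat) (s : R) : R :=
  match M with
  | O => 1 / 2 - s
  | S m => sawtooth_err m s - sin (2 * PI * INR (S m) * s) / (PI * INR (S m))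
  end.

Lemma sawtooth_err_derive M s : is_derive (sawtooth_err M) s (- dirichlet M s).
Proof.
  induction M as [|m IH].
  - simpl. auto_derive; auto; ring.
  - change (is_derive (fun s => sawtooth_err m s - sin (2 * PI * INR (S m) * s) / (PI * INR (S m))) s
              (- (dirichlet m s + 2 * cos (2 * PI * INR (S m) * s)))).
    pose proof PI_RGT_0 as HPI. assert (HS : INR (S m) <> 0) by (apply not_0_INR; lia).
    revert HS. generalize (INR (S m)). intros K HK.
    eapply is_derive_eq; [|apply (is_derive_minus (V := R_NormedModule) (sawtooth_err m)
      (fun s => sin (2 * PI * K * s) / (PI * K)) s (- dirichlet m s) (2 * cos (2 * PI * K * s))); [exact IH|]].
    + unfold minus, plus, opp; simpl. ring.
    + auto_derive; auto. field. split; [auto|lra].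
Qed.

Lemma dirichlet_continuous M s : continuous (dirichlet M) s.
Proof.
  induction M as [|m IH].
  - apply continuous_const.
  - apply (continuous_plus (V := R_NormedModule) (dirichlet m) (fun s => 2 * cos (2 * PI * INR (S m) * s))); auto.
    cont_of_derive.
Qed.

Lemma dirichlet_bound M s : Rabs (dirichlet M s) <= 2 * INR M + 1.
Proof.
  induction M as [|m IH].
  - simpl. rewrite Rabs_R1. lra.
  - change (Rabs (dirichlet m s + 2 * cos (2 * PI * INR (S m) * s)) <= 2 * INR (S m) + 1).
    rewrite (S_INR m) at 2. pose proof (COS_bound (2 * PI * INR (S m) * s)).
    eapply Rle_trans; [apply Rabs_triang|].
    assert (Rabs (2 * cos (2 * PI * INR (S m) * s)) <= 2) by (apply Rabs_le; lra). lra.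
Qed.

(** The closed form of the kernel, multiplied out to stay valid at integers. The induction step
    telescopes by [2 cos A sin B = sin (A + B) - sin (A - B)]. *)
Lemma dirichlet_sin M s : dirichlet M s * sin (PI * s) = sin ((2 * INR M + 1) * (PI * s)).
Proof.
  induction M as [|m IH].
  - cbn [dirichlet INR]. rewrite Rmult_0_r, Rplus_0_l, !Rmult_1_l. reflexivity.
  - change ((dirichlet m s + 2 * cos (2 * PI * INR (S m) * s)) * sin (PI * s) = sin ((2 * INR (S m) + 1) * (PI * s))).
    rewrite Rmult_plus_distr_r, IH.
    replace ((2 * INR m + 1) * (PI * s)) with (2 * PI * INR (S m) * s - PI * s) by (rewrite S_INR; ring).
    replace ((2 * INR (S m) + 1) * (PI * s)) with (2 * PI * INR (S m) * s + PI * s) by ring.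
    rewrite sin_minus, sin_plus. ring.
Qed.

Lemma sin_PI_INR n : sin (PI * INR n) = 0.
Proof. apply sin_eq_0_1. exists (Z.of_nat n). rewrite <- INR_IZR_INZ. ring. Qed.

Lemma sawtooth_err_half M : sawtooth_err M (1 / 2) = 0.
Proof.
  induction M as [|m IH]; [simpl; lra|].
  change (sawtooth_err m (1 / 2) - sin (2 * PI * INR (S m) * (1 / 2)) / (PI * INR (S m)) = 0).
  replace (2 * PI * INR (S m) * (1 / 2)) with (PI * INR (S m)) by field.
  rewrite IH, sin_PI_INR. unfold Rdiv. ring.
Qed.

Lemma sawtooth_err_0 M : sawtooth_err M 0 = 1 / 2.
Proof.
  induction M as [|m IH]; [simpl; lra|].
  change (sawtooth_err m 0 - sin (2 * PI * INR (S m) * 0) / (PI * INR (S m)) = 1 / 2).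
  rewrite Rmult_0_r, IH, sin_0. unfold Rdiv. ring.
Qed.

Lemma sin_2PI_INR_sub n s : sin (2 * PI * INR n * (1 - s)) = - sin (2 * PI * INR n * s).
Proof.
  replace (2 * PI * INR n * (1 - s)) with (- (2 * PI * INR n * s) + 2 * INR n * PI) by ring.
  rewrite sin_period. apply sin_neg.
Qed.

Lemma sawtooth_err_sym M s : sawtooth_err M (1 - s) = - sawtooth_err M s.
Proof.
  induction M as [|m IH]; [simpl; lra|].
  change (sawtooth_err m (1 - s) - sin (2 * PI * INR (S m) * (1 - s)) / (PI * INR (S m)) =
    - (sawtooth_err m s - sin (2 * PI * INR (S m) * s) / (PI * INR (S m)))).
  rewrite IH, sin_2PI_INR_sub. unfold Rdiv. ring.
Qed.

Lemma sawtooth_err_1 M : sawtooth_err M 1 = - (1 / 2).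
Proof. replace 1 with (1 - 0) at 1 by ring. rewrite sawtooth_err_sym, sawtooth_err_0. reflexivity. Qed.

Lemma abs_sin_le x : Rabs (sin x) <= Rabs x.
Proof.
  destruct (Rle_dec 0 x).
  - rewrite (Rabs_pos_eq x) by lra. apply Rabs_le.
    pose proof (SIN_bound x). destruct (Rle_dec x 1).
    + pose proof PI2_1. split; [|].
      * assert (0 <= sin x) by (apply sin_ge_0; lra). lra.
      * destruct (Req_dec x 0); [subst; rewrite sin_0; lra|]. left; apply sin_lt_x; lra.
    + lra.
  - rewrite (Rabs_left x) by lra. rewrite <- Rabs_Ropp, <- sin_neg. apply Rabs_le.
    pose proof (SIN_bound (-x)). destruct (Rle_dec (-x) 1).
    + pose proof PI2_1. split; [|].
      * assert (0 <= sin (-x)) by (apply sin_ge_0; lra). lra.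
      * left; apply sin_lt_x; lra.
    + lra.
Qed.

(** Each of the [M] sine terms is at most [2 |s|]. This is useful only while [M s] stays bounded. *)
Lemma sawtooth_err_bound_near M s : Rabs (sawtooth_err M s) <= Rabs (1 / 2 - s) + 2 * INR M * Rabs s.
Proof.
  induction M as [|m IH].
  - simpl. pose proof (Rabs_pos s). lra.
  - change (Rabs (sawtooth_err m s - sin (2 * PI * INR (S m) * s) / (PI * INR (S m))) <=
      Rabs (1 / 2 - s) + 2 * INR (S m) * Rabs s).
    pose proof PI_RGT_0. assert (HS : 0 < INR (S m)) by (apply lt_0_INR; lia).
    assert (Rabs (sin (2 * PI * INR (S m) * s) / (PI * INR (S m))) <= 2 * Rabs s).
    { unfold Rdiv. rewrite Rabs_mult, (Rabs_pos_eq (/ (PI * INR (S m)))).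
      2:{ left. apply Rinv_0_lt_compat. nra. }
      pose proof (abs_sin_le (2 * PI * INR (S m) * s)) as Hs.
      rewrite !Rabs_mult in Hs.
      rewrite (Rabs_pos_eq 2), (Rabs_pos_eq PI), (Rabs_pos_eq (INR (S m))) in Hs by lra.
      apply Rmult_le_reg_r with (PI * INR (S m)); [nra|].
      rewrite Rmult_assoc, Rinv_l by nra. lra. }
    pose proof (Rabs_triang (sawtooth_err m s) (- (sin (2 * PI * INR (S m) * s) / (PI * INR (S m))))) as T.
    rewrite Rabs_Ropp in T. unfold Rminus at 1. rewrite (S_INR m) at 3. lra.
Qed.

(** A crude Jordan inequality: the cubic Taylor polynomial is a lower bound of the sine, and
    [x <= 2] follows from [PI <= 4], so that [1 - x^2 / 6 >= 1 / 3]. *)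
Lemma sin_ge_third x : 0 <= x <= PI / 2 -> x / 3 <= sin x.
Proof.
  intros Hx. pose proof PI_4. pose proof (pre_sin_bound x 0 ltac:(lra) ltac:(lra)) as [H1 _].
  unfold sin_approx in H1. simpl in H1. unfold sin_term in H1. simpl in H1.
  eapply Rle_trans; [|exact H1].
  assert (x * x <= 4) by nra. 
  match goal with |- _ <= ?r => replace r with (x * (1 - x * x / 6)) by field end.
  nra.
Qed.

(* u = sawtooth_err - A cos((2M+1) pi s)/sin(pi s) has |u'| <= v' with v = -A/sin(pi s), by dirichlet_sin. *)
Lemma sawtooth_err_bound_far M s : 0 < s <= 1 / 2 ->
  Rabs (sawtooth_err M s) <= 2 / ((2 * INR M + 1) * PI * sin (PI * s)).
Proof.
  intros Hs. pose proof PI_RGT_0 as HPI. pose proof (pos_INR M) as HM.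
  set (A := / ((2 * INR M + 1) * PI)).
  assert (HA : 0 < A) by (apply Rinv_0_lt_compat; apply Rmult_lt_0_compat; lra).
  assert (Hsin : forall x, s <= x <= 1 / 2 -> 0 < sin (PI * x)) by (intros x Hx; assert (0 < x) by lra; apply sin_gt_0; nra).
  assert (Hcos : forall x, s <= x <= 1 / 2 -> 0 <= cos (PI * x)) by (intros x Hx; assert (0 < x) by lra; apply cos_ge_0; nra).
  set (om := (2 * INR M + 1) * PI).
  pose (u := fun x => sawtooth_err M x - A * cos (om * x) / sin (PI * x)).
  pose (v := fun x => - A / sin (PI * x)).
  pose (du := fun x => A * PI * cos (om * x) * cos (PI * x) / (sin (PI * x) * sin (PI * x))).
  pose (dv := fun x => A * PI * cos (PI * x) / (sin (PI * x) * sin (PI * x))).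
  assert (Du : forall x, s <= x <= 1 / 2 -> is_derive u x (du x)).
  { intros x Hx. specialize (Hsin x Hx).
    eapply is_derive_eq; [|apply (is_derive_minus (V := R_NormedModule) (sawtooth_err M)
      (fun x => A * cos (om * x) / sin (PI * x))); [apply sawtooth_err_derive|auto_derive; [|reflexivity]; lra]].
    unfold du, minus, plus, opp; simpl.
    assert (HD : dirichlet M x = sin (om * x) / sin (PI * x)).
    { pose proof (dirichlet_sin M x) as E. replace (om * x) with ((2 * INR M + 1) * (PI * x)) by (unfold om; ring).
      rewrite <- E. field. lra. }
    rewrite HD. replace A with (/ om) by reflexivity. assert (0 < om) by (apply Rmult_lt_0_compat; lra). field. split; lra. }
  assert (Dv : forall x, s <= x <= 1 / 2 -> is_derive v x (dv x)).
  { intros x Hx. specialize (Hsin x Hx). unfold v, dv.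
    auto_derive; [lra|]. field. lra. }
  assert (Hle : forall x, s <= x <= 1 / 2 -> Rabs (du x) <= dv x).
  { intros x Hx. specialize (Hsin x Hx). specialize (Hcos x Hx).
    assert (E : du x = cos (om * x) * dv x) by (unfold du, dv; field; lra).
    assert (0 <= dv x).
    { unfold dv. apply Rmult_le_pos; [apply Rmult_le_pos; [apply Rmult_le_pos|]; lra|]. left. apply Rinv_0_lt_compat. nra. }
    rewrite E, Rabs_mult, (Rabs_pos_eq (dv x)) by auto.
    assert (Rabs (cos (om * x)) <= 1) by (apply Rabs_le; apply COS_bound). nra. }
  (* The comparison point is [1/2]: the sawtooth error vanishes there by symmetry, and [om / 2] is
     an odd multiple of [PI / 2], so [u] vanishes as well. *)
  assert (Hcosom : cos (om * (1 / 2)) = 0).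
  { replace (om * (1/2)) with (PI / 2 + INR M * PI) by (unfold om; field).
    rewrite cos_plus, cos_PI2. rewrite (Rmult_comm (INR M)), sin_PI_INR. ring. }
  assert (Hu2 : u (1 / 2) = 0) by (unfold u; rewrite sawtooth_err_half, Hcosom; unfold Rdiv; ring).
  assert (Hv2 : v (1 / 2) = - A).
  { unfold v. replace (PI * (1 / 2)) with (PI / 2) by field. rewrite sin_PI2. field. }
  assert (Hmono : forall g dg, (forall x, s <= x <= 1 / 2 -> is_derive g x (dg x)) ->
     (forall x, s <= x <= 1 / 2 -> 0 <= dg x) -> g s <= g (1 / 2)).
  { intros g dg Hg Hp. destruct (Req_dec s (1 / 2)) as [->|Hne]; [lra|].
    destruct (MVT_gen g s (1 / 2) dg) as [c [Hc E]].
    - intros x Hx. rewrite Rmin_left, Rmax_right in Hx by lra. apply Hg; lra.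
    - intros x Hx. rewrite Rmin_left, Rmax_right in Hx by lra.
      apply continuity_pt_filterlim. apply (ex_derive_continuous (K := R_AbsRing) (V := R_NormedModule)).
      eexists. apply Hg; lra.
    - rewrite Rmin_left, Rmax_right in Hc by lra. specialize (Hp c Hc). nra. }
  assert (H1 : v s - u s <= v (1 / 2) - u (1 / 2)).
  { apply (Hmono (fun x => v x - u x) (fun x => dv x - du x)).
    - intros x Hx. apply (is_derive_minus (V := R_NormedModule)); auto.
    - intros x Hx. specialize (Hle x Hx). pose proof (Rle_abs (du x)). lra. }
  assert (H2 : v s + u s <= v (1 / 2) + u (1 / 2)).
  { apply (Hmono (fun x => v x + u x) (fun x => dv x + du x)).
    - intros x Hx. apply (is_derive_plus (V := R_NormedModule)); auto.
    - intros x Hx. specialize (Hle x Hx). pose proof (Rle_abs (- du x)). rewrite Rabs_Ropp in *. lra. }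
  rewrite Hu2, Hv2 in H1, H2.
  specialize (Hsin s ltac:(lra)).
  assert (Ev : v s = - (A * / sin (PI * s))) by (unfold v; field; lra).
  assert (Hom : 0 < om) by (apply Rmult_lt_0_compat; lra).
  assert (Eg : 2 / (om * sin (PI * s)) = 2 * (A * / sin (PI * s))).
  { replace A with (/ om) by reflexivity. field. split; lra. }
  rewrite Eg. set (B := A * / sin (PI * s)) in *.
  assert (Eu : sawtooth_err M s = u s + cos (om * s) * B) by (unfold u, B; field; lra).
  assert (HB : 0 < B) by (apply Rmult_lt_0_compat; auto; apply Rinv_0_lt_compat; auto).
  pose proof (COS_bound (om * s)). rewrite Eu. apply Rabs_le. split; nra.
Qed.

Lemma sawtooth_err_bound_inv M s : 0 < s <= 1 / 2 -> Rabs (sawtooth_err M s) <= / ((2 * INR M + 1) * s).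
Proof.
  intros Hs. eapply Rle_trans; [apply sawtooth_err_bound_far; auto|].
  pose proof PI_RGT_0 as HPI. pose proof PI2_3_2. pose proof (pos_INR M) as HM.
  pose proof (sin_ge_third (PI * s) ltac:(nra)) as Hsin.
  assert (0 < PI * s) by nra.
  unfold Rdiv. apply Rle_trans with (2 * / ((2 * INR M + 1) * 2 * s)).
  - apply Rmult_le_compat_l; [lra|]. apply Rinv_le_contravar; [nra|].
    assert (2 * s <= PI * sin (PI * s)) by nra.
    rewrite !Rmult_assoc. apply Rmult_le_compat_l; nra.
  - right. field. nra.
Qed.

(** The bounds near and far from 0 meet at [(2 M + 1) s = 1], which makes the result independent of
    [M]: the Gibbs overshoot is bounded. *)
Lemma sawtooth_err_bound_half M s : 0 <= s <= 1 / 2 -> Rabs (sawtooth_err M s) <= 3 / 2.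
Proof.
  intros Hs. pose proof (pos_INR M) as HM.
  destruct (Rle_dec ((2 * INR M + 1) * s) 1).
  - eapply Rle_trans; [apply sawtooth_err_bound_near|]. rewrite !Rabs_pos_eq by lra. nra.
  - eapply Rle_trans; [apply sawtooth_err_bound_inv; nra|].
    apply Rle_trans with (/ 1); [|lra]. apply Rinv_le_contravar; lra.
Qed.

Lemma sawtooth_err_bound M s : 0 <= s <= 1 -> Rabs (sawtooth_err M s) <= 3 / 2.
Proof.
  intros Hs. destruct (Rle_dec s (1 / 2)).
  - apply sawtooth_err_bound_half; lra.
  - replace s with (1 - (1 - s)) by ring. rewrite sawtooth_err_sym, Rabs_Ropp. apply sawtooth_err_bound_half; lra.
Qed.

Lemma sawtooth_err_bound_mid M e s : 0 < e -> e <= s <= 1 - e -> Rabs (sawtooth_err M s) <= / ((2 * INR M + 1) * e).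
Proof.
  intros He Hs. pose proof (pos_INR M) as HM.
  assert (H : forall x, e <= x <= 1 / 2 -> Rabs (sawtooth_err M x) <= / ((2 * INR M + 1) * e)).
  { intros x Hx. eapply Rle_trans; [apply sawtooth_err_bound_inv; lra|]. apply Rinv_le_contravar; nra. }
  destruct (Rle_dec s (1 / 2)).
  - apply H; lra.
  - replace s with (1 - (1 - s)) by ring. rewrite sawtooth_err_sym, Rabs_Ropp. apply H; lra.
Qed.

(* Subdivide finely: the quadratic errors add up to something arbitrarily small. *)
Lemma increment_bound (P : R -> C) (a b A B : R) : a <= b -> 0 <= A ->
  (forall x y, a <= x -> x <= y -> y <= b -> Cmod (P y - P x) <= A * (y - x) ^ 2 + B * (y - x)) ->
  Cmod (P b - P a) <= B * (b - a).
Proof.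
  intros Hab HA H. apply le_epsilon. intros eps Heps.
  destruct (nfloor_ex (A * (b - a) ^ 2 / eps)) as [n Hn].
  { apply Rmult_le_pos; [|left; apply Rinv_0_lt_compat; auto]. apply Rmult_le_pos; auto. apply pow2_ge_0. }
  set (m := S n). assert (Hm : 0 < INR m) by (apply lt_0_INR; unfold m; lia).
  set (h := (b - a) / INR m).
  assert (Hh : 0 <= h) by (apply Rmult_le_pos; [lra|left; apply Rinv_0_lt_compat; auto]).
  assert (Hmh : INR m * h = b - a) by (unfold h; field; lra).
  assert (K : forall j, (j <= m)%nat -> Cmod (P (a + INR j * h)%R - P a) <= INR j * (A * h ^ 2 + B * h)).
  { induction j as [|j IH]; intros Hj.
    - simpl. replace (a + 0 * h) with a by ring. replace (P a - P a)%C with (RtoC 0) by ring.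
      rewrite Cmod_0. lra.
    - replace (P (a + INR (S j) * h)%R - P a)%C with
        ((P (a + INR (S j) * h)%R - P (a + INR j * h)%R) + (P (a + INR j * h)%R - P a))%C by ring.
      eapply Rle_trans; [apply Cmod_triangle|].
      specialize (IH ltac:(lia)).
      assert (INR (S j) <= INR m) by (apply le_INR; lia).
      rewrite S_INR in *. pose proof (pos_INR j).
      assert (Hs := H (a + INR j * h) (a + (INR j + 1) * h) ltac:(nra) ltac:(nra) ltac:(nra)).
      replace (a + (INR j + 1) * h - (a + INR j * h)) with h in Hs by ring. lra. }
  specialize (K m (le_n _)). replace (a + INR m * h) with b in K by lra.
  eapply Rle_trans; [exact K|].
  replace (INR m * (A * h ^ 2 + B * h)) with (A * (b - a) * h + B * (b - a)) by (rewrite <- Hmh; ring).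
  assert (A * (b - a) * h <= eps); [|lra].
  unfold h. apply Rmult_le_reg_r with (INR m / eps).
  { apply Rmult_lt_0_compat; auto. apply Rinv_0_lt_compat; auto. }
  replace (A * (b - a) * ((b - a) / INR m) * (INR m / eps)) with (A * (b - a) ^ 2 / eps) by (field; lra).
  replace (eps * (INR m / eps)) with (INR m) by (field; lra).
  unfold m. rewrite S_INR. lra.
Qed.

(** The interval [[-1, 2]] surrounds [[0, 1]], so that continuity at the endpoints 0 and 1 is
    two-sided, as [continuous] demands. *)
Definition Lip_box (f : R -> C) (L : R) : Prop :=
  forall x y, -1 <= x <= 2 -> -1 <= y <= 2 -> Cmod (f x - f y) <= L * Rabs (x - y).

Lemma Lip_continuous_R (f : R -> R) L x d : 0 < d ->
  (forall y, Rabs (y - x) < d -> Rabs (f y - f x) <= L * Rabs (y - x)) -> continuous f x.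
Proof.
  intros Hd H. apply continuity_pt_filterlim. intros e He.
  assert (HK : 0 < Rabs L + 1) by (pose proof (Rabs_pos L); lra).
  exists (Rmin d (e / (Rabs L + 1))). split.
  - apply Rmin_pos; auto. apply Rdiv_lt_0_compat; auto.
  - intros y [_ Hy]. unfold dist in *; simpl in *. unfold R_dist in *.
    pose proof (Rmin_l d (e / (Rabs L + 1))). pose proof (Rmin_r d (e / (Rabs L + 1))).
    eapply Rle_lt_trans; [apply H; lra|].
    apply Rle_lt_trans with (Rabs L * Rabs (y - x)).
    + apply Rmult_le_compat_r; [apply Rabs_pos|apply Rle_abs].
    + apply Rle_lt_trans with ((Rabs L) * (e / (Rabs L + 1))).
      * apply Rmult_le_compat_l; [apply Rabs_pos|lra].
      * apply Rmult_lt_reg_r with (Rabs L + 1); auto.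
        replace (Rabs L * (e / (Rabs L + 1)) * (Rabs L + 1)) with (Rabs L * e) by (field; lra).
        nra.
Qed.

Lemma Lip_Ccont_loc (f : R -> C) L x d : 0 < d ->
  (forall y, Rabs (y - x) < d -> Cmod (f y - f x) <= L * Rabs (y - x)) -> Ccont f x.
Proof.
  intros Hd H. split; apply (Lip_continuous_R _ L x d Hd); intros y Hy.
  - eapply Rle_trans; [|apply H; auto]. eapply Rle_trans; [|apply re_le_Cmod]. right. reflexivity.
  - eapply Rle_trans; [|apply H; auto]. eapply Rle_trans; [|apply im_le_Cmod]. right. reflexivity.
Qed.

Lemma Lip_box_Ccont f L x : Lip_box f L -> -1 < x < 2 -> Ccont f x.
Proof.
  intros H Hx. apply (Lip_Ccont_loc f L x (Rmin (x + 1) (2 - x))).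
  - apply Rmin_pos; lra.
  - intros y Hy. pose proof (Rmin_l (x + 1) (2 - x)). pose proof (Rmin_r (x + 1) (2 - x)).
    apply Rabs_def2 in Hy. apply H; lra.
Qed.

Lemma Lip_box_Ccont_on f L : Lip_box f L -> Ccont_on f 0 1.
Proof. intros H x Hx. apply (Lip_box_Ccont f L); auto; lra. Qed.

Lemma Ccont_dirichlet M x : Ccont (fun s => RtoC (dirichlet M s)) x.
Proof. apply Ccont_RtoC. apply dirichlet_continuous. Qed.

(** In units of [1 / sqrt (M + 1)], the two end pieces in [dirichlet_Lip] contribute [3/2] and the
    middle piece 2, rounded up to 4. The argument uses only that the sequence tends to 0. *)
Definition dirichlet_err (M : nat) : R := 4 / sqrt (INR M + 1).

(** Dirichlet's theorem for a function that is not assumed periodic: the limit is the mean of the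
    two boundary values. Linearity of the error in [L] is essential, because in several variables
    the theorem is applied to functions that themselves depend on [M]. *)
Lemma dirichlet_Lip (f : R -> C) (L : R) (M : nat) : Lip_box f L ->
  Cmod (Cint (fun s => RtoC (dirichlet M s) * f s)%C 0 1 - (f 0%R + f 1%R) / 2) <= dirichlet_err M * L.
Proof.
  intros Hf. pose proof (pos_INR M) as HM.
  assert (HL : 0 <= L).
  { pose proof (Hf 0 1 ltac:(lra) ltac:(lra)) as E. pose proof (Cmod_ge_0 (f 0 - f 1)).
    replace (Rabs (0 - 1)) with 1 in E; [lra|]. rewrite Rabs_left; lra. }
  assert (Hc : Ccont_on (fun s => RtoC (dirichlet M s) * f s)%C 0 1).
  { intros x Hx. apply Ccont_mult; [apply Ccont_dirichlet|]. apply (Lip_box_Ccont f L); auto; lra. }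
  (* An integration by parts that does not differentiate f: the increments of P are of size L |sawtooth_err|. *)
  pose (P := fun x => (Cint (fun s => RtoC (dirichlet M s) * f s) 0 x + f x * RtoC (sawtooth_err M x))%C).
  assert (HS : forall x y, 0 <= x -> x <= y -> y <= 1 ->
     Cint (fun s => RtoC (dirichlet M s)) x y = RtoC (sawtooth_err M x - sawtooth_err M y)).
  { intros x y H0 H1 H2. rewrite (Cint_FTC (fun s => RtoC (- sawtooth_err M s))); auto.
    - apply C_ext; simpl; ring.
    - intros z Hz. apply Cderiv_RtoC. eapply is_derive_eq; [|apply (is_derive_opp (V := R_NormedModule)); apply sawtooth_err_derive].
      unfold opp; simpl; ring.
    - intros z Hz. apply Ccont_dirichlet. }
  assert (Hinc : forall a b B, 0 <= a -> b <= 1 -> (forall s, a <= s <= b -> Rabs (sawtooth_err M s) <= B) ->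
     forall x y, a <= x -> x <= y -> y <= b ->
     Cmod (P y - P x) <= ((2 * INR M + 1) * L) * (y - x) ^ 2 + (L * B) * (y - x)).
  { intros a b B Ha Hb HB x y H0 H1 H2. unfold P.
    rewrite <- (Cint_Chasles _ 0 x y) by (try lra; intros z Hz; apply Hc; lra).
    assert (E : Cint (fun s => RtoC (dirichlet M s) * f s)%C x y =
       (Cint (fun s => RtoC (dirichlet M s) * (f s - f x)) x y + f x * RtoC (sawtooth_err M x - sawtooth_err M y))%C).
    { rewrite <- HS by lra. rewrite <- Cint_scal; [|lra|intros z Hz; apply Ccont_dirichlet].
      rewrite <- Cint_plus; [|lra| |].
      - apply Cint_ext; [lra|]. intros z _. ring.
      - intros z Hz. apply Ccont_mult; [apply Ccont_dirichlet|]. apply Ccont_minus; [|apply Ccont_const]. apply (Lip_box_Ccont f L); auto; lra.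
      - intros z Hz. apply Ccont_mult; [apply Ccont_const|apply Ccont_dirichlet]. }
    rewrite E, RtoC_minus.
    match goal with |- Cmod ?z <= _ => replace z with
      (Cint (fun s => RtoC (dirichlet M s) * (f s - f x)) x y + (f y - f x) * RtoC (sawtooth_err M y))%C by ring end.
    eapply Rle_trans; [apply Cmod_triangle|]. apply Rplus_le_compat.
    - eapply Rle_trans; [apply (Cint_norm_le_const _ ((2 * INR M + 1) * (L * (y - x))))|].
      + lra.
      + intros z Hz. apply Ccont_mult; [apply Ccont_dirichlet|]. apply Ccont_minus; [|apply Ccont_const]. apply (Lip_box_Ccont f L); auto; lra.
      + intros z Hz. rewrite Cmod_RtoC_mult. apply Rmult_le_compat; try apply Rabs_pos; try apply Cmod_ge_0.
        * apply dirichlet_bound.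
        * eapply Rle_trans; [apply Hf; lra|]. apply Rmult_le_compat_l; auto. rewrite Rabs_pos_eq; lra.
      + simpl. nra.
    - rewrite Cmod_mult, Cmod_R.
      replace (L * B * (y - x)) with ((L * (y - x)) * B) by ring.
      apply Rmult_le_compat; try apply Cmod_ge_0; try apply Rabs_pos.
      + eapply Rle_trans; [apply Hf; lra|]. apply Rmult_le_compat_l; auto. rewrite Rabs_pos_eq; lra.
      + apply HB; lra. }
  set (q := sqrt (INR M + 1)).
  assert (Hq2 : q * q = INR M + 1) by (apply sqrt_sqrt; lra).
  assert (Hq : 1 <= q) by (rewrite <- sqrt_1; apply sqrt_le_1_alt; lra).
  (* Within distance [e] of the ends the sawtooth error is merely bounded, in the middle it is of
     order [1 / (M e)]. Taking [e] of order [1 / sqrt M] balances the two. *)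
  set (e := / (2 * q)).
  assert (He : 0 < e) by (apply Rinv_0_lt_compat; lra).
  assert (He2 : e <= 1 / 2).
  { unfold e. replace (1 / 2) with (/ (2 * 1)) by field. apply Rinv_le_contravar; lra. }
  assert (HA : 0 <= (2 * INR M + 1) * L) by nra.
  assert (E1 : Cmod (P e - P 0) <= L * (3 / 2) * (e - 0)).
  { apply (increment_bound _ _ _ ((2 * INR M + 1) * L)); auto; [lra|].
    apply Hinc; try lra. intros s Hs. apply sawtooth_err_bound; lra. }
  assert (E2 : Cmod (P (1 - e) - P e) <= L * (/ ((2 * INR M + 1) * e)) * (1 - e - e)).
  { apply (increment_bound _ _ _ ((2 * INR M + 1) * L)); auto; [lra|].
    apply Hinc; try lra. intros s Hs. apply sawtooth_err_bound_mid; lra. }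
  assert (E3 : Cmod (P 1 - P (1 - e)) <= L * (3 / 2) * (1 - (1 - e))).
  { apply (increment_bound _ _ _ ((2 * INR M + 1) * L)); auto; [lra|].
    apply Hinc; try lra. intros s Hs. apply sawtooth_err_bound; lra. }
  (* The boundary values [1/2] and [-1/2] of the sawtooth error turn the increment of [P] over
     [[0, 1]] into the integral minus the mean of the boundary values. *)
  assert (EP : (Cint (fun s => RtoC (dirichlet M s) * f s) 0 1 - (f 0%R + f 1%R) / 2)%C = (P 1%R - P 0%R)%C).
  { unfold P. rewrite sawtooth_err_1, sawtooth_err_0. rewrite Cint_point.
    replace (RtoC (- (1 / 2))) with (- / 2)%C by (apply C_ext; simpl; field).
    replace (RtoC (1 / 2)) with (/ 2)%C by (apply C_ext; simpl; field).
    field. }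
  rewrite EP.
  replace (P 1%R - P 0%R)%C with ((P 1%R - P (1 - e)%R) + ((P (1 - e)%R - P e) + (P e - P 0%R)))%C by ring.
  eapply Rle_trans; [apply Cmod_triangle|].
  eapply Rle_trans; [apply Rplus_le_compat_l; apply Cmod_triangle|].
  assert (HI : / ((2 * INR M + 1) * e) <= 2 / q).
  { apply Rle_trans with (/ ((INR M + 1) * e)).
    - apply Rinv_le_contravar; nra.
    - unfold e. rewrite <- Hq2. right. field. lra. }
  assert (HI' : L * / ((2 * INR M + 1) * e) * (1 - e - e) <= L * (2 / q)).
  { assert (0 < / ((2 * INR M + 1) * e)) by (apply Rinv_0_lt_compat; nra).
    rewrite Rmult_assoc. apply Rmult_le_compat_l; auto. nra. }
  unfold dirichlet_err. fold q.
  assert (Hqe : e = 1 / 2 * / q) by (unfold e; field; lra).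
  assert (0 < / q) by (apply Rinv_0_lt_compat; lra).
  unfold Rdiv in *. nra.
Qed.

Lemma dirichlet_err_pos M : 0 < dirichlet_err M.
Proof. apply Rdiv_lt_0_compat; [lra|]. apply sqrt_lt_R0. pose proof (pos_INR M); lra. Qed.

Lemma dirichlet_err_lim : is_lim_seq dirichlet_err 0.
Proof.
  apply is_lim_seq_spec. intros eps. 
  destruct (nfloor_ex ((4 / eps) ^ 2)) as [n Hn]; [apply pow2_ge_0|].
  exists n. intros M HMn. pose proof (dirichlet_err_pos M) as Hp. rewrite Rminus_0_r, Rabs_pos_eq by lra.
  unfold dirichlet_err. pose proof (cond_pos eps) as He.
  assert (H : (4 / eps) ^ 2 < INR M + 1) by (apply le_INR in HMn; lra).
  assert (H0 : 0 < 4 / eps) by (apply Rdiv_lt_0_compat; lra).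
  assert (H1 : 4 / eps < sqrt (INR M + 1)).
  { rewrite <- (sqrt_pow2 (4 / eps)) by lra. apply sqrt_lt_1_alt. split; [apply pow2_ge_0|auto]. }
  apply Rmult_lt_reg_r with (sqrt (INR M + 1)); [lra|].
  replace (4 / sqrt (INR M + 1) * sqrt (INR M + 1)) with (4 / eps * eps) by (field; lra).
  rewrite Rmult_comm. apply Rmult_lt_compat_l; auto.
Qed.

(** * Poisson summation on a cube *)

Lemma upd_comm {A} (g : nat -> A) i j x y : i <> j -> upd (upd g i x) j y = upd (upd g j y) i x.
Proof.
  intros H. apply functional_extensionality. intros l. unfold upd.
  destruct (Nat.eqb_spec l i); destruct (Nat.eqb_spec l j); subst; congruence.
Qed.

Lemma upd_same {A} (g : nat -> A) i x : upd g i x i = x.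
Proof. unfold upd. rewrite Nat.eqb_refl. reflexivity. Qed.

Lemma upd_other {A} (g : nat -> A) i x l : l <> i -> upd g i x l = g l.
Proof. intros H. unfold upd. destruct (Nat.eqb_spec l i); congruence. Qed.

Definition slice {A B} (F : (nat -> A) -> B) (d : nat) (y : A) : (nat -> A) -> B :=
  fun g => F (upd g d y).

Definition in_box (g : nat -> R) : Prop := forall i, -1 <= g i <= 2.

(* All mixed differences of order at most one in each of the first d variables
   are bounded by B times the product of the increments. *)
Fixpoint mixed_Lip (d : nat) (F : (nat -> R) -> C) (B : R) : Prop :=
  match d with
  | O => forall g, in_box g -> Cmod (F g) <= B
  | S d' =>
      (forall y, -1 <= y <= 2 -> mixed_Lip d' (slice F d' y) B) /\
      (forall y1 y2, -1 <= y1 <= 2 -> -1 <= y2 <= 2 ->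
         mixed_Lip d' (fun g => slice F d' y1 g - slice F d' y2 g)%C (B * Rabs (y1 - y2)))
  end.

Lemma mixed_Lip_ext d F G B : (forall g, F g = G g) -> mixed_Lip d F B -> mixed_Lip d G B.
Proof. intros H. replace G with F; auto. apply functional_extensionality; auto. Qed.

Lemma mixed_Lip_le d F B B' : B <= B' -> mixed_Lip d F B -> mixed_Lip d F B'.
Proof.
  revert F B B'. induction d as [|d IH]; intros F B B' Hle H; simpl in *.
  - intros g Hg. specialize (H g Hg). lra.
  - destruct H as [H1 H2]. split; intros.
    + eapply IH; [|apply H1; auto]; auto.
    + eapply IH; [|apply H2; auto]. apply Rmult_le_compat_r; auto. apply Rabs_pos.
Qed.

Lemma mixed_Lip_bound d F B g : mixed_Lip d F B -> in_box g -> Cmod (F g) <= B.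
Proof.
  revert F g. induction d as [|d IH]; intros F g H Hg; simpl in *; auto.
  destruct H as [H _]. specialize (IH _ g (H (g d) (Hg d)) Hg). unfold slice in IH.
  replace (upd g d (g d)) with g in IH; auto.
  apply functional_extensionality. intros l. unfold upd. destruct (Nat.eqb_spec l d); subst; auto.
Qed.

Lemma mixed_Lip_nonneg d F B : mixed_Lip d F B -> 0 <= B.
Proof.
  intros H. pose proof (mixed_Lip_bound d F B (fun _ => 0) H ltac:(intros i; lra)).
  pose proof (Cmod_ge_0 (F (fun _ => 0))). lra.
Qed.

Lemma mixed_Lip_plus d F G B B' : mixed_Lip d F B -> mixed_Lip d G B' -> mixed_Lip d (fun g => F g + G g)%C (B + B').
Proof.
  revert F G B B'. induction d as [|d IH]; intros F G B B' HF HG; simpl in *.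
  - intros g Hg. eapply Rle_trans; [apply Cmod_triangle|]. specialize (HF g Hg). specialize (HG g Hg). lra.
  - destruct HF as [F1 F2], HG as [G1 G2]. split; intros.
    + apply (IH (slice F d y) (slice G d y)); auto.
    + rewrite Rmult_plus_distr_r.
      eapply mixed_Lip_ext; [|apply IH; [apply F2 | apply G2]]; eauto. intros g. unfold slice. simpl. ring.
Qed.

Lemma mixed_Lip_scal d (c : C) F B : mixed_Lip d F B -> mixed_Lip d (fun g => c * F g)%C (Cmod c * B).
Proof.
  revert F B. induction d as [|d IH]; intros F B HF; simpl in *.
  - intros g Hg. rewrite Cmod_mult. apply Rmult_le_compat_l; auto. apply Cmod_ge_0.
  - destruct HF as [F1 F2]. split; intros.
    + apply (IH (slice F d y)); auto.
    + rewrite Rmult_assoc. eapply mixed_Lip_ext; [|apply IH; apply F2]; eauto.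
      intros g. unfold slice. simpl. ring.
Qed.

(** The discrete product rule [F1 G1 - F2 G2 = (F1 - F2) G1 + F2 (G1 - G2)] splits every difference
    in two, whence a factor 2 for each variable. *)
Lemma mixed_Lip_mult d F G B B' : mixed_Lip d F B -> mixed_Lip d G B' -> mixed_Lip d (fun g => F g * G g)%C (2 ^ d * (B * B')).
Proof.
  revert F G B B'. induction d as [|d IH]; intros F G B B' HF HG.
  - simpl in *. intros g Hg. rewrite Cmod_mult, Rmult_1_l.
    apply Rmult_le_compat; auto; apply Cmod_ge_0.
  - pose proof (mixed_Lip_nonneg _ _ _ HF) as HB. pose proof (mixed_Lip_nonneg _ _ _ HG) as HB'.
    destruct HF as [F1 F2], HG as [G1 G2].
    assert (H2 : 0 <= 2 ^ d) by (apply pow_le; lra).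
    split; intros.
    + eapply mixed_Lip_le; [|apply (IH (slice F d y) (slice G d y)); eauto]. simpl.
      apply Rmult_le_compat_r; [apply Rmult_le_pos; auto|]. lra.
    + eapply mixed_Lip_ext; [|eapply mixed_Lip_le; [|apply mixed_Lip_plus;
        [apply (IH (fun g => slice F d y1 g - slice F d y2 g)%C (slice G d y1)); [apply (F2 y1 y2); auto|apply G1; auto]
        |apply (IH (slice F d y2) (fun g => slice G d y1 g - slice G d y2 g)%C); [apply F1; auto|apply (G2 y1 y2); auto]]]].
      * intros g. unfold slice. simpl. ring.
      * simpl. right. ring.
Qed.

Lemma mixed_Lip_const d (c : C) : mixed_Lip d (fun _ => c) (Cmod c).
Proof.
  assert (H0 : forall d B, 0 <= B -> mixed_Lip d (fun _ => RtoC 0) B).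
  { induction d0 as [|e IH]; intros B HB; simpl.
    - intros. rewrite Cmod_0; auto.
    - split; intros; [apply IH; auto|].
      eapply mixed_Lip_ext; [|apply IH; apply Rmult_le_pos; [exact HB|apply Rabs_pos]].
      intros g. unfold slice. simpl. ring. }
  induction d as [|d IH]; simpl; [intros; lra|].
  split; intros; [apply IH|].
  eapply mixed_Lip_ext; [|apply H0; apply Rmult_le_pos; [apply Cmod_ge_0|apply Rabs_pos]].
  intros g. unfold slice. simpl. ring.
Qed.

Lemma mixed_Lip_zero d B : 0 <= B -> mixed_Lip d (fun _ => RtoC 0) B.
Proof. intros H. eapply mixed_Lip_le; [|apply mixed_Lip_const]. rewrite Cmod_0; auto. Qed.

Lemma mixed_Lip_one_var d (h : R -> C) (B : R) (p : nat) : Lip_box h B ->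
  (forall x, -1 <= x <= 2 -> Cmod (h x) <= B) -> mixed_Lip d (fun g => h (g p)) B.
Proof.
  intros Hl Hb. induction d as [|d IH].
  - intros g Hg. apply Hb. apply Hg.
  - destruct (Nat.eq_dec p d) as [->|Hne]; split; intros.
    + eapply mixed_Lip_ext; [|eapply mixed_Lip_le; [apply (Hb y); auto|apply mixed_Lip_const]].
      intros g. unfold slice. rewrite upd_same. reflexivity.
    + eapply mixed_Lip_ext; [|eapply mixed_Lip_le; [apply (Hl y1 y2); auto|apply mixed_Lip_const]].
      intros g. unfold slice. rewrite !upd_same. reflexivity.
    + eapply mixed_Lip_ext; [|exact IH]. intros g. unfold slice. rewrite upd_other; auto.
    + eapply mixed_Lip_ext; [|apply mixed_Lip_zero].
      * intros g. unfold slice. rewrite !upd_other; auto. ring.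
      * apply Rmult_le_pos; [|apply Rabs_pos]. apply (mixed_Lip_nonneg d _ _ IH).
Qed.

(** Each factor of a crossing weight depends on at most two of the variables, so this case and
    products cover the whole integrand. The last hypothesis is the mixed difference in both
    variables; a difference in any third variable vanishes. *)
Lemma mixed_Lip_two_var d (h : R -> R -> C) (B : R) (p q : nat) : p <> q ->
  (forall x y, -1 <= x <= 2 -> -1 <= y <= 2 -> Cmod (h x y) <= B) ->
  (forall x, -1 <= x <= 2 -> Lip_box (h x) B) ->
  (forall y, -1 <= y <= 2 -> Lip_box (fun x => h x y) B) ->
  (forall x x', -1 <= x <= 2 -> -1 <= x' <= 2 -> Lip_box (fun y => h x y - h x' y)%C (B * Rabs (x - x'))) ->
  mixed_Lip d (fun g => h (g p) (g q)) B.
Proof.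
  intros Hpq Hb H1 H2 H12. induction d as [|d IH].
  - intros g Hg. apply Hb; apply Hg.
  - destruct (Nat.eq_dec p d) as [->|Hp]; [|destruct (Nat.eq_dec q d) as [->|Hq]]; split; intros.
    + eapply mixed_Lip_ext; [|apply (mixed_Lip_one_var d (h y) B q); auto].
      intros g. unfold slice. rewrite upd_same, upd_other; auto.
    + eapply mixed_Lip_ext; [|apply (mixed_Lip_one_var d (fun z => h y1 z - h y2 z)%C _ q); auto].
      * intros g. unfold slice. rewrite !upd_same, !upd_other; auto.
      * intros x Hx. apply H2; auto.
    + eapply mixed_Lip_ext; [|apply (mixed_Lip_one_var d (fun z => h z y) B p); auto].
      intros g. unfold slice. rewrite upd_same, upd_other; auto.
    + eapply mixed_Lip_ext; [|apply (mixed_Lip_one_var d (fun z => h z y1 - h z y2)%C _ p); auto].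
      * intros g. unfold slice. rewrite !upd_same, !upd_other; auto.
      * intros x x' Hx Hx'. specialize (H12 x x' Hx Hx' y1 y2 H H0).
        replace (h x y1 - h x y2 - (h x' y1 - h x' y2))%C with
          (h x y1 - h x' y1 - (h x y2 - h x' y2))%C by ring. lra.
      * intros x Hx. apply H1; auto.
    + eapply mixed_Lip_ext; [|exact IH]. intros g. unfold slice. rewrite !upd_other; auto.
    + eapply mixed_Lip_ext; [|apply mixed_Lip_zero].
      * intros g. unfold slice. rewrite !upd_other; auto. ring.
      * apply Rmult_le_pos; [|apply Rabs_pos]. apply (mixed_Lip_nonneg d _ _ IH).
Qed.

(** One weight per variable. With exponentials as weights this is a Fourier coefficient, with
    Dirichlet kernels a partial sum of the Fourier series over a cube; treating both at once avoids
    two parallel theories of iterated integrals. *)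
Fixpoint kernel_int (K : nat -> R -> C) (d : nat) (F : (nat -> R) -> C) (g : nat -> R) : C :=
  match d with
  | O => F g
  | S d' => Cint (fun y => K d' y * kernel_int K d' F (upd g d' y))%C 0 1
  end.

Lemma kernel_int_slice K d F g e y : (d <= e)%nat -> kernel_int K d F (upd g e y) = kernel_int K d (slice F e y) g.
Proof.
  revert g. induction d as [|d IH]; intros g Hd; simpl; [reflexivity|].
  apply Cint_ext; [lra|]. intros x _. rewrite upd_comm by lia. rewrite IH by lia. reflexivity.
Qed.

Lemma kernel_int_S K d F g : kernel_int K (S d) F g = Cint (fun y => K d y * kernel_int K d (slice F d y) g)%C 0 1.
Proof. simpl. apply Cint_ext; [lra|]. intros x _. rewrite kernel_int_slice by lia. reflexivity. Qed.

Definition kernel_ok (K : nat -> R -> C) (kap : R) : Prop :=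
  0 <= kap /\ (forall i x, Ccont (K i) x) /\ (forall i x, 0 <= x <= 1 -> Cmod (K i x) <= kap).

(** The three claims must be proved together. Linearity of the outer integral needs continuity of
    the inner one; this is a Lipschitz estimate, obtained by applying the bound and linearity in one
    dimension less to a difference of slices. *)
Lemma kernel_int_bound_linear K kap d : kernel_ok K kap ->
  (forall F B g, mixed_Lip d F B -> in_box g -> Cmod (kernel_int K d F g) <= kap ^ d * B) /\
  (forall F G B B' g, mixed_Lip d F B -> mixed_Lip d G B' -> in_box g ->
     kernel_int K d (fun t => F t - G t)%C g = (kernel_int K d F g - kernel_int K d G g)%C) /\
  (forall c F B g, mixed_Lip d F B -> in_box g -> kernel_int K d (fun t => c * F t)%C g = (c * kernel_int K d F g)%C).
Proof.
  intros [Hk [Kc Kb]]. induction d as [|d [IHb [IHl IHs]]].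
  - simpl. split; [|split]; auto. intros. rewrite Rmult_1_l. auto.
  - assert (Hlip : forall F B g, mixed_Lip (S d) F B -> in_box g ->
       Lip_box (fun y => kernel_int K d (slice F d y) g) (kap ^ d * B)).
    { intros F B g [H1 H2] Hg x y Hx Hy.
      rewrite <- (IHl _ _ B B) by auto. rewrite Rmult_assoc. apply IHb; auto. }
    assert (Hcc : forall F B g, mixed_Lip (S d) F B -> in_box g ->
       Ccont_on (fun y => K d y * kernel_int K d (slice F d y) g)%C 0 1).
    { intros F B g HF Hg x Hx. apply Ccont_mult; auto. apply (Lip_box_Ccont _ (kap ^ d * B)); [|lra]. apply Hlip; auto. }
    split; [|split].
    + intros F B g HF Hg. rewrite kernel_int_S. pose proof (mixed_Lip_nonneg _ _ _ HF).
      replace (kap ^ S d * B) with ((1 - 0) * (kap * (kap ^ d * B))) by (simpl; ring).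
      apply Cint_norm_le_const; [lra|apply (Hcc F B); auto|].
      intros x Hx. rewrite Cmod_mult. apply Rmult_le_compat; try apply Cmod_ge_0; auto.
      apply IHb; auto. apply HF; lra.
    + intros F G B B' g HF HG Hg. rewrite !kernel_int_S.
      rewrite <- Cint_minus; [|lra|apply (Hcc F B); auto|apply (Hcc G B'); auto].
      apply Cint_ext; [lra|]. intros x Hx.
      change (slice (fun t => F t - G t)%C d x) with (fun t => slice F d x t - slice G d x t)%C.
      rewrite (IHl _ _ B B'); auto; [|apply HF; lra|apply HG; lra].
      change (@eq C (K d x * (kernel_int K d (slice F d x) g - kernel_int K d (slice G d x) g))%C
        (K d x * kernel_int K d (slice F d x) g - K d x * kernel_int K d (slice G d x) g)%C). ring.
    + intros c F B g HF Hg. rewrite !kernel_int_S.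
      rewrite <- Cint_scal; [|lra|apply (Hcc F B); auto].
      apply Cint_ext; [lra|]. intros x Hx.
      change (slice (fun t => c * F t)%C d x) with (fun t => c * slice F d x t)%C.
      rewrite (IHs c _ B); auto; [|apply HF; lra].
      change (@eq C (K d x * (c * kernel_int K d (slice F d x) g))%C
        (c * (K d x * kernel_int K d (slice F d x) g))%C). ring.
Qed.

Lemma kernel_int_Lip_box K kap d F B g : kernel_ok K kap -> mixed_Lip (S d) F B -> in_box g ->
  Lip_box (fun y => kernel_int K d (slice F d y) g) (kap ^ d * B).
Proof.
  intros HK [H1 H2] Hg x y Hx Hy. destruct (kernel_int_bound_linear K kap d HK) as [IHb [IHl _]].
  rewrite <- (IHl _ _ B B) by auto. rewrite Rmult_assoc. apply IHb; auto.
Qed.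

Lemma kernel_int_Ccont K kap d F B g x : kernel_ok K kap -> mixed_Lip (S d) F B -> in_box g -> -1 < x < 2 ->
  Ccont (fun y => kernel_int K d F (upd g d y)) x.
Proof.
  intros HK HF Hg Hx. apply (Ccont_ext (fun y => kernel_int K d (slice F d y) g)).
  - intros u. rewrite kernel_int_slice by lia. reflexivity.
  - eapply Lip_box_Ccont; [apply (kernel_int_Lip_box K kap d F B); auto|auto].
Qed.

(** * Finite sums over ranges and cubes, and their exchange with integrals *)

Lemma csum_ext n f h : (forall a, (a < n)%nat -> f a = h a) -> csum_range n f = csum_range n h.
Proof. induction n as [|n IH]; simpl; intros H; auto. rewrite IH, H; auto. Qed.

Lemma csum_scal n c f : csum_range n (fun a => c * f a)%C = (c * csum_range n f)%C.
Proof. induction n as [|n IH]; simpl; [ring|]. rewrite IH. ring. Qed.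

Lemma csum_plus n f h : csum_range n (fun a => f a + h a)%C = (csum_range n f + csum_range n h)%C.
Proof. induction n as [|n IH]; simpl; [ring|]. rewrite IH. ring. Qed.

Lemma csum_shift n f : csum_range (S n) f = (f O + csum_range n (fun a => f (S a)))%C.
Proof.
  induction n as [|n IH]; [simpl; ring|].
  change (csum_range (S (S n)) f) with (csum_range (S n) f + f (S n))%C. rewrite IH. simpl. ring.
Qed.

Lemma csum_bound n f B : (forall a, (a < n)%nat -> Cmod (f a) <= B) -> Cmod (csum_range n f) <= INR n * B.
Proof.
  induction n as [|n IH]; intros H.
  - simpl. rewrite Cmod_0. lra.
  - simpl csum_range. eapply Rle_trans; [apply Cmod_triangle|]. rewrite S_INR.
    specialize (IH ltac:(intros; apply H; lia)). specialize (H n ltac:(lia)). lra.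
Qed.

Lemma csum_Ccont n (f : nat -> R -> C) x : (forall a, Ccont (f a) x) -> Ccont (fun y => csum_range n (fun a => f a y)) x.
Proof. intros H. induction n as [|n IH]; simpl; [apply Ccont_const|]. apply Ccont_plus; auto. Qed.

Lemma csum_Cint n (f : nat -> R -> C) a b : a <= b -> (forall k, Ccont_on (f k) a b) ->
  csum_range n (fun k => Cint (f k) a b) = Cint (fun y => csum_range n (fun k => f k y)) a b.
Proof.
  intros Hab H. induction n as [|n IH]; simpl.
  - rewrite Cint_const. ring.
  - rewrite IH, Cint_plus; auto. intros x Hx. apply csum_Ccont. intros k. apply H; auto.
Qed.

Lemma cube_sumZ_slice M d Phi k e z : (d <= e)%nat ->
  cube_sumZ M d Phi (upd k e z) = cube_sumZ M d (slice Phi e z) k.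
Proof.
  revert k. induction d as [|d IH]; intros k Hd; simpl cube_sumZ; [reflexivity|].
  apply csum_ext. intros a _. rewrite upd_comm by lia. apply IH. lia.
Qed.

Lemma cube_sumZ_ext M d (Phi Psi : (nat -> Z) -> C) k : (forall k, Phi k = Psi k) ->
  cube_sumZ M d Phi k = cube_sumZ M d Psi k.
Proof. intros H. replace Psi with Phi; auto. apply functional_extensionality; auto. Qed.

Lemma cube_sumZ_scal M d c Phi k : cube_sumZ M d (fun k => c * Phi k)%C k = (c * cube_sumZ M d Phi k)%C.
Proof.
  revert k. induction d as [|d IH]; intros k; simpl cube_sumZ; [reflexivity|].
  rewrite <- csum_scal. apply csum_ext. auto.
Qed.

Lemma cube_sumZ_Ccont M d (f : (nat -> Z) -> R -> C) x k : (forall k, Ccont (f k) x) ->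
  Ccont (fun y => cube_sumZ M d (fun k => f k y) k) x.
Proof.
  intros H. revert k. induction d as [|d IH]; intros k; simpl cube_sumZ; [apply H|].
  apply csum_Ccont. intros a. apply IH.
Qed.

Lemma cube_sumZ_Cint M d (f : (nat -> Z) -> R -> C) k : (forall k, Ccont_on (f k) 0 1) ->
  cube_sumZ M d (fun k => Cint (f k) 0 1) k = Cint (fun y => cube_sumZ M d (fun k => f k y) k) 0 1.
Proof.
  intros H. revert k. induction d as [|d IH]; intros k; simpl cube_sumZ; [reflexivity|].
  rewrite <- csum_Cint; [|lra|].
  - apply csum_ext. auto.
  - intros a x Hx. apply cube_sumZ_Ccont. intros k'. apply H; auto.
Qed.

Definition ker_exp (N : nat) (k : nat -> Z) (i : nat) (y : R) : C :=
  cexp (- (twopii * RtoC (INR N) * RtoC (IZR (k i) * y))).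
Definition ker_dir (N M : nat) (i : nat) (y : R) : C := RtoC (dirichlet M (INR N * y)).

Lemma ker_exp_ok N k : kernel_ok (ker_exp N k) 1.
Proof.
  split; [lra|split].
  - intros i x. apply Ccont_cexp. apply Ccont_opp. apply Ccont_mult; [apply Ccont_const|].
    apply Ccont_RtoC. cont_of_derive.
  - intros i x _. unfold ker_exp. rewrite Cmod_cexp. right. rewrite <- exp_0. f_equal.
    unfold twopii. simpl. ring.
Qed.

(** This bound grows with [M]. It secures continuity and linearity of the iterated integrals, while
    the convergence estimate rests on [dirichlet_Lip]. *)
Lemma ker_dir_ok N M : kernel_ok (ker_dir N M) (2 * INR M + 1).
Proof.
  pose proof (pos_INR M). split; [lra|split].
  - intros i x. apply Ccont_RtoC. apply (continuous_comp (fun y => INR N * y) (dirichlet M)); [|apply dirichlet_continuous].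
    cont_of_derive.
  - intros i x _. unfold ker_dir. rewrite Cmod_R. apply dirichlet_bound.
Qed.

Lemma cexp_conj_sum (x : R) : (cexp (- (twopii * RtoC x)) + cexp (twopii * RtoC x))%C = RtoC (2 * cos (2 * PI * x)).
Proof.
  unfold cexp. apply C_ext; simpl; unfold twopii; simpl.
  - replace (- ((2 * PI - 0 * 0) * 0 - (2 * 0 + 0 * PI) * 1) * x) with 0 by ring.
    match goal with |- exp ?a * cos ?b + exp ?c * cos ?d = _ =>
      replace a with 0 by ring; replace c with 0 by ring;
      replace b with (- (2 * PI * x)) by ring; replace d with (2 * PI * x) by ring end.
    rewrite cos_neg, exp_0. ring.
  - match goal with |- exp ?a * sin ?b + exp ?c * sin ?d = _ =>
      replace a with 0 by ring; replace c with 0 by ring;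
      replace b with (- (2 * PI * x)) by ring; replace d with (2 * PI * x) by ring end.
    rewrite sin_neg, exp_0. ring.
Qed.

(** The index runs from 0 to [2 M], so the frequency runs from [-M] to [M]. Passing to [M + 1] adds
    one term at each end, and the two conjugate exponentials combine into a cosine. *)
Lemma csum_dirichlet M (x : R) :
  csum_range (2 * M + 1) (fun a => cexp (- (twopii * RtoC (IZR (Z.of_nat a - Z.of_nat M) * x)))) = RtoC (dirichlet M x).
Proof.
  induction M as [|M IH].
  - cbn. replace (IZR 0 * x) with 0 by ring. replace (- (twopii * 0))%C with (RtoC 0) by ring. rewrite cexp_0. ring.
  - replace (2 * S M + 1)%nat with (S (S (2 * M + 1))) by lia.
    rewrite csum_shift.
    change (csum_range (S (2 * M + 1)) ?f) with (csum_range (2 * M + 1) f + f (2 * M + 1)%nat)%C.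
    cbv beta.
    rewrite (csum_ext _ _ (fun a => cexp (- (twopii * RtoC (IZR (Z.of_nat a - Z.of_nat M) * x))))).
    2:{ intros a _. replace (Z.of_nat (S a) - Z.of_nat (S M))%Z with (Z.of_nat a - Z.of_nat M)%Z by lia. reflexivity. }
    rewrite IH.
    replace (Z.of_nat 0 - Z.of_nat (S M))%Z with (- Z.of_nat (S M))%Z by lia.
    replace (Z.of_nat (S (2 * M + 1)) - Z.of_nat (S M))%Z with (Z.of_nat (S M)) by lia.
    change (dirichlet (S M) x) with (dirichlet M x + 2 * cos (2 * PI * INR (S M) * x)).
    rewrite RtoC_plus. replace (2 * PI * INR (S M) * x) with (2 * PI * (INR (S M) * x)) by ring.
    rewrite <- cexp_conj_sum. rewrite opp_IZR, <- INR_IZR_INZ.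
    replace (RtoC (- INR (S M) * x)) with (- RtoC (INR (S M) * x))%C by (apply C_ext; simpl; ring).
    replace (- (twopii * - RtoC (INR (S M) * x)))%C with (twopii * RtoC (INR (S M) * x))%C by ring.
    ring.
Qed.

Lemma kernel_int_ker_exp_indep N d F g k e z : (d <= e)%nat -> kernel_int (ker_exp N (upd k e z)) d F g = kernel_int (ker_exp N k) d F g.
Proof.
  revert g. induction d as [|d IH]; intros g Hd; [reflexivity|]. simpl.
  apply Cint_ext; [lra|]. intros x _. rewrite IH by lia. f_equal. unfold ker_exp. rewrite upd_other by lia. reflexivity.
Qed.

(** The sum over a cube of frequencies acts on each variable separately, so it can be carried under
    the integrals one variable at a time, turning each exponential into a Dirichlet kernel. *)
Lemma cube_sumZ_kernel_int N M d F B g k : mixed_Lip d F B -> in_box g ->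
  cube_sumZ M d (fun k => kernel_int (ker_exp N k) d F g) k = kernel_int (ker_dir N M) d F g.
Proof.
  revert F B g k. induction d as [|d IH]; intros F B g k HF Hg; [reflexivity|].
  change (cube_sumZ M (S d) ?P k) with
    (csum_range (2 * M + 1) (fun a => cube_sumZ M d P (upd k d (Z.of_nat a - Z.of_nat M)%Z))).
  pose (E := fun (z : Z) y => cexp (- (twopii * RtoC (INR N) * RtoC (IZR z * y)))).
  assert (HE : forall z x, Ccont (E z) x).
  { intros z x. apply (proj1 (proj2 (ker_exp_ok N (fun _ => z))) O x). }
  rewrite (csum_ext _ _ (fun a => Cint (fun y => E (Z.of_nat a - Z.of_nat M)%Z y * kernel_int (ker_dir N M) d F (upd g d y))%C 0 1)).
  - rewrite csum_Cint; [|lra|].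
    + simpl. apply Cint_ext; [lra|]. intros y Hy.
      rewrite (csum_ext _ _ (fun a => kernel_int (ker_dir N M) d F (upd g d y) * E (Z.of_nat a - Z.of_nat M)%Z y)%C) by (intros; ring).
      rewrite csum_scal. rewrite Cmult_comm. f_equal. unfold ker_dir. rewrite <- csum_dirichlet.
      apply csum_ext. intros a _. unfold E. f_equal. f_equal.
      rewrite <- Cmult_assoc. f_equal. rewrite <- RtoC_mult. f_equal. ring.
    + intros a x Hx. apply Ccont_mult; auto. apply (kernel_int_Ccont _ (2 * INR M + 1) d F B); auto; [apply ker_dir_ok|lra].
  - intros a _. set (z := (Z.of_nat a - Z.of_nat M)%Z).
    rewrite cube_sumZ_slice by lia.
    rewrite (cube_sumZ_ext _ _ _ (fun k' => Cint (fun y => E z y * kernel_int (ker_exp N k') d F (upd g d y))%C 0 1)).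
    2:{ intros k'. unfold slice. simpl. apply Cint_ext; [lra|]. intros x _. rewrite kernel_int_ker_exp_indep by lia.
        f_equal. unfold ker_exp. rewrite upd_same. reflexivity. }
    rewrite cube_sumZ_Cint.
    + apply Cint_ext; [lra|]. intros y Hy. rewrite cube_sumZ_scal. f_equal.
      rewrite kernel_int_slice by lia. destruct HF as [HF _].
      rewrite <- (IH (slice F d y) B g k); auto; [|apply HF; lra].
      apply cube_sumZ_ext. intros k'. apply kernel_int_slice. lia.
    + intros k' x Hx. apply Ccont_mult; auto. apply (kernel_int_Ccont _ 1 d F B); auto; [apply ker_exp_ok|lra].
Qed.

Lemma cube_int_S d F g : cube_int (S d) F g = Cint (fun y => cube_int d F (upd g d y)) 0 1.
Proof. reflexivity. Qed.

Lemma cube_int_slice d F g e y : (d <= e)%nat -> cube_int d F (upd g e y) = cube_int d (slice F e y) g.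
Proof.
  revert g. induction d as [|d IH]; intros g Hd; [reflexivity|]. rewrite !cube_int_S.
  apply Cint_ext; [lra|]. intros x _. rewrite upd_comm by lia. rewrite IH by lia. reflexivity.
Qed.

Lemma cube_int_ext d (F G : (nat -> R) -> C) g : (forall g, F g = G g) -> cube_int d F g = cube_int d G g.
Proof. intros H. replace G with F; auto. apply functional_extensionality; auto. Qed.

(** The exponential of the scalar product is pulled apart into one factor per variable. Each factor
    is taken out of the inner integrals by linearity, which is where the Lipschitz hypothesis
    enters. *)
Lemma cube_int_kernel_int N k d F B g : mixed_Lip d F B -> in_box g ->
  cube_int d (fun t => F t * cexp (- (twopii * RtoC (INR N) *
                       csum_range d (fun i => RtoC (IZR (k i) * t i)))))%C g = kernel_int (ker_exp N k) d F g.
Proof.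
  revert F B g. induction d as [|d IH]; intros F B g HF Hg.
  - simpl. replace (- (twopii * INR N * 0))%C with (RtoC 0) by ring. rewrite cexp_0. ring.
  - rewrite kernel_int_S, cube_int_S. apply Cint_ext; [lra|]. intros y Hy.
    rewrite cube_int_slice by lia.
    destruct HF as [HF _]. specialize (HF y ltac:(lra)).
    rewrite <- (proj2 (proj2 (kernel_int_bound_linear _ 1 d (ker_exp_ok N k))) (ker_exp N k d y) _ B g) by auto.
    rewrite <- (IH _ _ g (mixed_Lip_scal _ (ker_exp N k d y) _ _ HF) Hg).
    apply cube_int_ext. intros t. unfold slice. cbn [csum_range].
    rewrite (csum_ext d _ (fun i => RtoC (IZR (k i) * t i))) by (intros a Ha; rewrite upd_other by lia; reflexivity).
    rewrite upd_same. unfold ker_exp.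
    set (s := csum_range d _).
    replace (- (twopii * INR N * (s + RtoC (IZR (k d) * y))))%C with
      (- (twopii * INR N * s) + - (twopii * INR N * RtoC (IZR (k d) * y)))%C by ring.
    rewrite cexp_add. ring.
Qed.

(** The iterated trapezoidal rule with mesh [1 / N]. Kept in this form, with two half weights per
    cell, because Dirichlet's theorem on each cell returns precisely the mean of the two end
    values. *)
Fixpoint trap_sum (N d : nat) (F : (nat -> R) -> C) (g : nat -> R) : C :=
  match d with
  | O => F g
  | S d' => (RtoC (/ INR N) * csum_range N (fun n =>
      (trap_sum N d' F (upd g d' (INR n / INR N)%R) + trap_sum N d' F (upd g d' (INR (S n) / INR N)%R)) / 2))%C
  end.

Lemma trap_sum_slice N d F g e y : (d <= e)%nat -> trap_sum N d F (upd g e y) = trap_sum N d (slice F e y) g.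
Proof.
  revert g. induction d as [|d IH]; intros g Hd; [reflexivity|]. cbn [trap_sum]. f_equal.
  apply csum_ext. intros n _. rewrite !(upd_comm g e) by lia. rewrite !IH by lia. reflexivity.
Qed.

Lemma trap_sum_minus N d F G g : trap_sum N d (fun t => F t - G t)%C g = (trap_sum N d F g - trap_sum N d G g)%C.
Proof.
  revert g. induction d as [|d IH]; intros g; [reflexivity|]. cbn [trap_sum].
  rewrite (csum_ext N _ (fun n =>
      (trap_sum N d F (upd g d (INR n / INR N)%R) + trap_sum N d F (upd g d (INR (S n) / INR N)%R)) / 2
      + (-1) * ((trap_sum N d G (upd g d (INR n / INR N)%R) + trap_sum N d G (upd g d (INR (S n) / INR N)%R)) / 2))%C).
  - rewrite csum_plus, csum_scal. ring.
  - intros a _. rewrite !IH. unfold Cdiv. ring.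
Qed.

Definition trapezoid (N : nat) (f : R -> C) : C :=
  (RtoC (/ INR N) * csum_range N (fun n => (f (INR n / INR N)%R + f (INR (S n) / INR N)%R) / 2))%C.

Lemma Cmod_half (z : C) : Cmod (z / 2) = Cmod z / 2.
Proof.
  rewrite Cmod_div. 
  - rewrite Cmod_R, Rabs_pos_eq; lra.
  - intros H. apply RtoC_inj in H. lra.
Qed.

Lemma lattice_pt N n : (0 < N)%nat -> (n <= N)%nat -> 0 <= INR n / INR N <= 1.
Proof.
  intros HN Hn. apply lt_0_INR in HN. apply le_INR in Hn. pose proof (pos_INR n). split.
  - apply Rmult_le_pos; auto. left; apply Rinv_0_lt_compat; auto.
  - apply Rmult_le_reg_r with (INR N); auto. unfold Rdiv. rewrite Rmult_assoc, Rinv_l; lra.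
Qed.

Lemma trapezoid_bound N f B : (0 < N)%nat -> (forall x, 0 <= x <= 1 -> Cmod (f x) <= B) -> Cmod (trapezoid N f) <= B.
Proof.
  intros HN H. unfold trapezoid. rewrite Cmod_RtoC_mult. assert (HN' := lt_0_INR _ HN).
  rewrite Rabs_pos_eq by (left; apply Rinv_0_lt_compat; auto).
  apply Rmult_le_reg_l with (INR N); auto. rewrite <- Rmult_assoc, Rinv_r, Rmult_1_l by lra.
  apply csum_bound. intros a Ha. rewrite Cmod_half.
  pose proof (Cmod_triangle (f (INR a / INR N)) (f (INR (S a) / INR N))).
  pose proof (H _ (lattice_pt N a HN ltac:(lia))). pose proof (H _ (lattice_pt N (S a) HN ltac:(lia))). lra.
Qed.

Lemma trap_sum_S N d F g : trap_sum N (S d) F g = trapezoid N (fun y => trap_sum N d (slice F d y) g).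
Proof. cbn [trap_sum]. unfold trapezoid. f_equal. apply csum_ext. intros a _. rewrite !trap_sum_slice by lia. reflexivity. Qed.

Lemma trap_sum_bound N d F B g : (0 < N)%nat -> mixed_Lip d F B -> in_box g -> Cmod (trap_sum N d F g) <= B.
Proof.
  intros HN. revert F. induction d as [|d IH]; intros F HF Hg.
  - apply HF; auto.
  - rewrite trap_sum_S. apply trapezoid_bound; auto. intros x Hx. apply IH; auto. apply HF; lra.
Qed.

Lemma dirichlet_period M (x : R) (n : nat) : dirichlet M (x + INR n) = dirichlet M x.
Proof.
  induction M as [|M IH]; [reflexivity|].
  change (dirichlet M (x + INR n) + 2 * cos (2 * PI * INR (S M) * (x + INR n)) = dirichlet M x + 2 * cos (2 * PI * INR (S M) * x)).
  rewrite IH. f_equal. f_equal.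
  replace (2 * PI * INR (S M) * (x + INR n)) with (2 * PI * INR (S M) * x + 2 * INR (S M * n) * PI)
    by (rewrite mult_INR; ring).
  apply cos_period.
Qed.

(** The kernel [dirichlet M (N y)] has period [1 / N]. Rescaling each of the [N] cells to [[0, 1]]
    reduces it to [dirichlet_Lip]; the factor [1 / N] of the substitution compensates the number of
    cells. *)
Lemma dirichlet_trapezoid N M (f : R -> C) (B : R) : (0 < N)%nat -> Lip_box f B -> 
  Cmod (Cint (fun y => RtoC (dirichlet M (INR N * y)) * f y)%C 0 1 - trapezoid N f) <= dirichlet_err M * B.
Proof.
  intros HN Hf. assert (HN' := lt_0_INR _ HN). assert (HN1 : 1 <= INR N) by (apply (le_INR 1); lia).
  assert (HB : 0 <= B).
  { pose proof (Hf 0 1 ltac:(lra) ltac:(lra)) as E. pose proof (Cmod_ge_0 (f 0 - f 1)).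
    replace (Rabs (0 - 1)) with 1 in E; [lra|]. rewrite Rabs_left; lra. }
  set (h := fun y => (RtoC (dirichlet M (INR N * y)) * f y)%C).
  assert (Hc : Ccont_on h 0 1).
  { intros x Hx. apply Ccont_mult; [apply (proj1 (proj2 (ker_dir_ok N M)) O)|apply (Lip_box_Ccont f B); auto; lra]. }
  assert (Hsplit : forall n, (n <= N)%nat ->
    Cint h 0 (INR n / INR N) = csum_range n (fun j => Cint h (INR j / INR N) (INR (S j) / INR N))).
  { induction n as [|n IH]; intros Hn.
    - replace (INR 0 / INR N) with 0 by (simpl; unfold Rdiv; ring).
      apply Cint_point.
    - change (csum_range (S n) ?f) with (csum_range n f + f n)%C. cbv beta.
      rewrite <- IH by lia. symmetry. apply Cint_Chasles.
      + apply (lattice_pt N n); lia.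
      + unfold Rdiv. apply Rmult_le_compat_r; [left; apply Rinv_0_lt_compat; auto|]. apply le_INR; lia.
      + intros x Hx. apply Hc. pose proof (lattice_pt N (S n) HN Hn). lra. }
  specialize (Hsplit N (le_n _)). replace (INR N / INR N) with 1 in Hsplit by (field; lra).
  rewrite Hsplit. unfold trapezoid.
  rewrite <- csum_scal.
  assert (Hpiece : forall n, (n < N)%nat ->
    Cmod (Cint h (INR n / INR N) (INR (S n) / INR N)
      + (-1) * (RtoC (/ INR N) * ((f (INR n / INR N)%R + f (INR (S n) / INR N)%R) / 2))) <= / INR N * (dirichlet_err M * B)).
  { intros n Hn.
    assert (E : Cint h (INR n / INR N) (INR (S n) / INR N) =
      (RtoC (/ INR N) * Cint (fun r => RtoC (dirichlet M r) * f (/ INR N * r + INR n / INR N)%R) 0 1)%C).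
    { replace (INR n / INR N) with (/ INR N * 0 + INR n / INR N) at 1 by (field; lra).
      replace (INR (S n) / INR N) with (/ INR N * 1 + INR n / INR N) by (rewrite S_INR; field; lra).
      rewrite <- Cint_comp_lin.
      - f_equal. apply Cint_ext; [lra|]. intros x _. unfold h.
        replace (INR N * (/ INR N * x + INR n / INR N)) with (x + INR n) by (field; lra).
        rewrite dirichlet_period. reflexivity.
      - apply Rinv_0_lt_compat; auto.
      - lra.
      - intros x Hx. apply Hc. pose proof (lattice_pt N n HN ltac:(lia)). pose proof (lattice_pt N (S n) HN Hn).
        replace (/ INR N * 1 + INR n / INR N) with (INR (S n) / INR N) in Hx by (rewrite S_INR; field; lra). lra. }
    rewrite E.
    pose (f' := fun r => f (/ INR N * r + INR n / INR N)).
    assert (Hf' : Lip_box f' (/ INR N * B)).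
    { assert (Hi : 0 < / INR N) by (apply Rinv_0_lt_compat; auto).
      assert (Hi1 : / INR N <= 1) by (rewrite <- Rinv_1; apply Rinv_le_contravar; lra).
      pose proof (lattice_pt N n HN ltac:(lia)). pose proof (lattice_pt N (S n) HN Hn) as L.
      replace (INR (S n) / INR N) with (/ INR N + INR n / INR N) in L by (rewrite S_INR; field; lra).
      intros x y Hx Hy. unfold f'. eapply Rle_trans; [apply Hf; nra|].
      replace (/ INR N * x + INR n / INR N - (/ INR N * y + INR n / INR N)) with (/ INR N * (x - y)) by ring.
      rewrite Rabs_mult, (Rabs_pos_eq (/ INR N)) by lra. right. ring. }
    pose proof (dirichlet_Lip f' _ M Hf') as D. unfold f' at 2 3 in D.
    replace (/ INR N * 0 + INR n / INR N) with (INR n / INR N) in D by ring.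
    replace (/ INR N * 1 + INR n / INR N) with (INR (S n) / INR N) in D by (rewrite S_INR; field; lra).
    assert (Hi : 0 < / INR N) by (apply Rinv_0_lt_compat; auto).
    assert (Hi1 : / INR N <= 1) by (rewrite <- Rinv_1; apply Rinv_le_contravar; lra).
    match goal with |- Cmod ?z <= _ => replace z with
      (RtoC (/ INR N) * (Cint (fun r => RtoC (dirichlet M r) * f' r) 0 1 - (f (INR n / INR N)%R + f (INR (S n) / INR N)%R) / 2))%C end.
    2:{ unfold f'. ring. }
    rewrite Cmod_RtoC_mult, Rabs_pos_eq by lra.
    apply Rmult_le_compat_l; [lra|]. eapply Rle_trans; [exact D|].
    apply Rmult_le_compat_l; [left; apply dirichlet_err_pos|]. nra. }
  match goal with |- Cmod (?a - ?b) <= _ => replace (a - b)%C with (a + (-1) * b)%C by ring end.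
  rewrite <- csum_scal, <- csum_plus.
  eapply Rle_trans; [apply csum_bound; exact Hpiece|]. right. field. lra.
Qed.

(** The inner integral [phiA] has no Lipschitz bound uniform in [M] that is known in advance. It is
    written as the trapezoidal sum [phiT], whose Lipschitz constant is [B], plus a difference whose
    Lipschitz constant is small by the induction hypothesis; the one-variable theorem then applies
    to both summands. *)
Lemma kernel_int_dir_limit N d : (0 < N)%nat -> exists ep : nat -> R,
  is_lim_seq ep 0 /\ (forall M, 0 <= ep M) /\
  forall M F B g, mixed_Lip d F B -> in_box g -> Cmod (kernel_int (ker_dir N M) d F g - trap_sum N d F g) <= ep M * B.
Proof.
  intros HN. induction d as [|d [ep [Hl [Hp IH]]]].
  - exists (fun _ => 0). split; [apply is_lim_seq_const|]. split; [intros; lra|].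
    intros M F B g _ _. simpl. replace (F g - F g)%C with (RtoC 0) by ring. rewrite Cmod_0. lra.
  (* The terms stand for the one-variable error on [phiA - phiT], the trapezoidal sum of
     [phiA - phiT] itself, and the one-variable error on [phiT]. *)
  - exists (fun M => (dirichlet_err M + 1) * ep M + dirichlet_err M). split; [|split].
    + assert (H : is_lim_seq (fun M => (dirichlet_err M + 1) * ep M + dirichlet_err M) ((0 + 1) * 0 + 0)).
      { apply is_lim_seq_plus'; [|apply dirichlet_err_lim]. apply is_lim_seq_mult'; auto.
        apply is_lim_seq_plus'; [apply dirichlet_err_lim|apply is_lim_seq_const]. }
      replace ((0 + 1) * 0 + 0) with 0 in H by ring. exact H.
    + intros M. pose proof (dirichlet_err_pos M). specialize (Hp M). nra.
    + intros M F B g HF Hg. pose proof (mixed_Lip_nonneg _ _ _ HF) as HB.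
      rewrite kernel_int_S, trap_sum_S.
      pose (phiA := fun y => kernel_int (ker_dir N M) d (slice F d y) g).
      pose (phiT := fun y => trap_sum N d (slice F d y) g).
      assert (HLA : Lip_box phiA ((2 * INR M + 1) ^ d * B)) by (apply kernel_int_Lip_box; auto; apply ker_dir_ok).
      assert (HLT : Lip_box phiT B).
      { intros x y Hx Hy. unfold phiT. rewrite <- trap_sum_minus. apply trap_sum_bound; auto. apply HF; auto. }
      (* This is where mixed differences are needed: the induction hypothesis is applied to the
         difference of two slices, whose constant is [B] times the increment. *)
      assert (HLd : Lip_box (fun y => phiA y - phiT y)%C (ep M * B)).
      { intros x y Hx Hy. unfold phiA, phiT. destruct HF as [HF1 HF2].
        match goal with |- Cmod ?z <= _ => replace z with
          (kernel_int (ker_dir N M) d (slice F d x) g - kernel_int (ker_dir N M) d (slice F d y) g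
            - (trap_sum N d (slice F d x) g - trap_sum N d (slice F d y) g))%C by ring end.
        rewrite <- trap_sum_minus.
        rewrite <- (proj1 (proj2 (kernel_int_bound_linear _ _ d (ker_dir_ok N M))) _ _ B B) by auto.
        rewrite Rmult_assoc. apply IH; auto. }
      change (Cmod (Cint (fun y => RtoC (dirichlet M (INR N * y)) * phiA y)%C 0 1 - trapezoid N phiT)
        <= ((dirichlet_err M + 1) * ep M + dirichlet_err M) * B).
      assert (Hker : Ccont_on (fun y => RtoC (dirichlet M (INR N * y))) 0 1).
      { intros x Hx. apply (proj1 (proj2 (ker_dir_ok N M)) O). }
      replace (Cint (fun y => RtoC (dirichlet M (INR N * y)) * phiA y)%C 0 1) with
        (Cint (fun y => RtoC (dirichlet M (INR N * y)) * (phiA y - phiT y))%C 0 1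
         + Cint (fun y => RtoC (dirichlet M (INR N * y)) * phiT y)%C 0 1)%C.
      2:{ rewrite <- Cint_plus; [|lra| |].
          - apply Cint_ext; [lra|]. intros x _. ring.
          - apply Ccont_on_mult; auto. apply Lip_box_Ccont_on with (1 := HLd).
          - apply Ccont_on_mult; auto. apply Lip_box_Ccont_on with (1 := HLT). }
      pose proof (dirichlet_trapezoid N M _ _ HN HLd) as D1.
      pose proof (dirichlet_trapezoid N M _ _ HN HLT) as D2.
      assert (D3 : Cmod (trapezoid N (fun y => phiA y - phiT y)%C) <= ep M * B).
      { apply trapezoid_bound; auto. intros x Hx. apply IH; auto. apply HF; lra. }
      set (a := Cint (fun y => RtoC (dirichlet M (INR N * y)) * (phiA y - phiT y))%C 0 1) in *.
      set (b := Cint (fun y => RtoC (dirichlet M (INR N * y)) * phiT y)%C 0 1) in *.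
      set (c := trapezoid N (fun y => phiA y - phiT y)%C) in *.
      replace (a + b - trapezoid N phiT)%C with ((a - c) + (c + (b - trapezoid N phiT)))%C by ring.
      eapply Rle_trans; [apply Cmod_triangle|].
      eapply Rle_trans; [apply Rplus_le_compat_l; apply Cmod_triangle|]. nra.
Qed.

Definition lattice (N : nat) (n : nat -> nat) : nat -> R := fun i => INR (n i) / INR N.

Lemma lattice_upd N n d a : upd (lattice N n) d (INR a / INR N) = lattice N (upd n d a).
Proof.
  apply functional_extensionality. intros l. unfold lattice, upd. destruct (Nat.eqb l d); reflexivity.
Qed.

Lemma box_sum_slice N d F g e y : (d <= e)%nat -> box_sum N d F (upd g e y) = box_sum N d (slice F e y) g.
Proof.
  revert g. induction d as [|d IH]; intros g Hd; simpl box_sum; [reflexivity|].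
  apply csum_ext. intros a _. rewrite upd_comm by lia. apply IH. lia.
Qed.

Lemma box_sum_ext N d (F G : (nat -> nat) -> C) g : (forall g, F g = G g) -> box_sum N d F g = box_sum N d G g.
Proof. intros H. replace G with F; auto. apply functional_extensionality; auto. Qed.

(* By periodicity the two half weights at the endpoints combine. *)
Lemma trap_sum_box_sum N d F n : (0 < N)%nat ->
  (forall n i, (i < d)%nat -> F (lattice N (upd n i N)) = F (lattice N (upd n i O))) ->
  trap_sum N d F (lattice N n) = (RtoC (/ INR N ^ d) * box_sum N d (fun n => F (lattice N n)) n)%C.
Proof.
  intros HN HP. assert (HN' := lt_0_INR _ HN). revert n.
  induction d as [|d IH]; intros n.
  - simpl. rewrite Rinv_1. ring.
  - cbn [trap_sum box_sum]. pose (s := fun a => box_sum N d (fun n => F (lattice N n)) (upd n d a)).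
    rewrite (csum_ext N _ (fun a => (RtoC (/ INR N ^ d) / 2) * (s a + s (S a)))%C).
    2:{ intros a _. rewrite !lattice_upd, !IH by (intros; apply HP; lia). unfold s, Cdiv. ring. }
    rewrite csum_scal, csum_plus.
    assert (Hs : s N = s O).
    { unfold s. rewrite !box_sum_slice by lia. apply box_sum_ext. intros g. unfold slice. apply HP. lia. }
    assert (Hsh : csum_range N (fun a => s (S a)) = csum_range N s).
    { pose proof (csum_shift N s) as E. simpl in E. rewrite Hs in E.
      apply (f_equal (fun z => z - s O)%C) in E. ring_simplify in E. symmetry. exact E. }
    rewrite Hsh. fold s.
    replace (RtoC (/ INR N ^ S d)) with (RtoC (/ INR N) * RtoC (/ INR N ^ d))%C.
    2:{ rewrite <- RtoC_mult. f_equal. simpl. rewrite Rinv_mult. reflexivity. }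
    field.
Qed.

(** Periodicity is asked for at lattice points only. There it merges the half weights; between
    lattice points the Lipschitz bound is all that is used. *)
Theorem poisson_box N d F B : (0 < N)%nat -> mixed_Lip d F B ->
  (forall n i, (i < d)%nat -> F (lattice N (upd n i N)) = F (lattice N (upd n i O))) ->
  filterlim (fun M : nat => cube_sumZ M d (fun k => cube_int d
    (fun t => F t * cexp (- (twopii * RtoC (INR N) *
                       csum_range d (fun i => RtoC (IZR (k i) * t i)))))%C (fun _ => 0)) (fun _ => 0%Z))
      eventually (locally (RtoC (/ INR N ^ d) * box_sum N d (fun n => F (lattice N n)) (fun _ => O))%C).
Proof.
  intros HN HF HP.
  assert (Hb : in_box (fun _ => 0)) by (intros i; lra).
  assert (E0 : (fun _ : nat => 0) = lattice N (fun _ => O)).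
  { apply functional_extensionality. intros i. unfold lattice. simpl. unfold Rdiv. ring. }
  rewrite <- trap_sum_box_sum by auto. rewrite <- E0.
  destruct (kernel_int_dir_limit N d HN) as [ep [Hl [Hp H]]].
  intros P [eps HPe].
  assert (HB := mixed_Lip_nonneg _ _ _ HF).
  assert (Hl' : is_lim_seq (fun M => ep M * B) 0).
  { replace (Finite 0) with (Finite (0 * B)) by (f_equal; ring).
    apply is_lim_seq_mult'; auto. apply is_lim_seq_const. }
  apply is_lim_seq_spec in Hl'. destruct (Hl' eps) as [n Hn].
  exists n. intros M HM. apply HPe.
  specialize (Hn M HM). rewrite Rminus_0_r, Rabs_pos_eq in Hn by (apply Rmult_le_pos; auto).
  rewrite (cube_sumZ_ext _ _ _ (fun k => kernel_int (ker_exp N k) d F (fun _ => 0))).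
  2:{ intros k. apply (cube_int_kernel_int N k d F B); auto. }
  rewrite (cube_sumZ_kernel_int N M d F B) by auto.
  specialize (H M F B (fun _ => 0) HF Hb).
  apply C_NormedModule_mixin_compat1. eapply Rle_lt_trans; [|exact Hn].
  eapply Rle_trans; [|exact H]. right. reflexivity.
Qed.

(** * Dominated improper integrals *)

Definition CintR (f : R -> C) : C :=
  RInt_gen (V := C_R_CompleteNormedModule) f (Rbar_locally m_infty) (Rbar_locally p_infty).

(** Explicit exponential decay is stable under sums, under factors of linear growth and under small
    changes of an exponential parameter, at the price of a smaller rate [c]. All improper integrals
    below are of this kind. *)
Definition dominated_by (f : R -> C) (K c : R) : Prop :=
  0 < c /\ (forall x, Ccont f x) /\ (forall x, Cmod (f x) <= K * exp (- c * Rabs x)).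

Definition dominated (f : R -> C) : Prop := exists K c, dominated_by f K c.

Lemma dominated_by_K f K c : dominated_by f K c -> 0 <= K.
Proof.
  intros [_ [_ H]]. specialize (H 0). rewrite Rabs_R0, Rmult_0_r, exp_0, Rmult_1_r in H.
  pose proof (Cmod_ge_0 (f 0)). lra.
Qed.

Lemma exp_tail_int (K c a b : R) : 0 < c -> a <= b ->
  RInt (fun x => K * exp (- c * x)) a b = K / c * (exp (- c * a) - exp (- c * b)).
Proof.
  intros Hc Hab. apply is_RInt_unique.
  replace (K / c * (exp (- c * a) - exp (- c * b))) with
    (minus (- (K / c) * exp (- c * b)) (- (K / c) * exp (- c * a))) by (unfold minus, plus, opp; simpl; ring).
  apply (is_RInt_derive (V := R_CompleteNormedModule) (fun x => - (K / c) * exp (- c * x))).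
  - intros x _. auto_derive; auto. field. lra.
  - intros x _. cont_of_derive.
Qed.

Lemma exp_Ccont_ex_RInt (K c a b : R) : ex_RInt (fun x => K * exp (- c * x)) a b.
Proof.
  apply (ex_RInt_continuous (V := R_CompleteNormedModule)). intros x _.
  cont_of_derive.
Qed.

Lemma right_tail f K c A b b' : dominated_by f K c -> 0 <= A -> A <= b -> b <= b' ->
  Cmod (Cint f b b') <= K / c * exp (- c * A).
Proof.
  intros Hd HA Hb Hb'. pose proof (dominated_by_K _ _ _ Hd) as HK. destruct Hd as [Hc [HC H]].
  eapply Rle_trans; [apply (Cint_norm_le f (fun x => K * exp (- c * x)))|].
  - lra.
  - intros x _; auto.
  - apply exp_Ccont_ex_RInt.
  - intros x Hx. specialize (H x). rewrite Rabs_pos_eq in H by lra. exact H.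
  - rewrite exp_tail_int by lra. apply Rmult_le_compat_l.
    + apply Rmult_le_pos; auto. left; apply Rinv_0_lt_compat; auto.
    + pose proof (exp_pos (- c * b')).
      assert (exp (- c * b) <= exp (- c * A)); [|lra].
      destruct (Req_dec A b) as [->|Hne]; [lra|]. left. apply exp_increasing. nra.
Qed.

Lemma exp_tail_int_neg (K c a b : R) : 0 < c -> a <= b ->
  RInt (fun x => K * exp (- (- c) * x)) a b = K / c * (exp (c * b) - exp (c * a)).
Proof.
  intros Hc Hab. apply is_RInt_unique.
  replace (K / c * (exp (c * b) - exp (c * a))) with
    (minus ((K / c) * exp (c * b)) ((K / c) * exp (c * a))) by (unfold minus, plus, opp; simpl; ring).
  apply (is_RInt_derive (V := R_CompleteNormedModule) (fun x => (K / c) * exp (c * x))).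
  - intros x _. auto_derive; auto. rewrite Ropp_involutive. field. lra.
  - intros x _. cont_of_derive.
Qed.

Lemma left_tail f K c A a a' : dominated_by f K c -> 0 <= A -> a' <= a -> a <= - A ->
  Cmod (Cint f a' a) <= K / c * exp (- c * A).
Proof.
  intros Hd HA Hb Hb'. pose proof (dominated_by_K _ _ _ Hd) as HK. destruct Hd as [Hc [HC H]].
  eapply Rle_trans; [apply (Cint_norm_le f (fun x => K * exp (- (- c) * x)))|].
  - lra.
  - intros x _; auto.
  - apply exp_Ccont_ex_RInt.
  - intros x Hx. specialize (H x). rewrite Rabs_left1 in H by lra.
    replace (- (- c) * x) with (- c * - x) by ring. exact H.
  - rewrite exp_tail_int_neg by lra. apply Rmult_le_compat_l.
    + apply Rmult_le_pos; auto. left; apply Rinv_0_lt_compat; auto.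
    + pose proof (exp_pos (c * a')).
      assert (exp (c * a) <= exp (- c * A)); [|lra].
      destruct (Req_dec a (- A)) as [->|Hne]; [right; f_equal; ring|]. left. apply exp_increasing. nra.
Qed.

Lemma Cint_cauchy f K c A a b a' b' : dominated_by f K c -> 0 <= A -> a <= - A -> a' <= - A -> A <= b -> A <= b' ->
  Cmod (Cint f a b - Cint f a' b') <= 2 * (K / c * exp (- c * A)).
Proof.
  intros Hd HA Ha Ha' Hb Hb'.
  assert (HCC : forall u v, Ccont_on f u v) by (intros u v x _; apply Hd).
  assert (HR : Cmod (Cint f a' b - Cint f a' b') <= K / c * exp (- c * A)).
  { destruct (Rle_dec b b').
    - rewrite <- (Cint_Chasles f a' b b') by (auto; lra).
      replace (Cint f a' b - (Cint f a' b + Cint f b b'))%C with (- Cint f b b')%C by ring.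
      rewrite Cmod_opp. apply right_tail; auto.
    - rewrite <- (Cint_Chasles f a' b' b) by (auto; lra).
      replace (Cint f a' b' + Cint f b' b - Cint f a' b')%C with (Cint f b' b)%C by ring.
      apply right_tail; auto; lra. }
  assert (HL : Cmod (Cint f a b - Cint f a' b) <= K / c * exp (- c * A)).
  { destruct (Rle_dec a a').
    - rewrite <- (Cint_Chasles f a a' b) by (auto; lra).
      replace (Cint f a a' + Cint f a' b - Cint f a' b)%C with (Cint f a a')%C by ring.
      apply left_tail; auto.
    - rewrite <- (Cint_Chasles f a' a b) by (auto; lra).
      replace (Cint f a b - (Cint f a' a + Cint f a b))%C with (- Cint f a' a)%C by ring.
      rewrite Cmod_opp. apply left_tail; auto; lra. }
  replace (Cint f a b - Cint f a' b')%C with ((Cint f a b - Cint f a' b) + (Cint f a' b - Cint f a' b'))%C by ring.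
  eapply Rle_trans; [apply Cmod_triangle|]. lra.
Qed.

Lemma exp_small (c K eps : R) : 0 < c -> 0 <= K -> 0 < eps -> exists A, 0 <= A /\ forall B, A <= B -> K * exp (- c * B) < eps.
Proof.
  intros Hc HK He. exists (K / (c * eps)). split.
  - apply Rmult_le_pos; auto. left. apply Rinv_0_lt_compat. nra.
  - intros B HB.
    assert (HB0 : 0 <= B).
    { eapply Rle_trans; [|exact HB]. apply Rmult_le_pos; auto. left. apply Rinv_0_lt_compat. nra. }
    assert (H1 : 1 + c * B <= exp (c * B)) by (destruct (Req_dec (c * B) 0) as [->|Hn]; [rewrite exp_0; lra|left; apply exp_ineq1; auto]).
    replace (- c * B) with (- (c * B)) by ring. rewrite exp_Ropp.
    pose proof (exp_pos (c * B)).
    apply Rmult_lt_reg_r with (exp (c * B)); auto. rewrite Rmult_assoc, Rinv_l, Rmult_1_r by lra.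
    assert (K <= B * (c * eps)).
    { apply Rmult_le_compat_r with (r := c * eps) in HB; [|nra].
      unfold Rdiv in HB. rewrite Rmult_assoc, Rinv_l in HB by nra. lra. }
    nra.
Qed.

(** The improper integral exists by completeness, the proper integrals being Cauchy along the
    product filter. Comparison with one sufficiently distant pair of bounds carries the explicit
    Cauchy estimate over to the limit. *)
Lemma CintR_tail f K c A a b : dominated_by f K c -> 0 <= A -> a <= - A -> A <= b ->
  Cmod (Cint f a b - CintR f) <= 2 * (K / c * exp (- c * A)).
Proof.
  intros Hd HA Ha Hb. pose proof (dominated_by_K _ _ _ Hd) as HK. pose proof (proj1 Hd) as Hc.
  set (F := filter_prod (Rbar_locally m_infty) (Rbar_locally p_infty)).
  assert (HKc : 0 <= 2 * (K / c)).
  { assert (0 < / c) by (apply Rinv_0_lt_compat; auto). unfold Rdiv. nra. }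
  assert (Hfar : forall A, F (fun ab => fst ab <= - A /\ A <= snd ab)).
  { intros A'. exists (fun x => x <= - A') (fun x => A' <= x); auto.
    - exists (- A'). intros x Hx. lra.
    - exists A'. intros x Hx. lra. }
  assert (HF : ProperFilter F) by (unfold F; typeclasses eauto).
  destruct (proj1 (filterlim_locally_cauchy (F := F) (U := C_R_CompleteNormedModule) (fun ab => Cint f (fst ab) (snd ab)))) as [y Hy].
  { intros eps. destruct (exp_small c (2 * (K / c)) eps Hc HKc (cond_pos eps)) as [A' [HA' H']].
    exists (fun ab => fst ab <= - A' /\ A' <= snd ab). split; [apply Hfar|].
    intros [u1 u2] [v1 v2] [H1 H2] [H3 H4]. simpl in *.
    apply C_NormedModule_mixin_compat1. 
    eapply Rle_lt_trans; [|apply (H' A'); lra].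
    pose proof (Cint_cauchy f K c A' v1 v2 u1 u2 Hd HA' H3 H1 H4 H2) as E.
    rewrite Rmult_assoc. exact E. }
  assert (Hgen : is_RInt_gen (V := C_R_CompleteNormedModule) f (Rbar_locally m_infty) (Rbar_locally p_infty) y).
  { intros P HP. specialize (Hy P HP). unfold filtermap in Hy. unfold filtermapi.
    eapply filter_imp; [|exact Hy]. intros [u v] Huv. exists (Cint f u v). split; auto.
    apply (RInt_correct (V := C_R_CompleteNormedModule)).
    apply (ex_RInt_continuous (V := C_R_CompleteNormedModule)). intros z _. apply Ccont_continuous. apply Hd. }
  assert (E : CintR f = y).
  { exact (is_RInt_gen_unique (V := C_R_CompleteNormedModule) (Fa := Rbar_locally m_infty) (Fb := Rbar_locally p_infty) f y Hgen). }
  rewrite E. apply le_epsilon. intros eps Heps.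
  assert (Heps2 : 0 < eps / 2) by lra.
  pose proof (proj1 (filterlim_locally (F := F) (U := C_R_CompleteNormedModule) _ y) Hy (mkposreal _ Heps2)) as Hb1.
  assert (HX : exists uv, (fst uv <= - A /\ A <= snd uv) /\ ball (M := C_R_CompleteNormedModule) y (mkposreal _ Heps2) (Cint f (fst uv) (snd uv))).
  { apply (filter_ex (F := F)). apply filter_and; auto. }
  destruct HX as [[u v] [[Hu Hv] Hball]]. simpl in Hu, Hv, Hball.
  pose proof (C_NormedModule_mixin_compat2 y (Cint f u v) (mkposreal _ Heps2) Hball) as Hball2. simpl in Hball2.
  (* Balls of the product uniform structure are squares, so passing to the modulus costs a factor
     [sqrt 2], absorbed by the radius [eps / 2]. *)
  assert (Hs2 : sqrt 2 <= 2).
  { rewrite <- (sqrt_square 2) at 2 by lra. apply sqrt_le_1_alt. lra. }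
  assert (Hcl : Cmod (Cint f u v - y) <= eps).
  { left. eapply Rlt_le_trans; [exact Hball2|]. nra. }
  replace (Cint f a b - y)%C with ((Cint f a b - Cint f u v) + (Cint f u v - y))%C by ring.
  eapply Rle_trans; [apply Cmod_triangle|]. apply Rplus_le_compat; auto.
  apply Cint_cauchy; auto.
Qed.

Lemma CintR_bound f K c : dominated_by f K c -> Cmod (CintR f) <= 2 * K / c.
Proof.
  intros H. pose proof (CintR_tail f K c 0 0 0 H ltac:(lra) ltac:(lra) ltac:(lra)) as E.
  rewrite Cint_point in E.
  rewrite Rmult_0_r, exp_0, Rmult_1_r in E.
  replace (0 - CintR f)%C with (- CintR f)%C in E by ring. rewrite Cmod_opp in E. unfold Rdiv in *. lra.
Qed.

Definition cconv (u : R -> C) (l : C) : Prop :=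
  forall eps, 0 < eps -> exists A, 0 <= A /\ forall B, A <= B -> Cmod (u B - l) < eps.

Lemma CintR_lim f : dominated f -> cconv (fun A => Cint f (- A) A) (CintR f).
Proof.
  intros [K [c H]] eps He. pose proof (dominated_by_K _ _ _ H) as HK. pose proof (proj1 H) as Hc.
  assert (0 < / c) by (apply Rinv_0_lt_compat; auto).
  destruct (exp_small c (2 * (K / c)) eps Hc ltac:(unfold Rdiv; nra) He) as [A [HA HB]].
  exists A. split; auto. intros B HAB.
  eapply Rle_lt_trans; [apply (CintR_tail f K c B (- B) B); auto; lra|].
  rewrite <- Rmult_assoc. apply HB; auto.
Qed.

Lemma cconv_unique u l l' : cconv u l -> cconv u l' -> l = l'.
Proof.
  intros H H'. apply Ceq_minus. apply Cmod_eq_0. apply Rle_antisym; [|apply Cmod_ge_0].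
  apply le_epsilon. intros eps He.
  destruct (H (eps / 2) ltac:(lra)) as [A [HA HB]]. destruct (H' (eps / 2) ltac:(lra)) as [A' [HA' HB']].
  specialize (HB (Rmax A A') (Rmax_l _ _)). specialize (HB' (Rmax A A') (Rmax_r _ _)).
  replace (l - l')%C with ((u (Rmax A A') - l') - (u (Rmax A A') - l))%C by ring.
  eapply Rle_trans; [apply Cmod_triangle_minus|]. lra.
Qed.

Lemma cconv_plus u v l m : cconv u l -> cconv v m -> cconv (fun A => u A + v A)%C (l + m)%C.
Proof.
  intros H H' eps He.
  destruct (H (eps / 2) ltac:(lra)) as [A [HA HB]]. destruct (H' (eps / 2) ltac:(lra)) as [A' [HA' HB']].
  exists (Rmax A A'). split; [eapply Rle_trans; [exact HA|apply Rmax_l]|].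
  intros B HBB. specialize (HB B ltac:(eapply Rle_trans; [apply Rmax_l|eauto])).
  specialize (HB' B ltac:(eapply Rle_trans; [apply Rmax_r|eauto])).
  replace (u B + v B - (l + m))%C with ((u B - l) + (v B - m))%C by ring.
  eapply Rle_lt_trans; [apply Cmod_triangle|]. lra.
Qed.

Lemma cconv_scal c u l : cconv u l -> cconv (fun A => c * u A)%C (c * l)%C.
Proof.
  intros H eps He. pose proof (Cmod_ge_0 c) as Hc.
  destruct (H (eps / (Cmod c + 1))) as [A [HA HB]].
  { apply Rdiv_lt_0_compat; lra. }
  exists A. split; auto. intros B HBB. specialize (HB B HBB).
  replace (c * u B - c * l)%C with (c * (u B - l))%C by ring. rewrite Cmod_mult.
  pose proof (Cmod_ge_0 (u B - l)).
  apply Rle_lt_trans with ((Cmod c) * (eps / (Cmod c + 1))).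
  - apply Rmult_le_compat_l; lra.
  - apply Rmult_lt_reg_r with (Cmod c + 1); [lra|].
    replace (Cmod c * (eps / (Cmod c + 1)) * (Cmod c + 1)) with (Cmod c * eps) by (field; lra). nra.
Qed.

Lemma cconv_ext_pos u v l : (forall A, 0 <= A -> u A = v A) -> cconv u l -> cconv v l.
Proof.
  intros E H eps He. destruct (H eps He) as [A [HA HB]]. exists A. split; auto.
  intros B HBB. rewrite <- E by lra. auto.
Qed.

Lemma cconv_const l : cconv (fun _ => l) l.
Proof.
  intros eps He. exists 0. split; [lra|]. intros B _.
  replace (l - l)%C with (RtoC 0) by ring. rewrite Cmod_0. auto.
Qed.

Lemma CintR_unique f l : dominated f -> cconv (fun A => Cint f (- A) A) l -> CintR f = l.
Proof. intros H H'. eapply cconv_unique; [apply CintR_lim; exact H|exact H']. Qed.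

Lemma dominated_Ccont_on f a b : dominated f -> Ccont_on f a b.
Proof. intros [K [c [_ [H _]]]] x _. apply H. Qed.

Lemma exp_le (x y : R) : x <= y -> exp x <= exp y.
Proof. intros H. destruct (Req_dec x y) as [->|Hn]; [lra|]. left. apply exp_increasing. lra. Qed.

Lemma dominated_by_weaken f K c c' : dominated_by f K c -> 0 < c' -> c' <= c -> dominated_by f K c'.
Proof.
  intros H Hc' Hle. pose proof (dominated_by_K _ _ _ H) as HK. destruct H as [Hc [HC H]].
  split; [|split]; auto. intros x. eapply Rle_trans; [apply H|]. apply Rmult_le_compat_l; auto.
  apply exp_le. pose proof (Rabs_pos x). nra.
Qed.

Lemma dominated_plus f g : dominated f -> dominated g -> dominated (fun x => f x + g x)%C.
Proof.
  intros [K [c H]] [K' [c' H']].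
  assert (Hm : 0 < Rmin c c') by (apply Rmin_pos; [apply H|apply H']).
  apply (dominated_by_weaken _ _ _ (Rmin c c')) in H; auto; [|apply Rmin_l].
  apply (dominated_by_weaken _ _ _ (Rmin c c')) in H'; auto; [|apply Rmin_r].
  exists (K + K'), (Rmin c c'). destruct H as [_ [HC H]], H' as [_ [HC' H']].
  split; [|split]; auto.
  - intros x. apply Ccont_plus; auto.
  - intros x. eapply Rle_trans; [apply Cmod_triangle|]. specialize (H x). specialize (H' x). lra.
Qed.

Lemma dominated_scal a f : dominated f -> dominated (fun x => a * f x)%C.
Proof.
  intros [K [c [Hc [HC H]]]]. exists (Cmod a * K), c. split; [|split]; auto.
  - intros x. apply Ccont_mult; auto. apply Ccont_const.
  - intros x. rewrite Cmod_mult, Rmult_assoc. apply Rmult_le_compat_l; auto. apply Cmod_ge_0.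
Qed.

Lemma dominated_minus f g : dominated f -> dominated g -> dominated (fun x => f x - g x)%C.
Proof.
  intros Hf Hg. replace (fun x => f x - g x)%C with (fun x => f x + (-1) * g x)%C.
  - apply dominated_plus; auto. apply dominated_scal; auto.
  - apply functional_extensionality. intros x. ring.
Qed.

Lemma CintR_plus f g : dominated f -> dominated g -> CintR (fun x => f x + g x)%C = (CintR f + CintR g)%C.
Proof.
  intros Hf Hg. apply CintR_unique; [apply dominated_plus; auto|].
  eapply cconv_ext_pos; [|apply cconv_plus; apply CintR_lim; eauto].
  intros A HA. simpl. rewrite Cint_plus; auto; try apply dominated_Ccont_on; auto. lra.
Qed.

Lemma CintR_scal a f : dominated f -> CintR (fun x => a * f x)%C = (a * CintR f)%C.
Proof.
  intros Hf. apply CintR_unique; [apply dominated_scal; auto|].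
  eapply cconv_ext_pos; [|apply cconv_scal; apply CintR_lim; eauto].
  intros A HA. simpl. rewrite Cint_scal; auto; try apply dominated_Ccont_on; auto. lra.
Qed.

Lemma CintR_ext f g : (forall x, f x = g x) -> CintR f = CintR g.
Proof. intros H. f_equal. apply functional_extensionality; auto. Qed.

Lemma dominated_ext f g : (forall x, f x = g x) -> dominated f -> dominated g.
Proof. intros H. replace g with f; auto. apply functional_extensionality; auto. Qed.

Lemma CintR_minus f g : dominated f -> dominated g -> CintR (fun x => f x - g x)%C = (CintR f - CintR g)%C.
Proof.
  intros Hf Hg. rewrite (CintR_ext _ (fun x => f x + (-1) * g x)%C) by (intros; ring).
  rewrite CintR_plus, CintR_scal; auto; [ring|]. apply dominated_scal; auto.
Qed.

Definition lin_growth (lam : R -> C) (al be : R) : Prop :=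
  0 <= al /\ 0 <= be /\ (forall x, Ccont lam x) /\ (forall x, Cmod (lam x) <= al * Rabs x + be).

Lemma le_exp_lin (c x : R) : 0 < c -> 0 <= x -> x <= / c * exp (c * x).
Proof.
  intros Hc Hx. assert (H : 1 + c * x <= exp (c * x)) by (destruct (Req_dec (c * x) 0) as [->|Hn]; [rewrite exp_0; lra|left; apply exp_ineq1; auto]).
  apply Rmult_le_reg_l with c; auto. rewrite <- Rmult_assoc, Rinv_r, Rmult_1_l; lra.
Qed.

Lemma lin_growth_exp lam al be c : lin_growth lam al be -> 0 < c ->
  forall x, Cmod (lam x) <= (al / c + be) * exp (c * Rabs x).
Proof.
  intros [Hal [Hbe [_ H]]] Hc x. eapply Rle_trans; [apply H|].
  pose proof (Rabs_pos x) as Hx. pose proof (le_exp_lin c (Rabs x) Hc Hx) as E.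
  assert (1 <= exp (c * Rabs x)) by (rewrite <- exp_0; apply exp_le; nra).
  assert (al * Rabs x <= al * (/ c * exp (c * Rabs x))) by (apply Rmult_le_compat_l; auto).
  unfold Rdiv. nra.
Qed.

(** Half of the decay rate pays for the linear factor. *)
Lemma dominated_by_lin lam al be f K c : lin_growth lam al be -> dominated_by f K c ->
  dominated_by (fun x => lam x * f x)%C ((al / (c / 2) + be) * K) (c / 2).
Proof.
  intros Hl Hf. pose proof (dominated_by_K _ _ _ Hf) as HK. destruct Hf as [Hc [HC H]].
  assert (Hc2 : 0 < c / 2) by lra.
  split; [|split]; auto.
  - intros x. apply Ccont_mult; auto. apply Hl.
  - intros x. rewrite Cmod_mult.
    eapply Rle_trans; [apply Rmult_le_compat; try apply Cmod_ge_0;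
      [apply (lin_growth_exp _ _ _ (c / 2) Hl); auto|apply H]|].
    right. replace (- c * Rabs x) with (- (c / 2) * Rabs x + - (c / 2) * Rabs x) by field.
    rewrite exp_plus. replace (c / 2 * Rabs x) with (- (- (c / 2) * Rabs x)) by ring.
    rewrite exp_Ropp. pose proof (exp_pos (- (c / 2) * Rabs x)). field. split; lra.
Qed.

Lemma dominated_lin lam al be f : lin_growth lam al be -> dominated f -> dominated (fun x => lam x * f x)%C.
Proof. intros Hl [K [c H]]. eexists; eexists. eapply dominated_by_lin; eauto. Qed.

(** * Differentiation of integrals in an exponential parameter *)

Lemma Cderiv_cexp_lin (z : C) u : Cderiv (fun u => cexp (RtoC u * z)) u (z * cexp (RtoC u * z))%C.
Proof.
  eapply Cderiv_eq; [|apply Cderiv_cexp; apply Cderiv_mult; [apply Cderiv_id|apply Cderiv_const]].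
  cbv beta. ring.
Qed.

Lemma Cmod_cexp_le (z : C) : Cmod (cexp z) <= exp (Cmod z).
Proof. rewrite Cmod_cexp. apply exp_le. eapply Rle_trans; [apply Rle_abs|apply re_le_Cmod]. Qed.

(** Obtained, like the second-order version below, by integrating the derivative along the segment
    from 0 to [z]. *)
Lemma cexp_1_bound (z : C) : Cmod (cexp z - 1) <= Cmod z * exp (Cmod z).
Proof.
  assert (HC : Ccont_on (fun u => z * cexp (RtoC u * z))%C 0 1).
  { intros x _. apply Ccont_mult; [apply Ccont_const|]. eapply Cderiv_Ccont. apply Cderiv_cexp_lin. }
  replace (cexp z - 1)%C with (Cint (fun u => z * cexp (RtoC u * z))%C 0 1).
  - eapply Rle_trans; [apply (Cint_norm_le_const _ (Cmod z * exp (Cmod z)))|]; auto; [lra| |lra].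
    intros x Hx. rewrite Cmod_mult. apply Rmult_le_compat_l; [apply Cmod_ge_0|].
    eapply Rle_trans; [apply Cmod_cexp_le|]. apply exp_le. rewrite Cmod_RtoC_mult, Rabs_pos_eq by lra.
    pose proof (Cmod_ge_0 z). nra.
  - rewrite (Cint_FTC (fun u => cexp (RtoC u * z))); auto; [|lra|intros; apply Cderiv_cexp_lin].
    replace (1 * z)%C with z by ring. replace (0 * z)%C with (RtoC 0) by ring. rewrite cexp_0. reflexivity.
Qed.

Lemma cexp_2_bound (z : C) : Cmod (cexp z - 1 - z) <= Cmod z ^ 2 * exp (Cmod z).
Proof.
  assert (HD : forall u, Cderiv (fun u => cexp (RtoC u * z) - RtoC u * z)%C u (z * (cexp (RtoC u * z) - 1))%C).
  { intros u. eapply Cderiv_eq; [|apply Cderiv_minus; [apply Cderiv_cexp_lin|apply Cderiv_mult; [apply Cderiv_id|apply Cderiv_const]]]. cbv beta. ring. }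
  assert (HC : Ccont_on (fun u => z * (cexp (RtoC u * z) - 1))%C 0 1).
  { intros x _. apply Ccont_mult; [apply Ccont_const|]. apply Ccont_minus; [|apply Ccont_const]. eapply Cderiv_Ccont. apply Cderiv_cexp_lin. }
  replace (cexp z - 1 - z)%C with (Cint (fun u => z * (cexp (RtoC u * z) - 1))%C 0 1).
  - eapply Rle_trans; [apply (Cint_norm_le_const _ (Cmod z ^ 2 * exp (Cmod z)))|]; auto; [lra| |lra].
    intros x Hx. rewrite Cmod_mult. simpl. rewrite Rmult_1_r, Rmult_assoc.
    apply Rmult_le_compat_l; [apply Cmod_ge_0|].
    eapply Rle_trans; [apply cexp_1_bound|]. rewrite Cmod_RtoC_mult, Rabs_pos_eq by lra.
    pose proof (Cmod_ge_0 z). apply Rmult_le_compat; try nra; [left; apply exp_pos|]. apply exp_le; nra.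
  - rewrite (Cint_FTC (fun u => cexp (RtoC u * z) - RtoC u * z)%C); auto; [|lra].
    replace (1 * z)%C with z by ring. replace (0 * z)%C with (RtoC 0) by ring. rewrite cexp_0. ring.
Qed.

Lemma is_derive_quad (f : R -> R) D K d : 0 < d ->
  (forall s, Rabs s < d -> Rabs (f s - f 0 - s * D) <= K * s ^ 2) -> is_derive f 0 D.
Proof.
  intros Hd H. apply is_derive_Reals. intros eps He.
  assert (HK : 0 < Rabs K + 1) by (pose proof (Rabs_pos K); lra).
  assert (Hp : 0 < Rmin d (eps / (Rabs K + 1))) by (apply Rmin_pos; auto; apply Rdiv_lt_0_compat; auto).
  exists (mkposreal _ Hp). intros h Hh Hlt. simpl in Hlt. rewrite Rplus_0_l.
  pose proof (Rmin_l d (eps / (Rabs K + 1))). pose proof (Rmin_r d (eps / (Rabs K + 1))).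
  specialize (H h ltac:(lra)).
  replace ((f h - f 0) / h - D) with ((f h - f 0 - h * D) * / h) by (field; auto).
  rewrite Rabs_mult, Rabs_inv. assert (0 < Rabs h) by (apply Rabs_pos_lt; auto).
  apply Rmult_lt_reg_r with (Rabs h); auto. rewrite Rmult_assoc, Rinv_l, Rmult_1_r by lra.
  eapply Rle_lt_trans; [exact H|]. rewrite <- (pow2_abs h).
  assert (Rabs h * (Rabs K + 1) < eps).
  { apply Rlt_le_trans with (eps / (Rabs K + 1) * (Rabs K + 1)); [apply Rmult_lt_compat_r; lra|].
    right. field. lra. }
  pose proof (Rle_abs K). simpl. rewrite Rmult_1_r. rewrite <- Rmult_assoc.
  apply Rmult_lt_compat_r; auto. nra.
Qed.

Lemma Cderiv_quad (f : R -> C) D K d : 0 < d ->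
  (forall s, Rabs s < d -> Cmod (f s - f 0%R - RtoC s * D) <= K * s ^ 2) -> Cderiv f 0 D.
Proof.
  intros Hd H. split; apply (is_derive_quad _ _ K d); auto; intros s Hs.
  - eapply Rle_trans; [|apply (H s Hs)]. eapply Rle_trans; [|apply re_le_Cmod]. right. f_equal. simpl. unfold Re; ring.
  - eapply Rle_trans; [|apply (H s Hs)]. eapply Rle_trans; [|apply im_le_Cmod]. right. f_equal. simpl. unfold Im; ring.
Qed.

Section ExpParam.
Variables (lam k : R -> C) (al be : R).
Hypothesis Hlam : lin_growth lam al be.
Hypothesis Hk : forall x, Ccont k x.

(** A shift of [t] multiplies the integrand by an exponential, and a derivative in [t] multiplies it
    by [lam]. So derivatives stay in the same family with [k] replaced by [lam k], and one lemma
    yields all orders. *)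
Definition exp_integrand (t : C) (x : R) : C := (cexp (t * lam x) * k x)%C.

Lemma exp_integrand_shift t (s : R) theta x : exp_integrand (t + RtoC s * theta) x = (cexp (RtoC s * theta * lam x) * exp_integrand t x)%C.
Proof. unfold exp_integrand. rewrite Cmult_plus_distr_r, cexp_add. ring. Qed.

Lemma Ccont_exp_integrand t x : Ccont (exp_integrand t) x.
Proof. apply Ccont_mult; auto. apply Ccont_cexp. apply Ccont_mult; [apply Ccont_const|]. apply Hlam. Qed.

(* The integrand is exponential in the parameter, so its second-order Taylor
   remainder is dominated with half the decay rate. *)
Lemma CintR_exp_integrand_derive_0 t theta : dominated (exp_integrand t) ->
  Cderiv (fun s => CintR (exp_integrand (t + RtoC s * theta))) 0 (theta * CintR (fun x => lam x * exp_integrand t x))%C.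
Proof.
  intros HD. pose proof HD as [K [c H]]. pose proof (dominated_by_K _ _ _ H) as HK.
  destruct H as [Hc [HC H]]. destruct (Hlam) as [Hal [Hbe [Hlc Hlb]]].
  set (T := Cmod theta). assert (HT : 0 <= T) by apply Cmod_ge_0.
  assert (HTa : 0 <= T * al) by (apply Rmult_le_pos; auto).
  assert (HTb : 0 <= T * be) by (apply Rmult_le_pos; auto).
  (* For [|s| < d] the additional exponent is at most [c / 4 * |x| + 1]: a quarter of the decay rate
     and a constant factor [exp 1]. *)
  set (d := Rmin (c / 4 / (T * al + 1)) (/ (T * be + 1))).
  assert (Hd : 0 < d).
  { apply Rmin_pos; [apply Rdiv_lt_0_compat; lra|apply Rinv_0_lt_compat; lra]. }
  assert (Hd1 : d * (T * al) <= c / 4).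
  { apply Rle_trans with (c / 4 / (T * al + 1) * (T * al + 1)); [|right; field; lra].
    apply Rmult_le_compat; try lra. apply Rmin_l. }
  assert (Hd2 : d * (T * be) <= 1).
  { apply Rle_trans with (/ (T * be + 1) * (T * be + 1)); [|right; field; lra].
    apply Rmult_le_compat; try lra. apply Rmin_r. }
  assert (Hexpo : forall s x, Rabs s < d -> Cmod (RtoC s * theta * lam x) <= c / 4 * Rabs x + 1).
  { intros s x Hs. rewrite !Cmod_mult, Cmod_R. fold T.
    pose proof (Rabs_pos s). pose proof (Rabs_pos x). specialize (Hlb x).
    apply Rle_trans with (d * T * (al * Rabs x + be)).
    - apply Rmult_le_compat; auto; try apply Cmod_ge_0; [apply Rmult_le_pos; auto|].
      apply Rmult_le_compat_r; auto. lra.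
    - nra. }
  assert (HDs : forall s, Rabs s < d -> dominated (exp_integrand (t + RtoC s * theta))).
  { intros s Hs. exists (exp 1 * K), (c / 2). split; [lra|split].
    - intros x. apply Ccont_exp_integrand.
    - intros x. rewrite exp_integrand_shift, Cmod_mult.
      apply Rle_trans with (exp (c / 4 * Rabs x + 1) * (K * exp (- c * Rabs x))).
      + apply Rmult_le_compat; try apply Cmod_ge_0; auto.
        eapply Rle_trans; [apply Cmod_cexp_le|]. apply exp_le. auto.
      + rewrite exp_plus.
        assert (exp (c / 4 * Rabs x) * exp (- c * Rabs x) <= exp (- (c / 2) * Rabs x)).
        { rewrite <- exp_plus. apply exp_le. pose proof (Rabs_pos x). nra. }
        assert (0 <= exp 1 * K) by (apply Rmult_le_pos; auto; left; apply exp_pos). nra. }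
  (* With rate [c / 8] for [lam], its square costs [c / 4]. Together with the [c / 4] of the
     exponential in the Taylor remainder this leaves the rate [c / 2]. *)
  set (L := al / (c / 8) + be).
  assert (HL : 0 <= L).
  { unfold L. assert (0 < / (c / 8)) by (apply Rinv_0_lt_compat; lra). unfold Rdiv at 1. nra. }
  set (K3 := T * T * (L * L) * exp 1 * K).
  assert (HDl : dominated (fun x => lam x * exp_integrand t x)%C) by (eapply dominated_lin; eauto).
  apply (Cderiv_quad _ _ (2 * K3 / (c / 2)) d); auto.
  intros s Hs.
  replace (t + 0%R * theta)%C with t by ring.
  replace (CintR (exp_integrand (t + s * theta)) - CintR (exp_integrand t) - s * (theta * CintR (fun x => lam x * exp_integrand t x)))%C
    with (CintR (fun x => exp_integrand (t + RtoC s * theta) x - exp_integrand t x - (RtoC s * theta) * (lam x * exp_integrand t x))%C).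
  2:{ rewrite CintR_minus, CintR_minus, CintR_scal; auto; [ring|apply dominated_minus; auto|apply dominated_scal; auto]. }
  replace (2 * K3 / (c / 2) * s ^ 2) with (2 * (s ^ 2 * K3) / (c / 2)) by (unfold Rdiv; ring).
  apply CintR_bound. split; [lra|split].
  - intros x. apply Ccont_minus; [apply Ccont_minus; apply Ccont_exp_integrand|].
    apply Ccont_mult; [apply Ccont_const|]. apply Ccont_mult; auto.
  - intros x. rewrite exp_integrand_shift.
    replace (cexp (s * theta * lam x) * exp_integrand t x - exp_integrand t x - s * theta * (lam x * exp_integrand t x))%C with
      ((cexp (s * theta * lam x) - 1 - s * theta * lam x) * exp_integrand t x)%C by ring.
    rewrite Cmod_mult.
    pose proof (lin_growth_exp lam al be (c / 8) Hlam ltac:(lra) x) as HLx. fold L in HLx.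
    assert (Hsq : Cmod (s * theta * lam x) ^ 2 <= s ^ 2 * (T * T * (L * L) * exp (c / 4 * Rabs x))).
    { rewrite !Cmod_mult, Cmod_R. fold T.
      replace (c / 4 * Rabs x) with (c / 8 * Rabs x + c / 8 * Rabs x) by field. rewrite exp_plus.
      rewrite <- (pow2_abs s).
      replace ((Rabs s * T * Cmod (lam x)) ^ 2) with (Rabs s ^ 2 * (T * T * (Cmod (lam x) * Cmod (lam x)))) by ring.
      apply Rmult_le_compat_l; [apply pow2_ge_0|].
      rewrite !Rmult_assoc. apply Rmult_le_compat_l; auto. apply Rmult_le_compat_l; auto.
      pose proof (Cmod_ge_0 (lam x)). pose proof (exp_pos (c / 8 * Rabs x)).
      replace (L * (L * (exp (c / 8 * Rabs x) * exp (c / 8 * Rabs x)))) with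
        ((L * exp (c / 8 * Rabs x)) * (L * exp (c / 8 * Rabs x))) by ring.
      apply Rmult_le_compat; auto. }
    eapply Rle_trans; [apply Rmult_le_compat; try apply Cmod_ge_0; [apply cexp_2_bound|apply H]|].
    assert (He : exp (Cmod (s * theta * lam x)) <= exp (c / 4 * Rabs x) * exp 1).
    { rewrite <- exp_plus. apply exp_le. auto. }
    eapply Rle_trans; [apply Rmult_le_compat_r; [apply Rmult_le_pos; auto; left; apply exp_pos|];
      apply Rmult_le_compat; [apply pow2_ge_0|left; apply exp_pos|exact Hsq|exact He]|].
    right. unfold K3.
    replace (- (c / 2) * Rabs x) with (c / 4 * Rabs x + c / 4 * Rabs x + - c * Rabs x) by field.
    rewrite !exp_plus. ring.
Qed.

Lemma CintR_exp_integrand_derive t theta (s0 : R) : dominated (exp_integrand (t + RtoC s0 * theta)) ->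
  Cderiv (fun s => CintR (exp_integrand (t + RtoC s * theta))) s0 (theta * CintR (fun x => lam x * exp_integrand (t + RtoC s0 * theta) x))%C.
Proof.
  intros H. pose proof (CintR_exp_integrand_derive_0 _ theta H) as E.
  replace 0 with (1 * s0 + - s0) in E by ring. apply Cderiv_comp_lin in E.
  eapply Cderiv_eq; [|eapply Cderiv_ext; [|exact E]].
  - ring.
  - intros u. simpl. f_equal. f_equal. apply C_ext; simpl; ring.
Qed.
End ExpParam.

(** * The Fourier transform of the hyperbolic secant *)

Lemma C_neq_Re (z w : C) : Re z <> Re w -> z <> w.
Proof. intros H E. subst. auto. Qed.

Lemma RtoC_neq_0 (x : R) : x <> 0 -> RtoC x <> 0%C.
Proof. intros H E. apply RtoC_inj in E. auto. Qed.

Lemma Rle_0_limit (x : R) (e : nat -> R) : (forall n, x <= e n) -> is_lim_seq e 0 -> x <= 0.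
Proof.
  intros H Hl. change (Rbar_le x 0). eapply is_lim_seq_le; [|apply is_lim_seq_const|exact Hl]. auto.
Qed.

Lemma csum_sym_S M (g : Z -> C) :
  csum_range (2 * S M + 1) (fun a => g (Z.of_nat a - Z.of_nat (S M))%Z) =
  (csum_range (2 * M + 1) (fun a => g (Z.of_nat a - Z.of_nat M)%Z) + g (Z.of_nat (S M)) + g (- Z.of_nat (S M))%Z)%C.
Proof.
  replace (2 * S M + 1)%nat with (S (S (2 * M + 1))) by lia.
  rewrite csum_shift.
  change (csum_range (S (2 * M + 1)) ?f) with (csum_range (2 * M + 1) f + f (2 * M + 1)%nat)%C.
  cbv beta.
  rewrite (csum_ext _ _ (fun a => g (Z.of_nat a - Z.of_nat M)%Z)).
  2:{ intros a _. f_equal. lia. }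
  replace (Z.of_nat 0 - Z.of_nat (S M))%Z with (- Z.of_nat (S M))%Z by lia.
  replace (Z.of_nat (S (2 * M + 1)) - Z.of_nat (S M))%Z with (Z.of_nat (S M)) by lia.
  ring.
Qed.

Definition pi_i : C := (RtoC PI * Ci)%C.

Lemma twopii_pi_i : twopii = (2 * pi_i)%C.
Proof. unfold twopii, pi_i. ring. Qed.

Lemma twopii_neq_0 : twopii <> 0%C.
Proof.
  pose proof PI_RGT_0. unfold twopii. intros E. apply (f_equal Im) in E. simpl in E. lra.
Qed.

Lemma cexp_half_pi_i : cexp (pi_i / 2) = Ci.
Proof.
  unfold cexp, pi_i. apply C_ext; simpl.
  - match goal with |- exp ?a * cos ?b = _ => replace a with 0 by field; replace b with (PI / 2) by field end.
    rewrite exp_0, cos_PI2. ring.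
  - match goal with |- exp ?a * sin ?b = _ => replace a with 0 by field; replace b with (PI / 2) by field end.
    rewrite exp_0, sin_PI2. ring.
Qed.

(** Settles a side condition of [field] that agrees with the known inequation [N] up to ring
    normalisation and possibly a sign. *)
Ltac nz_by N := let E := fresh in intro E; apply N;
  match type of E with ?l = _ => first [transitivity l; [ring|exact E] | transitivity (- l)%C; [ring|rewrite E; ring]] end.

Section Sech.
Variable t : C.
Hypothesis Ht : 0 < Re t < 1.

Let q : C := cexp (pi_i * t).

Lemma qsq : (q * q)%C = cexp (twopii * t).
Proof. unfold q. rewrite <- cexp_add, twopii_pi_i. f_equal. ring. Qed.

Lemma cexp_twopii_neq_1 : cexp (twopii * t) <> 1%C.
Proof.
  intros E. pose proof PI_RGT_0.
  assert (Hm : Cmod (cexp (twopii * t)) = 1) by (rewrite E; apply Cmod_1).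
  rewrite Cmod_cexp in Hm. apply (f_equal Re) in E.
  change (exp (Re (twopii * t)%C) * cos (Im (twopii * t)%C) = 1) in E.
  rewrite Hm, Im_twopii_mult in E. replace (2 * PI * Re t) with (2 * (PI * Re t)) in E by ring.
  rewrite cos_2a_sin in E.
  assert (0 < sin (PI * Re t)) by (apply sin_gt_0; nra). nra.
Qed.

Lemma one_minus_qsq : (1 - q * q <> 0)%C.
Proof. rewrite qsq. intros H. apply cexp_twopii_neq_1. symmetry. apply Ceq_minus. exact H. Qed.

Lemma t_minus_IZR (z : Z) : (t - RtoC (IZR z) <> 0)%C.
Proof.
  apply C_neq_Re. simpl. unfold Re in *. intros E.
  assert (Hz : fst t = IZR z) by lra. rewrite Hz in Ht. destruct Ht as [H1 H2].
  apply lt_IZR in H1. apply lt_IZR in H2. lia.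
Qed.

(** As [t] is not an integer, this exponential is not periodic on [[0, 1]]. Its Fourier coefficients
    there are [kap / (t - z)], so Dirichlet's theorem for [f0] is a statement on partial
    fractions. *)
Let f0 (s : R) : C := cexp (twopii * t * RtoC s).

Let kap : C := ((q * q - 1) / twopii)%C.

Lemma fourier_coef (z : Z) :
  Cint (fun y => cexp (- (twopii * RtoC (IZR z * y))) * f0 y)%C 0 1 = (kap / (t - RtoC (IZR z)))%C.
Proof.
  pose proof (t_minus_IZR z) as Hz. pose proof twopii_neq_0 as Hp.
  set (c := (twopii * (t - RtoC (IZR z)))%C).
  assert (Hc : c <> 0%C) by (apply Cmult_neq_0; auto).
  assert (E : forall y, (cexp (- (twopii * RtoC (IZR z * y))) * f0 y = cexp (RtoC y * c))%C).
  { intros y. unfold f0. rewrite <- cexp_add. f_equal. unfold c. rewrite RtoC_mult. ring. }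
  rewrite (Cint_ext _ (fun y => cexp (RtoC y * c))) by (auto; lra).
  rewrite (Cint_FTC (fun y => / c * cexp (RtoC y * c))%C).
  - replace (1 * c)%C with c by ring. replace (0 * c)%C with (RtoC 0) by ring.
    rewrite cexp_0. unfold kap. rewrite qsq.
    replace (cexp c) with (cexp (twopii * t)).
    + unfold c. field. split; auto.
    + unfold c. replace (twopii * (t - IZR z))%C with (twopii * t - twopii * RtoC (IZR z))%C by ring.
      rewrite cexp_minus, cexp_twopii_IZR. field.
  - lra.
  - intros x _. eapply Cderiv_eq; [|apply Cderiv_mult; [apply Cderiv_const|apply Cderiv_cexp_lin]]. cbv beta. field. auto.
  - intros x _. eapply Cderiv_Ccont. apply Cderiv_cexp_lin.
Qed.

Lemma Ccont_f0 x : Ccont f0 x.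
Proof. apply Ccont_cexp. apply Ccont_mult; [apply Ccont_const|]. eapply Cderiv_Ccont. apply Cderiv_id. Qed.

(** Rescaling the argument of the kernel by [N] selects the frequencies divisible by [N]. Both
    [N = 1] and [N = 2] are used. *)
Lemma dirichlet_sum_coef N M :
  Cint (fun y => RtoC (dirichlet M (INR N * y)) * f0 y)%C 0 1 =
  csum_range (2 * M + 1) (fun a => kap / (t - RtoC (IZR (Z.of_nat N * (Z.of_nat a - Z.of_nat M)))))%C.
Proof.
  rewrite (csum_ext _ _ (fun a => Cint (fun y => cexp (- (twopii * RtoC (IZR (Z.of_nat N * (Z.of_nat a - Z.of_nat M)) * y))) * f0 y)%C 0 1))
    by (intros; rewrite fourier_coef; reflexivity).
  rewrite csum_Cint.
  - apply Cint_ext; [lra|]. intros y _. rewrite <- csum_dirichlet, Cmult_comm, <- csum_scal.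
    apply csum_ext. intros a _. rewrite Cmult_comm. f_equal. f_equal. f_equal. f_equal. f_equal.
    rewrite mult_IZR, <- INR_IZR_INZ. ring.
  - lra.
  - intros k x _. apply Ccont_mult; [|apply Ccont_f0]. apply Ccont_cexp. apply Ccont_opp. apply Ccont_mult; [apply Ccont_const|].
    apply Ccont_RtoC. cont_of_derive.
Qed.

Lemma f0_Lip : exists L, Lip_box f0 L.
Proof.
  set (c := (twopii * t)%C). set (K := exp (2 * Cmod c)). exists (Cmod c * K).
  assert (HD : forall x, Cderiv f0 x (c * cexp (c * RtoC x))%C).
  { intros x. unfold f0. fold c. eapply Cderiv_eq; [|apply Cderiv_cexp; apply Cderiv_mult; [apply Cderiv_const|apply Cderiv_id]].
    cbv beta. ring. }
  assert (HB : forall x, -1 <= x <= 2 -> Cmod (c * cexp (c * RtoC x)) <= Cmod c * K).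
  { intros x Hx. rewrite Cmod_mult. apply Rmult_le_compat_l; [apply Cmod_ge_0|].
    eapply Rle_trans; [apply Cmod_cexp_le|]. apply exp_le. rewrite Cmod_mult, Cmod_R.
    assert (Rabs x <= 2) by (apply Rabs_le; lra). pose proof (Cmod_ge_0 c). nra. }
  assert (HC : forall a b, Ccont_on (fun x => c * cexp (c * RtoC x))%C a b).
  { intros a b x _. apply Ccont_mult; [apply Ccont_const|]. apply (Ccont_f0 x). }
  assert (Hw : forall x y, -1 <= x -> x <= y -> y <= 2 -> Cmod (f0 y - f0 x) <= Cmod c * K * (y - x)).
  { intros x y H1 H2 H3. rewrite <- (Cint_FTC f0 (fun x => c * cexp (c * RtoC x))%C x y); auto.
    rewrite Rmult_comm. apply Cint_norm_le_const; auto. intros z Hz. apply HB; lra. }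
  intros x y Hx Hy. destruct (Rle_dec x y).
  - rewrite Cmod_minus_sym, Rabs_left1 by lra. replace (- (x - y)) with (y - x) by ring. apply Hw; lra.
  - rewrite Rabs_pos_eq by lra. apply Hw; lra.
Qed.

Let Spart (N M : nat) : C := csum_range (2 * M + 1) (fun a => / (t - RtoC (IZR (Z.of_nat N * (Z.of_nat a - Z.of_nat M)))))%C.

(* Doubling the even frequencies and subtracting all of them leaves alternating signs. *)
Let A (M : nat) : C := (2 * Spart 2 M - Spart 1 (2 * M))%C.

Lemma kap_neq_0 : kap <> 0%C.
Proof.
  unfold kap. apply Cmult_neq_0.
  - intros H. apply one_minus_qsq. replace (1 - q * q)%C with (- (q * q - 1))%C by ring. rewrite H. ring.
  - intros H. pose proof twopii_neq_0 as Hp. pose proof (Cinv_r _ Hp) as E. rewrite H in E.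
    apply (f_equal Re) in E. simpl in E. lra.
Qed.

(** Up to the factor [kap], the limits are trapezoidal values of [f0]: [(1 + 2 q + q^2) / 4] with
    two cells and [(1 + q^2) / 2] with one. Twice the former minus the latter is [q]. *)
Lemma A_limit : exists e, is_lim_seq e 0 /\ forall M, Cmod (A M - q / kap) <= e M.
Proof.
  destruct f0_Lip as [L HL]. pose proof kap_neq_0 as Hk.
  exists (fun M => / Cmod kap * (2 * (dirichlet_err M * L) + dirichlet_err (2 * M) * L)). split.
  - replace (Finite 0) with (Finite (/ Cmod kap * (2 * (0 * L) + 0 * L))) by (f_equal; ring).
    assert (H2 : is_lim_seq (fun M => dirichlet_err (2 * M)) 0).
    { apply (is_lim_seq_subseq dirichlet_err 0 (fun M => (2 * M)%nat)); [|apply dirichlet_err_lim].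
      apply eventually_subseq. intros n. lia. }
    apply is_lim_seq_mult'; [apply is_lim_seq_const|]. apply is_lim_seq_plus'.
    + apply is_lim_seq_mult'; [apply is_lim_seq_const|]. apply is_lim_seq_mult'; [apply dirichlet_err_lim|apply is_lim_seq_const].
    + apply is_lim_seq_mult'; [exact H2|apply is_lim_seq_const].
  - intros M.
    assert (HS : forall N M, Cint (fun y => RtoC (dirichlet M (INR N * y)) * f0 y)%C 0 1 = (kap * Spart N M)%C).
    { intros N M'. rewrite dirichlet_sum_coef. unfold Spart. rewrite <- csum_scal. reflexivity. }
    pose proof (dirichlet_trapezoid 1 (2 * M) f0 L ltac:(lia) HL) as D1.
    pose proof (dirichlet_trapezoid 2 M f0 L ltac:(lia) HL) as D2.
    rewrite HS in D1, D2.
    assert (F0 : f0 0 = 1%C) by (unfold f0; replace (twopii * t * 0)%C with (RtoC 0) by ring; apply cexp_0).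
    assert (F1 : f0 1 = (q * q)%C) by (unfold f0; rewrite qsq; f_equal; ring).
    assert (F2 : f0 (1 / 2) = q).
    { unfold f0, q. f_equal. rewrite twopii_pi_i. replace (RtoC (1 / 2)) with (/ 2)%C by (apply C_ext; simpl; field). field. }
    assert (T1 : trapezoid 1 f0 = ((1 + q * q) / 2)%C).
    { unfold trapezoid. simpl. replace (0 / 1) with 0 by field. replace (1 / 1) with 1 by field.
      rewrite F0, F1, Rinv_1. field. }
    assert (T2 : trapezoid 2 f0 = (((1 + q) / 2 + (q + q * q) / 2) / 2)%C).
    { unfold trapezoid. simpl. replace (0 / (1 + 1)) with 0 by field. replace (1 / (1 + 1)) with (1 / 2) by field.
      replace ((1 + 1) / (1 + 1)) with 1 by field.
      rewrite F0, F1, F2. replace (RtoC (/ (1 + 1))) with (/ 2)%C by (apply C_ext; simpl; field). field. }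
    rewrite T1 in D1. rewrite T2 in D2.
    assert (EA : (A M - q / kap = / kap * (2 * (kap * Spart 2 M - ((1 + q) / 2 + (q + q * q) / 2) / 2)
       - (kap * Spart 1 (2 * M) - (1 + q * q) / 2)))%C).
    { unfold A. field. exact Hk. }
    rewrite EA, Cmod_mult, Cmod_inv by exact Hk.
    apply Rmult_le_compat_l; [left; apply Rinv_0_lt_compat; apply Cmod_gt_0; auto|].
    eapply Rle_trans; [apply Cmod_triangle_minus|]. apply Rplus_le_compat; auto.
    rewrite Cmod_mult, Cmod_R, Rabs_pos_eq by lra. apply Rmult_le_compat_l; [lra|auto].
Qed.

(** The integral of the [n]-th exponential in the geometric expansion of the secant; its two
    fractions come from the two half-lines. *)
Let term (n : nat) : C := (RtoC ((-1) ^ n) * (/ (RtoC (INR n + 1) - t) + / (RtoC (INR n) + t)))%C.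

(** [A M] is the sum of [(-1)^k / (t - k)] over [|k| <= 2 M]. The paired terms run over the same [k]
    except [k = -2 M], which accounts for the correction. *)
Lemma term_sum_A M : csum_range (2 * M) term = (A M - / (t + RtoC (INR (2 * M))))%C.
Proof.
  assert (Hpos : forall z, (0 <= z)%Z -> (t + RtoC (IZR z) <> 0)%C).
  { intros z Hz. apply IZR_le in Hz. apply C_neq_Re. simpl. unfold Re in *. lra. }
  induction M as [|M IH].
  - unfold A, Spart. simpl. replace (t + 0)%C with t by ring. replace (t - 0)%C with t by ring.
    assert (t <> 0)%C by (apply C_neq_Re; simpl; lra). field. auto.
  - replace (2 * S M)%nat with (S (S (2 * M))) by lia.
    change (csum_range (S (S (2 * M))) term) with
      (csum_range (2 * M) term + term (2 * M)%nat + term (S (2 * M)))%C.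
    rewrite IH. unfold A, Spart.
    rewrite (csum_sym_S M (fun z => / (t - RtoC (IZR (Z.of_nat 2 * z))))%C).
    replace (2 * S M)%nat with (S (S (2 * M))) by lia.
    rewrite (csum_sym_S (S (2 * M)) (fun z => / (t - RtoC (IZR (Z.of_nat 1 * z))))%C).
    rewrite (csum_sym_S (2 * M) (fun z => / (t - RtoC (IZR (Z.of_nat 1 * z))))%C).
    unfold term.
    replace ((-1) ^ S (2 * M)) with (-1) by (rewrite pow_1_odd; reflexivity).
    replace ((-1) ^ (2 * M)) with 1 by (rewrite pow_1_even; reflexivity).
    set (s1 := csum_range (2 * M + 1) _). set (s2 := csum_range (2 * (2 * M) + 1) _).
    rewrite !INR_IZR_INZ.
    set (z := Z.of_nat (2 * M)).
    replace (Z.of_nat (S (2 * M))) with (z + 1)%Z by lia.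
    replace (Z.of_nat (S (S (2 * M)))) with (z + 2)%Z by lia.
    replace (Z.of_nat 2 * Z.of_nat (S M))%Z with (z + 2)%Z by lia.
    replace (Z.of_nat 2 * - Z.of_nat (S M))%Z with (- (z + 2))%Z by lia.
    replace (Z.of_nat 1 * (z + 1))%Z with (z + 1)%Z by lia.
    replace (Z.of_nat 1 * - (z + 1))%Z with (- (z + 1))%Z by lia.
    replace (Z.of_nat 1 * (z + 2))%Z with (z + 2)%Z by lia.
    replace (Z.of_nat 1 * - (z + 2))%Z with (- (z + 2))%Z by lia.
    pose proof (t_minus_IZR (z + 1)) as N1. pose proof (t_minus_IZR (z + 2)) as N2.
    pose proof (Hpos z ltac:(lia)) as N3. pose proof (Hpos (z + 1)%Z ltac:(lia)) as N4. pose proof (Hpos (z + 2)%Z ltac:(lia)) as N5.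
    rewrite !opp_IZR. rewrite (plus_IZR z 1), (plus_IZR z 2) in *.
    set (x := IZR z) in *.
    replace (RtoC (x + 1 + 1)) with (RtoC x + 2)%C by (apply C_ext; simpl; ring).
    rewrite !RtoC_opp.
    rewrite (RtoC_plus x 1), (RtoC_plus x 2) in *.
    clearbody s1 s2. clear IH.
    field.
    repeat split; first [assumption | nz_by N1 | nz_by N2 | nz_by N3 | nz_by N4 | nz_by N5].
Qed.

Variable r : R.
Hypothesis Hr : 0 < r.

Let a : C := (2 * t - 1)%C.

Definition ebase (al be : C) (x : R) : C := cexp (al * RtoC (r * x) - be * RtoC (r * Rabs x)).

Lemma Re_a : -1 < Re a < 1.
Proof. unfold a. simpl. unfold Re in *. lra. Qed.

Lemma Re_al_be (al : C) (be x : R) : Re (al * RtoC (r * x) - RtoC be * RtoC (r * Rabs x))%C = r * (Re al * x - be * Rabs x).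
Proof. simpl. unfold Re. ring. Qed.

Lemma ebase_dom (al : C) (be : R) : Rabs (Re al) < be -> dominated_by (ebase al (RtoC be)) 1 (r * (be - Rabs (Re al))).
Proof.
  intros H. split; [apply Rmult_lt_0_compat; lra|split].
  - intros x. apply Ccont_cexp. apply Ccont_minus; (apply Ccont_mult; [apply Ccont_const|]).
    + apply Ccont_RtoC. cont_of_derive.
    + apply Ccont_RtoC. apply (continuous_mult (K := R_AbsRing) (fun _ => r) Rabs); [apply continuous_const|].
      apply continuous_Rabs.
  - intros x. unfold ebase. rewrite Cmod_cexp, Rmult_1_l, Re_al_be. apply exp_le.
    pose proof (Rle_abs (Re al * x)) as E. rewrite Rabs_mult in E. apply (Rmult_le_compat_l r) in E; [|lra]. lra.
Qed.

Lemma exp_cconv (c : C) : Re c < 0 -> cconv (fun A => cexp (RtoC A * c)) 0%C.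
Proof.
  intros Hc eps He. destruct (exp_small (- Re c) 1 eps ltac:(lra) ltac:(lra) He) as [A0 [HA HB]].
  exists A0. split; auto. intros B HBB. specialize (HB B HBB).
  replace (cexp (RtoC B * c) - 0)%C with (cexp (RtoC B * c)) by ring. rewrite Cmod_cexp.
  replace (Re (RtoC B * c)%C) with (- - Re c * B); [lra|]. simpl. unfold Re; ring.
Qed.

Lemma CintR_ebase (al : C) (be : R) : Rabs (Re al) < be ->
  CintR (ebase al (RtoC be)) = (/ RtoC r * (/ (RtoC be - al) + / (RtoC be + al)))%C.
Proof.
  intros H. pose proof (ebase_dom al be H) as HD.
  assert (HRe : - be < Re al < be) by (apply Rabs_def2 in H; lra).
  set (c1 := (RtoC r * (al - RtoC be))%C). set (c2 := (RtoC r * (al + RtoC be))%C).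
  assert (Hr0 : RtoC r <> 0%C) by (apply RtoC_neq_0; lra).
  assert (Hn1 : (RtoC be - al <> 0)%C) by (apply C_neq_Re; simpl; unfold Re in *; lra).
  assert (Hn2 : (RtoC be + al <> 0)%C) by (apply C_neq_Re; simpl; unfold Re in *; lra).
  assert (R1 : Re c1 < 0) by (unfold c1; simpl; unfold Re in *; nra).
  assert (R2 : 0 < Re c2) by (unfold c2; simpl; unfold Re in *; nra).
  assert (Hc1 : c1 <> 0%C) by (intros E; rewrite E in R1; simpl in R1; lra).
  assert (Hc2 : c2 <> 0%C) by (intros E; rewrite E in R2; simpl in R2; lra).
  apply CintR_unique; [exists 1, (r * (be - Rabs (Re al))); exact HD|].
  apply (cconv_ext_pos (fun A => / c1 * cexp (RtoC A * c1) + (- / c2 * cexp (RtoC A * - c2) + (- / c1 + / c2)))%C).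
  - intros A0 HA.
    assert (HCC : forall u v, Ccont_on (ebase al (RtoC be)) u v) by (intros u v x _; apply HD).
    rewrite <- (Cint_Chasles _ (- A0) 0 A0) by (auto; lra).
    assert (HF : forall (c : C) (x : R), c <> 0%C -> Cderiv (fun y => / c * cexp (RtoC y * c))%C x (cexp (RtoC x * c))).
    { intros c x Hc. eapply Cderiv_eq; [|apply Cderiv_mult; [apply Cderiv_const|apply Cderiv_cexp_lin]]. cbv beta. field. auto. }
    rewrite (Cint_ext _ (fun y => cexp (RtoC y * c2)) (- A0) 0).
    2: lra.
    2:{ intros x Hx. unfold ebase. f_equal. rewrite Rabs_left by lra. unfold c2. rewrite !RtoC_mult, RtoC_opp. ring. }
    rewrite (Cint_ext (ebase al be) (fun y => cexp (RtoC y * c1)) 0 A0).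
    2: lra.
    2:{ intros x Hx. unfold ebase. f_equal. rewrite Rabs_pos_eq by lra. unfold c1. rewrite !RtoC_mult. ring. }
    rewrite (Cint_FTC (fun y => / c1 * cexp (RtoC y * c1))%C _ 0 A0); [|lra|intros; apply HF; auto|].
    2:{ intros x _. eapply Cderiv_Ccont. apply Cderiv_cexp_lin. }
    rewrite (Cint_FTC (fun y => / c2 * cexp (RtoC y * c2))%C _ (- A0) 0); [|lra|intros; apply HF; auto|].
    2:{ intros x _. eapply Cderiv_Ccont. apply Cderiv_cexp_lin. }
    replace (0 * c1)%C with (RtoC 0) by ring. replace (0 * c2)%C with (RtoC 0) by ring.
    replace (RtoC (- A0) * c2)%C with (RtoC A0 * - c2)%C by (rewrite RtoC_opp; ring).
    rewrite cexp_0. ring.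
  - replace (/ RtoC r * (/ (RtoC be - al) + / (RtoC be + al)))%C with (/ c1 * 0 + (- / c2 * 0 + (- / c1 + / c2)))%C.
    + apply cconv_plus; [apply cconv_scal; apply exp_cconv; auto|].
      apply cconv_plus; [apply cconv_scal; apply exp_cconv; change (Re (- c2)%C) with (- Re c2); lra|]. apply cconv_const.
    + unfold c1, c2. field. repeat split; auto.
      * intros E. apply Hn1. replace (be - al)%C with (- (al - be))%C by ring. rewrite E. ring.
Qed.

(** This is [r exp (a r x) / cosh (r x)] with [a = 2 t - 1]. The factor [r] makes the integral
    independent of [r]; its value is [PI / sin (PI t)], appearing below as [q / kap]. *)
Definition sech_int (x : R) : C := (2 * RtoC r * cexp (a * RtoC (r * x)) / RtoC (exp (r * x) + exp (- (r * x))))%C.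

Lemma geom_alt (u : R) M : 0 <= u ->
  csum_range M (fun n => RtoC ((-1) ^ n * u ^ n)) = RtoC ((1 - (- u) ^ M) / (1 + u)).
Proof.
  intros Hu. induction M as [|M IH].
  - simpl. f_equal. field. lra.
  - simpl csum_range. rewrite IH, <- RtoC_plus. f_equal. simpl.
    replace ((- u) ^ M) with ((-1) ^ M * u ^ M) by (rewrite <- Rpow_mult_distr; f_equal; ring). field. lra.
Qed.

Lemma exp_INR n x : exp (INR n * x) = exp x ^ n.
Proof.
  induction n as [|n IH]; [simpl; rewrite Rmult_0_l; apply exp_0|].
  rewrite S_INR. replace ((INR n + 1) * x) with (x + INR n * x) by ring. rewrite exp_plus, IH. reflexivity.
Qed.

Let PM (M : nat) (x : R) : C := csum_range M (fun n => RtoC (2 * r * (-1) ^ n) * ebase a (RtoC (2 * INR n + 1)) x)%C.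

(** The geometric series in [exp (-2 r |x|)] diverges at [x = 0], so the exact remainder of the
    finite sum is kept. It is the next exponential times a bounded factor, and its integral vanishes
    in the limit because the decay rate grows with [M]. *)
Lemma sech_remainder M x : (sech_int x - PM M x)%C =
  (ebase a (RtoC (2 * INR M + 1)) x * RtoC (2 * r * (-1) ^ M / (1 + exp (- (2 * r * Rabs x)))))%C.
Proof.
  set (y := r * Rabs x). set (u := exp (- (2 * y))).
  assert (Hu : 0 < u) by apply exp_pos.
  assert (He : forall n, ebase a (RtoC (2 * INR n + 1)) x = (cexp (a * RtoC (r * x)) * RtoC (exp (- y) * u ^ n))%C).
  { intros n. unfold ebase, Cminus. rewrite cexp_add. f_equal. unfold u. rewrite <- exp_INR, <- exp_plus, <- cexp_RtoC.
    f_equal. fold y. rewrite <- RtoC_mult, <- RtoC_opp. f_equal. ring. }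
  assert (HP : PM M x = (cexp (a * RtoC (r * x)) * RtoC (2 * r * exp (- y)) * RtoC ((1 - (- u) ^ M) / (1 + u)))%C).
  { unfold PM. rewrite <- geom_alt by lra. rewrite <- csum_scal. apply csum_ext. intros n _.
    rewrite He, !RtoC_mult. ring. }
  assert (Hs : sech_int x = (cexp (a * RtoC (r * x)) * RtoC (2 * r * exp (- y) / (1 + u)))%C).
  { unfold sech_int.
    assert (Ed : exp (r * x) + exp (- (r * x)) = exp y + exp (- y)).
    { unfold y. destruct (Rle_dec 0 x).
      - rewrite Rabs_pos_eq by lra. reflexivity.
      - rewrite Rabs_left by lra. replace (- (r * - x)) with (r * x) by ring.
        replace (r * - x) with (- (r * x)) by ring. ring. }
    rewrite Ed.
    assert (Eu : u = exp (- y) * exp (- y)) by (unfold u; rewrite <- exp_plus; f_equal; ring).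
    assert (Ey : exp y = / exp (- y)) by (rewrite <- exp_Ropp; f_equal; ring).
    pose proof (exp_pos (- y)) as Hy.
    replace (2 * r * exp (- y) / (1 + u)) with (2 * r / (exp y + exp (- y))).
    - replace (RtoC (2 * r / (exp y + exp (- y)))) with (2 * RtoC r * / RtoC (exp y + exp (- y)))%C
        by (rewrite <- RtoC_inv by (pose proof (exp_pos y); lra); rewrite <- !RtoC_mult; reflexivity).
      unfold Cdiv. ring.
    - rewrite Ey, Eu. field. split; nra. }
  rewrite HP, Hs, He.
  replace (2 * r * Rabs x) with (2 * y) by (unfold y; ring). fold u.
  replace ((- u) ^ M) with ((-1) ^ M * u ^ M) by (rewrite <- Rpow_mult_distr; f_equal; ring).
  replace (2 * r * exp (- y) / (1 + u)) with (2 * r * exp (- y) * / (1 + u)) by reflexivity.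
  unfold Rdiv. rewrite !RtoC_mult, RtoC_minus, !RtoC_mult. ring.
Qed.

Lemma Rabs_Re_a n : Rabs (Re a) < 2 * INR n + 1.
Proof. pose proof Re_a. pose proof (pos_INR n). apply Rabs_def1; lra. Qed.

Lemma remainder_dom M : dominated_by (fun x => sech_int x - PM M x)%C (2 * r) (r * (2 * INR M + 1 - Rabs (Re a))).
Proof.
  pose proof (ebase_dom a (2 * INR M + 1) (Rabs_Re_a M)) as [Hc [HC HB]].
  split; [auto|split].
  - intros x. apply (Ccont_ext (fun x => ebase a (RtoC (2 * INR M + 1)) x * RtoC (2 * r * (-1) ^ M / (1 + exp (- (2 * r * Rabs x)))))%C).
    + intros u. symmetry. apply sech_remainder.
    + apply Ccont_mult; auto. apply Ccont_RtoC.
      apply (continuous_mult (K := R_AbsRing) (fun _ => 2 * r * (-1) ^ M)); [apply continuous_const|].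
      apply continuous_Rinv_comp.
      * apply (continuous_plus (V := R_NormedModule) (fun _ => 1)); [apply continuous_const|].
        apply (continuous_comp (fun x => - (2 * r * Rabs x)) exp); [|apply continuous_exp].
        apply (continuous_opp (V := R_NormedModule)). apply (continuous_mult (K := R_AbsRing) (fun _ => 2 * r) Rabs); [apply continuous_const|].
        apply continuous_Rabs.
      * pose proof (exp_pos (- (2 * r * Rabs x))). lra.
  - intros x. rewrite sech_remainder, Cmod_mult, Cmod_R. specialize (HB x). rewrite Rmult_1_l in HB.
    rewrite (Rmult_comm (2 * r) (exp (- (r * (2 * INR M + 1 - Rabs (Re a))) * Rabs x))). apply Rmult_le_compat; auto; try apply Cmod_ge_0; try apply Rabs_pos.
    unfold Rdiv. rewrite Rabs_mult, Rabs_mult, pow_1_abs, Rmult_1_r, Rabs_pos_eq by lra.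
    pose proof (exp_pos (- (2 * r * Rabs x))).
    rewrite Rabs_pos_eq by (left; apply Rinv_0_lt_compat; lra).
    apply Rle_trans with (2 * r * 1); [|lra]. apply Rmult_le_compat_l; [lra|].
    apply Rle_trans with (/ 1); [|lra]. apply Rinv_le_contravar; lra.
Qed.

Lemma PM_dominated_CintR M : dominated (PM M) /\ CintR (PM M) = csum_range M term.
Proof.
  induction M as [|M [IHD IHI]].
  - split.
    + exists 0, 1. split; [lra|split]; intros x; [apply Ccont_const|]. unfold PM. simpl. rewrite Cmod_0. lra.
    + unfold PM. simpl. assert (H : dominated (fun _ => RtoC 0)).
      { exists 0, 1. split; [lra|split]; intros x; [apply Ccont_const|]. rewrite Cmod_0. lra. }
      rewrite (CintR_ext _ (fun _ => 0 * 0)%C) by (intros; ring). rewrite (CintR_scal 0 (fun _ => 0%C)); auto. ring.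
  - assert (HE : dominated (ebase a (RtoC (2 * INR M + 1)))) by (eexists; eexists; apply ebase_dom; apply Rabs_Re_a).
    assert (HE2 : dominated (fun x => RtoC (2 * r * (-1) ^ M) * ebase a (RtoC (2 * INR M + 1)) x)%C) by (apply dominated_scal; auto).
    split.
    + apply (dominated_plus _ _ IHD HE2).
    + change (CintR (fun x => PM M x + RtoC (2 * r * (-1) ^ M) * ebase a (RtoC (2 * INR M + 1)) x)%C = (csum_range M term + term M)%C).
      rewrite CintR_plus, IHI, CintR_scal, CintR_ebase; auto; [|apply Rabs_Re_a]. f_equal.
      unfold term, a.
      assert (Hr0 : RtoC r <> 0%C) by (apply RtoC_neq_0; lra).
      assert (N1 : (INR M + 1 - t)%C <> 0%C) by (apply C_neq_Re; simpl; pose proof (pos_INR M); unfold Re in *; lra).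
      assert (N2 : (INR M + t)%C <> 0%C) by (apply C_neq_Re; simpl; pose proof (pos_INR M); unfold Re in *; lra).
      replace (RtoC (2 * INR M + 1) - (2 * t - 1))%C with (2 * (INR M + 1 - t))%C by (rewrite !RtoC_plus, RtoC_mult; ring).
      replace (RtoC (2 * INR M + 1) + (2 * t - 1))%C with (2 * (INR M + t))%C by (rewrite !RtoC_plus, RtoC_mult; ring).
      rewrite !RtoC_mult, RtoC_plus. field. auto.
Qed.

Lemma sech_dominated : dominated sech_int.
Proof.
  apply (dominated_ext (fun x => (sech_int x - PM 0 x) + PM 0 x)%C); [intros; ring|].
  apply dominated_plus; [|apply PM_dominated_CintR]. eexists; eexists; apply remainder_dom.
Qed.

Lemma CintR_sech : CintR sech_int = (q / kap)%C.
Proof.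
  apply Ceq_minus. apply Cmod_eq_0. apply Rle_antisym; [|apply Cmod_ge_0].
  destruct A_limit as [e [He HA]].
  (* Three errors: the remainder of the geometric sum, the single unpaired fraction of [term_sum_A],
     and the error in Dirichlet's theorem. *)
  apply (Rle_0_limit _ (fun M => 4 / (1 - Rabs (Re a)) * / (INR M + 1) + (/ Re t * / (INR M + 1) + e M))).
  - intros M.
    replace (CintR sech_int - q / kap)%C with ((CintR sech_int - CintR (PM (2 * M))) +
      ((CintR (PM (2 * M)) - A M) + (A M - q / kap)))%C by ring.
    eapply Rle_trans; [apply Cmod_triangle|]. apply Rplus_le_compat; [|eapply Rle_trans; [apply Cmod_triangle|apply Rplus_le_compat; auto]].
    + rewrite <- CintR_minus; [|apply sech_dominated|apply PM_dominated_CintR].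
      eapply Rle_trans; [apply (CintR_bound _ _ _ (remainder_dom (2 * M)))|].
      pose proof Re_a. assert (Ha : 0 <= Rabs (Re a) < 1) by (split; [apply Rabs_pos|apply Rabs_def1; lra]).
      rewrite mult_INR. simpl (INR 2). pose proof (pos_INR M).
      replace (4 / (1 - Rabs (Re a)) * / (INR M + 1)) with (4 * / ((1 - Rabs (Re a)) * (INR M + 1))) by (field; lra).
      replace (2 * (2 * r) / (r * (2 * ((1 + 1) * INR M) + 1 - Rabs (Re a)))) with
        (4 * / (2 * ((1 + 1) * INR M) + 1 - Rabs (Re a))) by (field; split; nra).
      apply Rmult_le_compat_l; [lra|]. apply Rinv_le_contravar; nra.
    + rewrite (proj2 (PM_dominated_CintR (2 * M))), term_sum_A.
      match goal with |- Cmod ?z <= _ => replace z with (- / (t + RtoC (INR (2 * M))))%C by ring end.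
      pose proof (pos_INR M).
      assert (N : (t + RtoC (INR (2 * M)) <> 0)%C) by (apply C_neq_Re; simpl; pose proof (pos_INR (2 * M)); unfold Re in *; simpl in *; lra).
      rewrite Cmod_opp, Cmod_inv by exact N.
      replace (/ Re t * / (INR M + 1)) with (/ (Re t * (INR M + 1))) by (field; lra).
      apply Rinv_le_contravar; [nra|]. eapply Rle_trans; [|apply re_le_Cmod].
      eapply Rle_trans; [|apply Rle_abs]. rewrite mult_INR. simpl (INR 2).
      change (Re (t + RtoC ((1 + 1) * INR M))%C) with (Re t + (1 + 1) * INR M). nra.
  - assert (Hi : is_lim_seq (fun M => / (INR M + 1)) 0).
    { apply (is_lim_seq_ext (fun M => / INR (S M))); [intros; rewrite S_INR; reflexivity|].
      apply (is_lim_seq_incr_1 (fun n => / INR n)).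
      replace (Finite 0) with (Rbar_inv p_infty) by reflexivity.
      apply is_lim_seq_inv; [apply is_lim_seq_INR|discriminate]. }
    replace (Finite 0) with (Finite (4 / (1 - Rabs (Re a)) * 0 + (/ Re t * 0 + 0))) by (f_equal; ring).
    apply is_lim_seq_plus'; [|apply is_lim_seq_plus'; auto]; apply is_lim_seq_mult'; auto; apply is_lim_seq_const.
Qed.

Lemma CintR_sech_eq : (CintR sech_int * (1 - cexp (twopii * t)) = - (twopii * cexp (pi_i * t)))%C.
Proof.
  rewrite CintR_sech, <- qsq. fold q. unfold kap. pose proof twopii_neq_0. pose proof one_minus_qsq as N.
  field. split; auto. intros E. apply N. replace (1 - q * q)%C with (- (q * q - 1))%C by ring. rewrite E. ring.
Qed.
End Sech.

(** * The dilogarithm on its strip *)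

Lemma Im_csinh (z : C) : Im (csinh z) = (exp (Re z) + exp (- Re z)) / 2 * sin (Im z).
Proof.
  unfold csinh, cexp. destruct z as [p q]. simpl. rewrite sin_neg, cos_neg. field.
Qed.

Lemma Re_csinh (z : C) : Re (csinh z) = (exp (Re z) - exp (- Re z)) / 2 * cos (Im z).
Proof.
  unfold csinh, cexp. destruct z as [p q]. simpl. rewrite sin_neg, cos_neg. field.
Qed.

(** The imaginary part [cosh (Re z) sin (Im z)] alone suffices: on a horizontal contour [sin (Im z)]
    is constant, so the bound grows exponentially in [|Re z|]. *)
Lemma csinh_lower (z : C) : 0 < sin (Im z) -> sin (Im z) * exp (Rabs (Re z)) / 2 <= Cmod (csinh z).
Proof.
  intros Hs. eapply Rle_trans; [|apply im_le_Cmod]. rewrite Im_csinh.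
  pose proof (exp_pos (Re z)). pose proof (exp_pos (- Re z)).
  rewrite (Rabs_pos_eq (_ * _)) by nra.
  assert (exp (Rabs (Re z)) <= exp (Re z) + exp (- Re z)).
  { unfold Rabs. destruct (Rcase_abs (Re z)); lra. }
  nra.
Qed.

Lemma csinh_neq_0 (z : C) : 0 < sin (Im z) -> csinh z <> 0%C.
Proof.
  intros Hs. apply Cmod_gt_0. eapply Rlt_le_trans; [|apply csinh_lower; auto].
  pose proof (exp_pos (Rabs (Re z))). nra.
Qed.

Lemma Ccont_csinh f x : Ccont f x -> Ccont (fun u => csinh (f u)) x.
Proof.
  intros H. apply Ccont_mult; [|apply Ccont_const]. apply Ccont_minus; apply Ccont_cexp; auto. apply Ccont_opp; auto.
Qed.

Section Strip.
Variable N : nat.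
Hypothesis HN : (1 <= N)%nat.

Let r : R := sqrt (INR N).
(** The value of [delta_b r], since [r >= 1]. At this height the argument [w r] has imaginary part
    exactly [PI / 2], while [w / r] has imaginary part [PI / (2 N)], where the sine is still
    positive. *)
Let del : R := PI / (2 * r).

Lemma INR_N_ge_1 : 1 <= INR N.
Proof. apply (le_INR 1). exact HN. Qed.

Lemma r_sq : r * r = INR N.
Proof. apply sqrt_sqrt. pose proof INR_N_ge_1. lra. Qed.

Lemma r_ge_1 : 1 <= r.
Proof. pose proof INR_N_ge_1. unfold r. rewrite <- sqrt_1. apply sqrt_le_1_alt. auto. Qed.

Lemma r_inv_N : / r = r * / INR N.
Proof. pose proof r_ge_1. rewrite <- r_sq. field. lra. Qed.

Lemma del_pos : 0 < del.
Proof. pose proof r_ge_1. pose proof PI_RGT_0. apply Rdiv_lt_0_compat; lra. Qed.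

Lemma delta_b_eq : delta_b r = del.
Proof.
  pose proof r_ge_1. pose proof PI_RGT_0. unfold delta_b, del.
  rewrite Rmin_right; [field; lra|].
  apply Rle_trans with (PI * 1); [|nra]. unfold Rdiv. apply Rmult_le_compat_l; [lra|].
  rewrite <- Rinv_1. apply Rinv_le_contravar; lra.
Qed.

Definition contour (x : R) : C := (x, del).
(** Substituting [z = i r t - c_b r + i / r] turns the exponent [-2 i z w] into
    [2 r t w + (1 / r - r) w]. The coefficient of [t] is this function; the remaining exponential
    belongs to [dilog_kernel]. *)
Definition dilog_freq (x : R) : C := (RtoC (2 * r) * contour x)%C.
Definition dilog_kernel (x : R) : C :=
  (cexp (RtoC (/ r - r) * contour x) / (4 * csinh (contour x * RtoC r) * csinh (contour x / RtoC r)) / contour x)%C.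
(** Lowering [t] by [1 / N] multiplies the integrand by [exp (-2 w / r)], and [1 - exp (-2 w / r) =
    2 exp (-w / r) sinh (w / r)] cancels one hyperbolic sine of [dilog_kernel]. *)
Definition ratio_kernel (x : R) : C :=
  (cexp (- (RtoC r * contour x)) / (2 * csinh (contour x * RtoC r)) / contour x)%C.

Lemma contour_neq_0 x : contour x <> 0%C.
Proof. pose proof del_pos. intros E. apply (f_equal Im) in E. simpl in E. lra. Qed.

Lemma rC_neq_0 : RtoC r <> 0%C.
Proof. pose proof r_ge_1. apply RtoC_neq_0. lra. Qed.

Lemma Re_wr x : Re (contour x * RtoC r)%C = r * x.
Proof. simpl. ring. Qed.
Lemma Im_wr x : Im (contour x * RtoC r)%C = PI / 2.
Proof. pose proof r_ge_1. simpl. unfold del. field. lra. Qed.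
Lemma Re_wdr x : Re (contour x / RtoC r)%C = x / r.
Proof. pose proof r_ge_1. unfold Cdiv. rewrite <- RtoC_inv by lra. simpl. unfold Rdiv. ring. Qed.
Lemma Im_wdr x : Im (contour x / RtoC r)%C = PI / 2 * / INR N.
Proof. pose proof r_ge_1. unfold Cdiv. rewrite <- RtoC_inv by lra. rewrite <- r_sq. simpl. unfold del. field. lra. Qed.

Lemma sin_wdr_pos : 0 < sin (PI / 2 * / INR N).
Proof.
  pose proof INR_N_ge_1. pose proof PI_RGT_0.
  assert (0 < / INR N <= 1).
  { split; [apply Rinv_0_lt_compat; lra|]. rewrite <- Rinv_1. apply Rinv_le_contravar; lra. }
  apply sin_gt_0; nra.
Qed.

Lemma Ccont_contour x : Ccont contour x.
Proof. split; simpl; [apply continuous_id|apply continuous_const]. Qed.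

Lemma Swr_neq_0 x : csinh (contour x * RtoC r) <> 0%C.
Proof. apply csinh_neq_0. rewrite Im_wr, sin_PI2. lra. Qed.
Lemma Swdr_neq_0 x : csinh (contour x / RtoC r) <> 0%C.
Proof. apply csinh_neq_0. rewrite Im_wdr. apply sin_wdr_pos. Qed.

Lemma Ccont_dilog_kernel x : Ccont dilog_kernel x.
Proof.
  apply Ccont_div; [apply Ccont_div| |apply contour_neq_0]; [| |apply Cmult_neq_0; [apply Cmult_neq_0|]| apply Ccont_contour].
  - apply Ccont_cexp. apply Ccont_mult; [apply Ccont_const|apply Ccont_contour].
  - apply Ccont_mult; [apply Ccont_mult; [apply Ccont_const|]|]; apply Ccont_csinh; apply Ccont_mult; try apply Ccont_contour; apply Ccont_const.
  - apply RtoC_neq_0; lra.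
  - apply Swr_neq_0.
  - apply Swdr_neq_0.
Qed.

Lemma Ccont_ratio_kernel x : Ccont ratio_kernel x.
Proof.
  apply Ccont_div; [apply Ccont_div| |apply contour_neq_0]; [| |apply Cmult_neq_0| apply Ccont_contour].
  - apply Ccont_cexp. apply Ccont_opp. apply Ccont_mult; [apply Ccont_const|apply Ccont_contour].
  - apply Ccont_mult; [apply Ccont_const|]; apply Ccont_csinh; apply Ccont_mult; try apply Ccont_contour; apply Ccont_const.
  - apply RtoC_neq_0; lra.
  - apply Swr_neq_0.
Qed.

Lemma dilog_freq_growth : lin_growth dilog_freq (2 * r) (2 * r * del).
Proof.
  pose proof r_ge_1. pose proof del_pos. split; [lra|split; [nra|split]].
  - intros x. apply Ccont_mult; [apply Ccont_const|apply Ccont_contour].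
  - intros x. unfold dilog_freq. rewrite Cmod_RtoC_mult, Rabs_pos_eq by lra.
    pose proof (Cmod_Re_Im (contour x)) as E. simpl in E. rewrite (Rabs_pos_eq del) in E by lra. nra.
Qed.

Lemma E_strip_CintR t : E_strip N t = cexp (CintR (exp_integrand dilog_freq dilog_kernel t)).
Proof.
  unfold E_strip, Phi_strip, CintR. fold r. f_equal. f_equal.
  apply functional_extensionality. intros x.
  unfold faddeev_integrand, exp_integrand, dilog_kernel, c_b. rewrite delta_b_eq. fold (contour x). unfold dilog_freq.
  pose proof rC_neq_0. pose proof (contour_neq_0 x). pose proof (Swr_neq_0 x). pose proof (Swdr_neq_0 x).
  match goal with |- (cexp ?z / _ / _)%C = _ => replace z with (t * (RtoC (2 * r) * contour x) + RtoC (/ r - r) * contour x)%C end.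
  - rewrite cexp_add. field. auto.
  - assert (Hr : r <> 0) by (pose proof r_ge_1; lra).
    rewrite RtoC_minus, RtoC_mult, RtoC_inv by auto.
    replace (RtoC ((r + / r) / 2)) with ((RtoC r + / RtoC r) / 2)%C.
      2:{ rewrite RtoC_div, RtoC_plus, RtoC_inv by (auto; lra). reflexivity. }
    match goal with |- _ = ?z => replace z with
      (- (Ci * Ci) * (2 * (RtoC r * t - (RtoC r + / RtoC r) / 2 + / RtoC r) * contour x))%C by (unfold Cdiv; ring) end.
    replace (Ci * Ci)%C with (RtoC (-1)) by (apply C_ext; simpl; ring). field. auto.
Qed.

Lemma dilog_kernel_bound x : Cmod (dilog_kernel x) <= / (sin (PI / 2 * / INR N) * del) * exp ((/ r - r) * x - (r + / r) * Rabs x).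
Proof.
  pose proof r_ge_1 as Hr. pose proof del_pos as Hd. pose proof sin_wdr_pos as Hs.
  pose proof (contour_neq_0 x). pose proof (Swr_neq_0 x). pose proof (Swdr_neq_0 x).
  set (s0 := sin (PI / 2 * / INR N)) in *.
  assert (Hi : 0 < / r) by (apply Rinv_0_lt_compat; lra).
  pose proof (csinh_lower (contour x * RtoC r)) as L1. rewrite Im_wr, Re_wr, sin_PI2 in L1. specialize (L1 ltac:(lra)).
  pose proof (csinh_lower (contour x / RtoC r)) as L2. rewrite Im_wdr, Re_wdr in L2. fold s0 in L2. specialize (L2 Hs).
  rewrite Rabs_mult, (Rabs_pos_eq r) in L1 by lra.
  unfold Rdiv in L2. rewrite Rabs_mult, (Rabs_pos_eq (/ r)) in L2 by lra.
  unfold dilog_kernel.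
  rewrite Cmod_div; auto. rewrite Cmod_div.
  2:{ apply Cmult_neq_0; [apply Cmult_neq_0|]; auto. apply RtoC_neq_0; lra. }
  rewrite Cmod_cexp, !Cmod_mult, Cmod_R, (Rabs_pos_eq 4) by lra.
  replace (Re (RtoC (/ r - r) * contour x)%C) with ((/ r - r) * x) by (simpl; ring).
  set (E1 := exp (r * Rabs x)) in *. set (E2 := exp (Rabs x * / r)) in *.
  assert (HE1 : 0 < E1) by apply exp_pos. assert (HE2 : 0 < E2) by apply exp_pos.
  replace (exp ((/ r - r) * x - (r + / r) * Rabs x)) with (exp ((/ r - r) * x) * / (E1 * E2)).
  2:{ unfold E1, E2. rewrite <- exp_plus, <- exp_Ropp, <- exp_plus. f_equal. ring. }
  assert (Hw : del <= Cmod (contour x)).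
  { eapply Rle_trans; [|apply im_le_Cmod]. simpl. rewrite Rabs_pos_eq; lra. }
  set (P := exp ((/ r - r) * x)). assert (HP : 0 < P) by apply exp_pos.
  replace (/ (s0 * del) * (P * / (E1 * E2))) with (P * / (s0 * del * (E1 * E2))) by (field; repeat split; lra).
  set (S1 := Cmod (csinh (contour x * RtoC r))) in *. set (S2 := Cmod (csinh (contour x / RtoC r))) in *.
  assert (HS1 : 0 < S1) by lra. assert (HS2 : 0 < S2).
  { eapply Rlt_le_trans; [|exact L2]. assert (0 < s0 * E2) by (apply Rmult_lt_0_compat; auto). lra. }
  replace (P / (4 * S1 * S2) / Cmod (contour x)) with (P * / (4 * S1 * S2 * Cmod (contour x))) by (field; repeat split; lra).
  apply Rmult_le_compat_l; [lra|]. apply Rinv_le_contravar.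
  - apply Rmult_lt_0_compat; apply Rmult_lt_0_compat; auto.
  - assert (A1 : E1 * (s0 * E2) <= (2 * S1) * (2 * S2)).
    { apply Rmult_le_compat; try lra. assert (0 < s0 * E2) by (apply Rmult_lt_0_compat; auto). lra. }
    replace (4 * S1 * S2 * Cmod (contour x)) with ((2 * S1 * (2 * S2)) * Cmod (contour x)) by ring.
    replace (s0 * del * (E1 * E2)) with ((E1 * (s0 * E2)) * del) by ring.
    apply Rmult_le_compat; [|lra|auto|auto]. left. apply Rmult_lt_0_compat; auto. apply Rmult_lt_0_compat; auto.
Qed.

Lemma Re_t_dilog_freq t x : Re (t * dilog_freq x)%C = 2 * r * Re t * x - PI * Im t.
Proof. pose proof r_ge_1. unfold dilog_freq, contour, del. simpl. unfold Re, Im. field. lra. Qed.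

(** The decay rates are [2 r (1 - Re t)] to the right and [2 r (Re t + 1 / N)] to the left; the
    strip is where both are positive. *)
Lemma exp_integrand_dilog_kernel_dominated t : - / INR N < Re t < 1 -> dominated (exp_integrand dilog_freq dilog_kernel t).
Proof.
  intros Ht. pose proof r_ge_1 as Hr. pose proof del_pos as Hd. pose proof sin_wdr_pos as Hs.
  set (K0 := / (sin (PI / 2 * / INR N) * del)).
  assert (HK0 : 0 < K0) by (apply Rinv_0_lt_compat; apply Rmult_lt_0_compat; auto).
  set (c := Rmin (2 * r * (1 - Re t)) (2 * r * (Re t + / INR N))).
  exists (exp (- (PI * Im t)) * K0), c. split; [|split].
  - unfold c. apply Rmin_pos; apply Rmult_lt_0_compat; lra.
  - intros x. apply (Ccont_exp_integrand dilog_freq dilog_kernel _ _ dilog_freq_growth Ccont_dilog_kernel).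
  - intros x. unfold exp_integrand. rewrite Cmod_mult, Cmod_cexp, Re_t_dilog_freq.
    eapply Rle_trans; [apply Rmult_le_compat_l; [left; apply exp_pos|apply dilog_kernel_bound]|].
    fold K0. unfold Rminus at 1. rewrite exp_plus.
    replace (exp (2 * r * Re t * x) * exp (- (PI * Im t)) * (K0 * exp ((/ r - r) * x - (r + / r) * Rabs x))) with
      (exp (- (PI * Im t)) * K0 * (exp (2 * r * Re t * x) * exp ((/ r - r) * x - (r + / r) * Rabs x))) by ring.
    apply Rmult_le_compat_l; [apply Rmult_le_pos; [left; apply exp_pos|lra]|].
    rewrite <- exp_plus. apply exp_le.
    assert (Hc1 : c <= 2 * r * (1 - Re t)) by apply Rmin_l.
    assert (Hc2 : c <= 2 * r * (Re t + / INR N)) by apply Rmin_r.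
    clearbody c.
    unfold Rabs. destruct (Rcase_abs x).
    + rewrite r_inv_N in *. 
      replace (2 * r * Re t * x + ((r * / INR N - r) * x - (r + r * / INR N) * - x)) with
        (- (2 * r * (Re t + / INR N)) * (- x)) by ring. nra.
    + replace (2 * r * Re t * x + ((/ r - r) * x - (r + / r) * x)) with (- (2 * r * (1 - Re t)) * x) by ring. nra.
Qed.

Lemma exp_integrand_ratio_kernel_diff t x : (exp_integrand dilog_freq dilog_kernel t x - exp_integrand dilog_freq dilog_kernel (t - RtoC (/ INR N)) x)%C = exp_integrand dilog_freq ratio_kernel t x.
Proof.
  unfold exp_integrand, dilog_kernel, ratio_kernel. pose proof rC_neq_0 as Hr. pose proof (contour_neq_0 x). pose proof (Swr_neq_0 x). pose proof (Swdr_neq_0 x) as H2.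
  pose proof r_ge_1 as Hr1.
  set (u := cexp (contour x / RtoC r)).
  assert (Hu : u <> 0%C) by apply cexp_neq_0.
  assert (ES : csinh (contour x / RtoC r) = ((u - / u) / 2)%C) by (unfold csinh; rewrite cexp_opp; reflexivity).
  replace ((t - RtoC (/ INR N)) * dilog_freq x)%C with (t * dilog_freq x + - (contour x / RtoC r + contour x / RtoC r))%C.
  2:{ unfold dilog_freq. rewrite <- r_sq, RtoC_inv by nra. rewrite !RtoC_mult. field. auto. }
  rewrite cexp_add, (cexp_opp (_ + _)), cexp_add. fold u.
  replace (RtoC (/ r - r) * contour x)%C with (contour x / RtoC r + - (RtoC r * contour x))%C.
  2:{ rewrite RtoC_minus, RtoC_inv by lra. field. auto. }
  rewrite cexp_add. fold u. rewrite ES in *.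
  assert (Hu2 : (u * u - 1)%C <> 0%C).
  { intros E. apply H2. replace ((u - / u) / 2)%C with ((u * u - 1) / (2 * u))%C by (field; auto). rewrite E.
    unfold Cdiv. ring. }
  field. repeat split; auto.
Qed.

Lemma exp_integrand_ratio_kernel_dominated t : 0 < Re t < 1 -> dominated (exp_integrand dilog_freq ratio_kernel t).
Proof.
  intros Ht. assert (Hi : 0 < / INR N) by (apply Rinv_0_lt_compat; pose proof INR_N_ge_1; lra).
  eapply dominated_ext; [intros x; apply exp_integrand_ratio_kernel_diff|]. apply dominated_minus; apply exp_integrand_dilog_kernel_dominated; simpl; unfold Re in *; lra.
Qed.

Lemma csinh_wr x : csinh (contour x * RtoC r) = (Ci * RtoC ((exp (r * x) + exp (- (r * x))) / 2))%C.
Proof.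
  apply C_ext.
  - rewrite Re_csinh, Im_wr, cos_PI2. simpl. ring.
  - rewrite Im_csinh, Im_wr, Re_wr, sin_PI2. simpl. ring.
Qed.

(** Differentiation in [t] brings down [2 r w], which cancels the pole [1 / w]; what is left on this
    contour is the secant integrand up to the factor [- exp (pi i t)]. *)
Lemma CintR_lam_ratio_kernel t : 0 < Re t < 1 ->
  (CintR (fun x => dilog_freq x * exp_integrand dilog_freq ratio_kernel t x) * (1 - cexp (twopii * t)) = twopii * cexp (twopii * t))%C.
Proof.
  intros Ht. pose proof r_ge_1 as Hr1.
  rewrite (CintR_ext _ (fun x => (- cexp (pi_i * t)) * sech_int t r x)%C).
  - rewrite CintR_scal by (apply sech_dominated; auto; lra).
    rewrite <- Cmult_assoc, CintR_sech_eq; auto; [|lra].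
    replace (cexp (twopii * t)) with (cexp (pi_i * t) * cexp (pi_i * t))%C by (apply qsq). ring.
  - intros x. unfold exp_integrand, ratio_kernel, sech_int, dilog_freq.
    pose proof (contour_neq_0 x). pose proof (Swr_neq_0 x) as Hs. rewrite csinh_wr in *.
    set (D := exp (r * x) + exp (- (r * x))).
    assert (HD : 0 < D) by (unfold D; pose proof (exp_pos (r * x)); pose proof (exp_pos (- (r * x))); lra).
    replace (RtoC (D / 2)) with (RtoC D / 2)%C by (rewrite RtoC_div by lra; reflexivity).
    assert (HDC : RtoC D <> 0%C) by (apply RtoC_neq_0; lra).
    assert (HCi : Ci <> 0%C) by (intros E; apply (f_equal Im) in E; simpl in E; lra).
    (* On the contour [w = x + pi i / (2 r)]: the constant part contributes [exp (pi i t)] from the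
       first exponential and [1 / i] from the second. *)
    assert (E : (cexp (t * (RtoC (2 * r) * contour x)) * cexp (- (RtoC r * contour x)))%C =
       (cexp ((2 * t - 1) * RtoC (r * x)) * cexp (pi_i * t) / Ci)%C).
    { rewrite <- cexp_half_pi_i, <- cexp_add, <- cexp_add, <- cexp_minus. f_equal.
      replace (contour x) with (RtoC x + pi_i / (2 * RtoC r))%C.
      - rewrite !RtoC_mult. field. apply rC_neq_0.
      - unfold pi_i, contour, del. replace (RtoC PI * Ci / (2 * RtoC r))%C with (RtoC (PI / (2 * r)) * Ci)%C.
        + apply C_ext; simpl; ring.
        + rewrite RtoC_div by lra. rewrite RtoC_mult. field. apply rC_neq_0. }
    replace (RtoC (2 * r) * contour x * (cexp (t * (RtoC (2 * r) * contour x)) * (cexp (- (RtoC r * contour x)) / (2 * (Ci * (RtoC D / 2))) / contour x)))%C with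
      (RtoC (2 * r) * (cexp (t * (RtoC (2 * r) * contour x)) * cexp (- (RtoC r * contour x))) / (Ci * RtoC D))%C by (field; auto).
    rewrite E, RtoC_mult.
    replace (2 * RtoC r * (cexp ((2 * t - 1) * RtoC (r * x)) * cexp (pi_i * t) / Ci) / (Ci * RtoC D))%C with
      (/ (Ci * Ci) * (2 * RtoC r * (cexp ((2 * t - 1) * RtoC (r * x)) * cexp (pi_i * t)) / (RtoC D)))%C by (field; auto).
    replace (Ci * Ci)%C with (RtoC (-1)) by (apply C_ext; simpl; ring). field. auto.
Qed.

(** The function [H] of the overview: a logarithm of [E_strip N t / E_strip N (t - 1 / N)]. *)
Definition log_ratio (t : C) : C := CintR (exp_integrand dilog_freq ratio_kernel t).

(** The contour has constant height, so moving [t] upwards by [s] scales the modulus of the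
    integrand by [exp (- PI s)] uniformly in [x]. *)
Lemma log_ratio_bound (X : R) : 0 < X < 1 -> exists K, 0 <= K /\ forall s, Cmod (log_ratio (RtoC X + RtoC s * Ci)) <= K * exp (- (PI * s)).
Proof.
  intros HX. destruct (exp_integrand_ratio_kernel_dominated (RtoC X)) as [K [c H]]; [simpl; auto|].
  pose proof (dominated_by_K _ _ _ H) as HK. destruct H as [Hc [HC HB]].
  exists (2 * K / c). split; [unfold Rdiv; apply Rmult_le_pos; [lra|left; apply Rinv_0_lt_compat; auto]|].
  intros s. replace (2 * K / c * exp (- (PI * s))) with (2 * (exp (- (PI * s)) * K) / c) by (unfold Rdiv; ring).
  apply CintR_bound. split; [auto|split].
  - intros x. apply (Ccont_exp_integrand dilog_freq ratio_kernel _ _ dilog_freq_growth Ccont_ratio_kernel).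
  - intros x. rewrite (exp_integrand_shift dilog_freq ratio_kernel), Cmod_mult, Cmod_cexp, Rmult_assoc.
    replace (Re (RtoC s * Ci * dilog_freq x)%C) with (- (PI * s)).
    + apply Rmult_le_compat_l; auto. left; apply exp_pos.
    + pose proof (Re_t_dilog_freq (RtoC s * Ci)%C x) as E. rewrite E. simpl. ring.
Qed.

Lemma exp_log_ratio t : 0 < Re t < 1 -> (cexp (log_ratio t) * (1 - cexp (twopii * t)) = 1)%C.
Proof.
  intros Ht. destruct t as [X Y]. simpl in Ht.
  pose (tt := fun s => (RtoC X + RtoC s * Ci)%C).
  pose (Q := fun s => (cexp (log_ratio (tt s)) * (1 - cexp (twopii * tt s)))%C).
  assert (HRe : forall s, 0 < Re (tt s) < 1) by (intros s; unfold tt; simpl; unfold Re; lra).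
  assert (HQ : forall s, Cderiv Q s 0%C).
  { intros s. unfold Q, tt.
    pose proof (CintR_exp_integrand_derive dilog_freq ratio_kernel _ _ dilog_freq_growth Ccont_ratio_kernel (RtoC X) Ci s (exp_integrand_ratio_kernel_dominated _ (HRe s))) as D1.
    assert (D2 : Cderiv (fun s => twopii * (RtoC X + RtoC s * Ci))%C s (twopii * Ci)%C).
    { eapply Cderiv_eq; [|apply Cderiv_mult; [apply Cderiv_const|apply Cderiv_plus; [apply Cderiv_const|apply Cderiv_mult; [apply Cderiv_id|apply Cderiv_const]]]].
      cbv beta. ring. }
    eapply Cderiv_eq; [|apply Cderiv_mult; [apply Cderiv_cexp; exact D1|apply Cderiv_minus; [apply Cderiv_const|apply Cderiv_cexp; exact D2]]].
    cbv beta. pose proof (CintR_lam_ratio_kernel _ (HRe s)) as J. unfold tt in J. unfold log_ratio.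
    set (I := CintR (fun x => dilog_freq x * exp_integrand dilog_freq ratio_kernel (RtoC X + RtoC s * Ci) x)%C) in *.
    set (e := cexp (twopii * (RtoC X + RtoC s * Ci))) in *.
    set (c := cexp (CintR _)).
    replace (Ci * I * c * (1 - e) + c * (0 - twopii * Ci * e))%C with (Ci * c * (I * (1 - e) - twopii * e))%C by ring.
    rewrite J. ring. }
  assert (Hconst : forall s s', s <= s' -> Q s' = Q s).
  { intros s s' Hss. apply Ceq_minus. rewrite <- (Cint_FTC Q (fun _ => 0%C) s s'); auto.
    - rewrite Cint_const. ring.
    - intros x _. apply Ccont_const. }
  destruct (log_ratio_bound X Ht) as [K [HK HB]].
  assert (HQ1 : Q Y = 1%C).
  { apply Ceq_minus. apply Cmod_eq_0. apply Rle_antisym; [|apply Cmod_ge_0].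
    apply le_epsilon. intros eps Heps. rewrite Rplus_0_l.
    pose proof PI_RGT_0 as HPI.
    (* The constant comes from [e^h (1 - e) - 1 = (e^h - 1) - e^h e]: for [s >= 0] one has
       [|h| <= K], and both [|h| / K] and [|e|] are controlled by [exp (- PI s)]. *)
    destruct (exp_small PI (K * exp K + exp K) eps HPI) as [A [HA HA2]]; auto.
    { pose proof (exp_pos K). nra. }
    set (s := Rmax A Y). assert (Hs0 : 0 <= s) by (unfold s; eapply Rle_trans; [exact HA|apply Rmax_l]).
    rewrite <- (Hconst Y s) by apply Rmax_r.
    specialize (HA2 s (Rmax_l _ _)). left. eapply Rle_lt_trans; [|exact HA2].
    specialize (HB s). fold (tt s) in HB. unfold Q.
    set (h := log_ratio (tt s)) in *. set (e := cexp (twopii * tt s)).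
    assert (He : Cmod e <= exp (- PI * s)).
    { unfold e. rewrite Cmod_cexp, Re_twopii_mult. apply exp_le. unfold tt. simpl. nra. }
    assert (Hp1 : exp (- PI * s) <= 1) by (rewrite <- exp_0; apply exp_le; nra).
    replace (- (PI * s)) with (- PI * s) in HB by ring.
    pose proof (exp_pos (- PI * s)) as Hp.
    assert (HhK : Cmod h <= K) by nra.
    replace (cexp h * (1 - e) - 1)%C with ((cexp h - 1) - cexp h * e)%C by ring.
    eapply Rle_trans; [apply Cmod_triangle_minus|].
    rewrite Rmult_plus_distr_r. apply Rplus_le_compat.
    - eapply Rle_trans; [apply cexp_1_bound|].
      replace (K * exp K * exp (- PI * s)) with (K * exp (- PI * s) * exp K) by ring.
      apply Rmult_le_compat; auto; [apply Cmod_ge_0|left; apply exp_pos|apply exp_le; auto].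
    - rewrite Cmod_mult. apply Rmult_le_compat; auto; try apply Cmod_ge_0.
      eapply Rle_trans; [apply Cmod_cexp_le|apply exp_le; auto]. }
  unfold Q in HQ1. replace (tt Y) with (X, Y) in HQ1; [exact HQ1|].
  unfold tt. apply C_ext; simpl; ring.
Qed.

Lemma E_strip_shift t : 0 < Re t < 1 ->
  (E_strip N t * (1 - cexp (twopii * t)) = E_strip N (t - RtoC (/ INR N)))%C.
Proof.
  intros Ht. assert (Hi : 0 < / INR N) by (apply Rinv_0_lt_compat; pose proof INR_N_ge_1; lra).
  rewrite !E_strip_CintR.
  assert (E : CintR (exp_integrand dilog_freq dilog_kernel t) = (CintR (exp_integrand dilog_freq dilog_kernel (t - RtoC (/ INR N))) + log_ratio t)%C).
  { unfold log_ratio. rewrite <- (CintR_ext _ _ (exp_integrand_ratio_kernel_diff t)), CintR_minus.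
    - ring.
    - apply exp_integrand_dilog_kernel_dominated. lra.
    - apply exp_integrand_dilog_kernel_dominated. simpl. unfold Re in *. lra. }
  rewrite E, cexp_add, <- Cmult_assoc, exp_log_ratio by auto. ring.
Qed.

Lemma E_strip_neq_0 t : E_strip N t <> 0%C.
Proof. rewrite E_strip_CintR. apply cexp_neq_0. Qed.

(** First derivative of [E_strip] in the real direction, as logarithmic derivative times function;
    [E_strip_2] is the second. *)
Definition E_strip_1 (t : C) : C := (CintR (fun x => dilog_freq x * exp_integrand dilog_freq dilog_kernel t x) * E_strip N t)%C.
Definition E_strip_2 (t : C) : C :=
  (CintR (fun x => dilog_freq x * (dilog_freq x * exp_integrand dilog_freq dilog_kernel t x)) * E_strip N t
   + CintR (fun x => dilog_freq x * exp_integrand dilog_freq dilog_kernel t x) * E_strip_1 t)%C.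

Lemma lam_exp_integrand k t x : (dilog_freq x * exp_integrand dilog_freq k t x)%C = exp_integrand dilog_freq (fun x => dilog_freq x * k x)%C t x.
Proof. unfold exp_integrand. ring. Qed.

(** Each derivative of the exponent multiplies the kernel by [dilog_freq], so the same
    differentiation lemma serves for [dilog_kernel], [k1] and [k2]. Its third use gives continuity
    of the second derivative. *)
Lemma E_strip_derive (y x : R) : - / INR N < x < 1 ->
  Cderiv (fun u => E_strip N (u, y)) x (E_strip_1 (x, y)) /\
  Cderiv (fun u => E_strip_1 (u, y)) x (E_strip_2 (x, y)) /\
  Ccont (fun u => E_strip_2 (u, y)) x.
Proof.
  intros Hx.
  assert (Et : forall u, (u, y) = (RtoC 0 + RtoC y * Ci + RtoC u * 1)%C) by (intros u; apply C_ext; simpl; ring).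
  set (t0 := (RtoC 0 + RtoC y * Ci)%C) in Et.
  assert (HRe : - / INR N < Re (t0 + RtoC x * 1)%C < 1) by (rewrite <- Et; simpl; auto).
  set (k1 := fun x => (dilog_freq x * dilog_kernel x)%C). set (k2 := fun x => (dilog_freq x * k1 x)%C).
  assert (C1 : forall x, Ccont k1 x) by (intros; apply Ccont_mult; [apply dilog_freq_growth|apply Ccont_dilog_kernel]).
  assert (C2 : forall x, Ccont k2 x) by (intros; apply Ccont_mult; [apply dilog_freq_growth|apply C1]).
  assert (D0 : dominated (exp_integrand dilog_freq dilog_kernel (t0 + RtoC x * 1))) by (apply exp_integrand_dilog_kernel_dominated; auto).
  assert (D1 : dominated (exp_integrand dilog_freq k1 (t0 + RtoC x * 1))).
  { eapply dominated_ext; [apply lam_exp_integrand|]. eapply dominated_lin; [apply dilog_freq_growth|auto]. }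
  assert (D2 : dominated (exp_integrand dilog_freq k2 (t0 + RtoC x * 1))).
  { eapply dominated_ext; [apply lam_exp_integrand|]. eapply dominated_lin; [apply dilog_freq_growth|auto]. }
  pose proof (CintR_exp_integrand_derive _ _ _ _ dilog_freq_growth Ccont_dilog_kernel t0 1%C x D0) as G0.
  pose proof (CintR_exp_integrand_derive _ _ _ _ dilog_freq_growth C1 t0 1%C x D1) as G1.
  pose proof (CintR_exp_integrand_derive _ _ _ _ dilog_freq_growth C2 t0 1%C x D2) as G2.
  assert (E1 : forall t, CintR (fun x => dilog_freq x * exp_integrand dilog_freq dilog_kernel t x)%C = CintR (exp_integrand dilog_freq k1 t)).
  { intros t. apply CintR_ext. intros u. apply lam_exp_integrand. }
  assert (E2 : forall t, CintR (fun x => dilog_freq x * exp_integrand dilog_freq k1 t x)%C = CintR (exp_integrand dilog_freq k2 t)).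
  { intros t. apply CintR_ext. intros u. apply lam_exp_integrand. }
  assert (E2' : forall t, CintR (fun x => dilog_freq x * (dilog_freq x * exp_integrand dilog_freq dilog_kernel t x))%C = CintR (exp_integrand dilog_freq k2 t)).
  { intros t. rewrite <- E2. apply CintR_ext. intros u. f_equal. apply lam_exp_integrand. }
  rewrite E1 in G0. rewrite E2 in G1.
  assert (F0 : Cderiv (fun u => E_strip N (u, y)) x (E_strip_1 (x, y))).
  { apply (Cderiv_ext (fun u => cexp (CintR (exp_integrand dilog_freq dilog_kernel (t0 + RtoC u * 1))))).
    { intros u. rewrite <- Et. symmetry. apply E_strip_CintR. }
    eapply Cderiv_eq; [|apply Cderiv_cexp; exact G0]. cbv beta. unfold E_strip_1. rewrite E1, E_strip_CintR, <- Et. ring. }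
  assert (F1 : Cderiv (fun u => E_strip_1 (u, y)) x (E_strip_2 (x, y))).
  { apply (Cderiv_ext (fun u => CintR (exp_integrand dilog_freq k1 (t0 + RtoC u * 1)) * E_strip N (u, y))%C).
    { intros u. rewrite <- Et. unfold E_strip_1. rewrite E1. reflexivity. }
    eapply Cderiv_eq; [|apply Cderiv_mult; [exact G1|exact F0]]. cbv beta. unfold E_strip_2. rewrite E1, E2', <- Et. ring. }
  split; [exact F0|split; [exact F1|]].
  apply (Ccont_ext (fun u => CintR (exp_integrand dilog_freq k2 (t0 + RtoC u * 1)) * E_strip N (u, y)
     + CintR (exp_integrand dilog_freq k1 (t0 + RtoC u * 1)) * E_strip_1 (u, y))%C).
  - intros u. rewrite <- Et. unfold E_strip_2. rewrite E1, E2'. reflexivity.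
  - apply Ccont_plus; apply Ccont_mult; [exact (Cderiv_Ccont _ _ _ G2)|exact (Cderiv_Ccont _ _ _ F0)|exact (Cderiv_Ccont _ _ _ G1)|exact (Cderiv_Ccont _ _ _ F1)].
Qed.
End Strip.

(** * The functional equations of the dilogarithm *)

Lemma cprod_shift n f : cprod_range (S n) f = (f O * cprod_range n (fun a => f (S a)))%C.
Proof.
  induction n as [|n IH]; [simpl; ring|].
  change (cprod_range (S (S n)) f) with (cprod_range (S n) f * f (S n))%C. rewrite IH. simpl. ring.
Qed.

Lemma cprod_ext n f h : (forall a, (a < n)%nat -> f a = h a) -> cprod_range n f = cprod_range n h.
Proof. induction n as [|n IH]; simpl; intros H; auto. rewrite IH, H; auto. Qed.

Lemma Int_part_nat (x : R) (j : nat) : INR j <= x < INR j + 1 -> Z.to_nat (Int_part x) = j.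
Proof.
  intros [H1 H2]. destruct (base_Int_part x) as [H3 H4]. rewrite INR_IZR_INZ in *.
  assert (Int_part x = Z.of_nat j); [|lia].
  apply Z.le_antisymm.
  - apply Zlt_succ_le. apply lt_IZR. unfold Z.succ. rewrite plus_IZR. lra.
  - apply Zlt_succ_le. apply lt_IZR. unfold Z.succ. rewrite plus_IZR. lra.
Qed.

Lemma one_minus_cexp_neq_0 t : Im t <> 0 -> (1 - cexp (twopii * t) <> 0)%C.
Proof.
  intros H E. assert (E1 : cexp (twopii * t) = 1%C) by (symmetry; apply Ceq_minus; exact E).
  apply (f_equal Cmod) in E1. rewrite Cmod_cexp, Cmod_1, Re_twopii_mult, <- exp_0 in E1.
  apply exp_inv in E1. pose proof PI_RGT_0. nra.
Qed.

Lemma RtoC_S_div j NR : RtoC (INR (S j) / NR) = (RtoC (INR j / NR) + RtoC (/ NR))%C.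
Proof. rewrite <- RtoC_plus. f_equal. rewrite S_INR. unfold Rdiv. ring. Qed.

Section EN.
Variable N : nat.
Hypothesis HN : (1 <= N)%nat.

Lemma INR_ge_1 : 1 <= INR N.
Proof. apply (le_INR 1). exact HN. Qed.

Lemma INR_inv_bounds : 0 < / INR N <= 1.
Proof. pose proof INR_ge_1. split; [apply Rinv_0_lt_compat; lra|]. rewrite <- Rinv_1. apply Rinv_le_contravar; lra. Qed.

Lemma E_N_strip t : - / INR N < Re t < 1 -> E_N N t = E_strip N t.
Proof.
  intros H. unfold E_N. destruct (Rlt_dec (Re t) 1); [|lra]. destruct (Rlt_dec (- / INR N) (Re t)); [reflexivity|lra].
Qed.

(** The integer part places [Re t + j / N] in [(-1/N, 0]]; correspondingly [E_N_high] lands in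
    [[1 - 1/N, 1)]. Both lie inside the strip of the integral. *)
Lemma E_N_low t j : Re t <= - / INR N -> INR j <= - INR N * Re t < INR j + 1 ->
  E_N N t = (E_strip N (t + RtoC (INR j / INR N)) *
       cprod_range j (fun l => 1 - cexp (twopii * (t + RtoC (INR (S l) / INR N)))))%C.
Proof.
  intros H Hj. pose proof INR_inv_bounds. unfold E_N. destruct (Rlt_dec (Re t) 1); [|lra].
  destruct (Rlt_dec (- / INR N) (Re t)); [lra|]. rewrite (Int_part_nat _ j Hj). reflexivity.
Qed.

Lemma E_N_high t j : 1 <= Re t -> INR j <= INR N * (Re t - 1) < INR j + 1 ->
  E_N N t = (E_strip N (t - RtoC (INR (S j) / INR N)) /
     cprod_range (S j) (fun l => 1 - cexp (twopii * (t - RtoC (INR l / INR N)))))%C.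
Proof.
  intros H Hj. unfold E_N. destruct (Rlt_dec (Re t) 1); [lra|].
  rewrite (Int_part_nat _ j Hj). reflexivity.
Qed.

(** The integral enters only when [t] and [t + 1 / N] both lie in the strip. In every other range
    the equation says that the defining products for the two points differ by one factor; off the
    real axis the factors divided by are nonzero. *)
Lemma E_N_step t : Im t <> 0 ->
  (E_N N (t + RtoC (/ INR N)) * (1 - cexp (twopii * (t + RtoC (/ INR N)))) = E_N N t)%C.
Proof.
  intros HIm. pose proof INR_inv_bounds as Hi. pose proof INR_ge_1 as HN1'.
  set (h := / INR N) in *.
  assert (HNh : INR N * h = 1) by (unfold h; field; lra).
  assert (HRe : Re (t + RtoC h)%C = Re t + h) by reflexivity.
  assert (HIm' : Im (t + RtoC h)%C <> 0) by (simpl; rewrite Rplus_0_r; exact HIm).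
  pose proof (one_minus_cexp_neq_0 _ HIm') as Hne.
  destruct (Rle_dec (Re t) (- h)) as [Hlow|Hlow].
  - destruct (nfloor_ex (- INR N * Re t)) as [j Hj]; [nra|].
    destruct j as [|j].
    { simpl in Hj. assert (1 <= - INR N * Re t) by nra. lra. }
    rewrite (E_N_low t (S j)) by auto.
    rewrite cprod_shift.
    replace (RtoC (INR 1 / INR N)) with (RtoC h) by (f_equal; simpl; unfold h; field; lra).
    rewrite RtoC_S_div. fold h.
    rewrite S_INR in Hj.
    destruct (Rle_dec (Re t + h) (- h)) as [Hlow'|Hlow'].
    + rewrite (E_N_low (t + RtoC h)%C j); [|rewrite HRe; auto|rewrite HRe; split; nra].
      rewrite (cprod_ext j (fun a => 1 - cexp (twopii * (t + RtoC (INR (S (S a)) / INR N))))%C (fun l => 1 - cexp (twopii * (t + h + RtoC (INR (S l) / INR N))))%C).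
      * replace (t + h + RtoC (INR j / INR N))%C with (t + (RtoC (INR j / INR N) + h))%C by ring. ring.
      * intros a _. rewrite (RtoC_S_div (S a)). fold h. do 3 f_equal. ring.
    + assert (j = O).
      { destruct j; auto. exfalso. rewrite S_INR in Hj. pose proof (pos_INR j). nra. }
      subst j. rewrite E_N_strip by (rewrite HRe; fold h; lra). simpl.
      replace (RtoC (0 / INR N)) with (RtoC 0) by (f_equal; unfold Rdiv; ring).
      replace (t + (0 + h))%C with (t + h)%C by ring. ring.
  - destruct (Rlt_dec (Re t) 1) as [H1|H1].
    + rewrite (E_N_strip t) by (fold h; lra).
      destruct (Rlt_dec (Re t + h) 1) as [H2|H2].
      * rewrite E_N_strip by (rewrite HRe; fold h; lra).
        rewrite (E_strip_shift N HN (t + h)%C) by (rewrite HRe; lra). fold h. replace (t + h - h)%C with t by ring. reflexivity.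
      * rewrite (E_N_high (t + RtoC h)%C 0); [|rewrite HRe; lra|rewrite HRe; simpl; split; nra].
        simpl cprod_range. replace (RtoC (INR 1 / INR N)) with (RtoC h) by (f_equal; simpl; unfold h; field; lra).
        replace (RtoC (0 / INR N)) with (RtoC 0) by (f_equal; unfold Rdiv; ring).
        replace (t + h - h)%C with t by ring. replace (t + h - 0)%C with (t + h)%C by ring.
        field. exact Hne.
    + destruct (nfloor_ex (INR N * (Re t - 1))) as [j Hj]; [nra|].
      rewrite (E_N_high t j); auto; [|lra].
      rewrite (E_N_high (t + RtoC h)%C (S j)); [|rewrite HRe; lra|rewrite HRe, S_INR; split; nra].
      rewrite (cprod_shift (S j)).
      replace (RtoC (INR 0 / INR N)) with (RtoC 0) by (f_equal; simpl; unfold Rdiv; ring).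
      replace (t + h - 0)%C with (t + h)%C by ring.
      rewrite (cprod_ext (S j) (fun a => 1 - cexp (twopii * (t + h - RtoC (INR (S a) / INR N))))%C
        (fun l => 1 - cexp (twopii * (t - RtoC (INR l / INR N))))%C).
      * assert (HP : cprod_range (S j) (fun l => 1 - cexp (twopii * (t - RtoC (INR l / INR N))))%C <> 0%C).
        { generalize (S j). induction n as [|n IH]; simpl; [apply RtoC_neq_0; lra|].
          apply Cmult_neq_0; auto. apply one_minus_cexp_neq_0. simpl. rewrite Ropp_0, Rplus_0_r. exact HIm. }
        rewrite (RtoC_S_div (S j)). fold h.
        replace (t + h - (RtoC (INR (S j) / INR N) + h))%C with (t - RtoC (INR (S j) / INR N))%C by ring.
        field. split; auto.
      * intros a _. rewrite RtoC_S_div. fold h. do 3 f_equal. ring.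
Qed.


Lemma E_N_neq_0 t : Im t <> 0 -> E_N N t <> 0%C.
Proof.
  intros HIm.
  assert (HP : forall (f : nat -> R) n, cprod_range n (fun l => 1 - cexp (twopii * (t + RtoC (f l))))%C <> 0%C).
  { intros f n. induction n as [|n IH]; simpl; [apply RtoC_neq_0; lra|].
    apply Cmult_neq_0; auto. apply one_minus_cexp_neq_0. simpl. rewrite Rplus_0_r. exact HIm. }
  unfold E_N. destruct (Rlt_dec (Re t) 1); [destruct (Rlt_dec (- / INR N) (Re t))|].
  - apply (E_strip_neq_0 N HN).
  - apply Cmult_neq_0; [apply (E_strip_neq_0 N HN)|]. apply HP.
  - apply Cmult_neq_0; [apply (E_strip_neq_0 N HN)|].
    intros E. set (k := S (Z.to_nat (Int_part (INR N * (Re t - 1))))) in E.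
    specialize (HP (fun l => - (INR l / INR N)) k).
    rewrite (cprod_ext k _ (fun l => 1 - cexp (twopii * (t - RtoC (INR l / INR N))))%C) in HP.
    + pose proof (Cinv_r _ HP) as E2. rewrite E in E2. apply (f_equal Re) in E2. simpl in E2. lra.
    + intros a _. rewrite RtoC_opp. reflexivity.
Qed.

Lemma E_N_steps t n : Im t <> 0 ->
  (E_N N (t + RtoC (INR n / INR N)) * cprod_range n (fun l => 1 - cexp (twopii * (t + RtoC (INR (S l) / INR N)))) = E_N N t)%C.
Proof.
  intros HIm. induction n as [|n IH].
  - simpl. replace (RtoC (0 / INR N)) with (RtoC 0) by (f_equal; unfold Rdiv; ring).
    replace (t + 0)%C with t by ring. ring.
  - rewrite <- IH. change (cprod_range (S n) ?f) with (cprod_range n f * f n)%C. cbv beta.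
    rewrite RtoC_S_div.
    rewrite <- (E_N_step (t + RtoC (INR n / INR N))).
    + replace (t + RtoC (INR n / INR N) + RtoC (/ INR N))%C with (t + (RtoC (INR n / INR N) + RtoC (/ INR N)))%C by ring. ring.
    + simpl. rewrite Rplus_0_r. exact HIm.
Qed.
End EN.

(* Polynomial functions of degree < n, in Horner form. *)
Fixpoint Poly (n : nat) (p : C -> C) : Prop :=
  match n with
  | O => forall X, p X = 0%C
  | S m => exists c q, Poly m q /\ forall X, p X = (c + X * q X)%C
  end.

Lemma Poly_plus n p q : Poly n p -> Poly n q -> Poly n (fun X => p X + q X)%C.
Proof.
  revert p q. induction n as [|n IH]; intros p q Hp Hq; simpl in *.
  - intros X. rewrite Hp, Hq. ring.
  - destruct Hp as [c [p' [Hp E]]], Hq as [c' [q' [Hq E']]].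
    exists (c + c')%C, (fun X => p' X + q' X)%C. split; auto. intros X. rewrite E, E'. ring.
Qed.

Lemma Poly_scal n a p : Poly n p -> Poly n (fun X => a * p X)%C.
Proof.
  revert p. induction n as [|n IH]; intros p Hp; simpl in *.
  - intros X. rewrite Hp. ring.
  - destruct Hp as [c [p' [Hp E]]]. exists (a * c)%C, (fun X => a * p' X)%C. split; auto. intros X. rewrite E. ring.
Qed.

Lemma Poly_S n p : Poly n p -> Poly (S n) p.
Proof.
  revert p. induction n as [|n IH]; intros p Hp.
  - exists 0%C, (fun _ => 0%C). split; [intros X; reflexivity|]. intros X. rewrite Hp. ring.
  - destruct Hp as [c [p' [Hp E]]]. exists c, p'. split; auto.
Qed.

Lemma Poly_mulX n p : Poly n p -> Poly (S n) (fun X => X * p X)%C.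
Proof. intros H. exists 0%C, p. split; auto. intros X. ring. Qed.

Lemma Poly_pow n : Poly (S n) (fun X => X ^ n)%C.
Proof.
  induction n as [|n IH].
  - exists 1%C, (fun _ => 0%C). split; [intros X; reflexivity|]. intros X. simpl. ring.
  - apply (Poly_mulX _ _ IH).
Qed.

Lemma Poly_factor n p r : Poly (S n) p -> exists q, Poly n q /\ forall X, p X = (p r + (X - r) * q X)%C.
Proof.
  revert p. induction n as [|n IH]; intros p [c [q [Hq E]]].
  - exists (fun _ => 0%C). split; [intros X; reflexivity|]. intros X. rewrite !E, !Hq. ring.
  - destruct (IH q Hq) as [q' [Hq' E']].
    exists (fun X => q r + X * q' X)%C. split.
    + exists (q r), q'. split; auto.
    + intros X. rewrite !E. rewrite (E' X). ring.
Qed.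

Lemma Poly_roots n p (r : nat -> C) : Poly n p ->
  (forall i j, (i < n)%nat -> (j < n)%nat -> r i = r j -> i = j) ->
  (forall i, (i < n)%nat -> p (r i) = 0%C) -> forall X, p X = 0%C.
Proof.
  revert p. induction n as [|n IH]; intros p Hp Hinj Hr X; [apply Hp|].
  destruct (Poly_factor n p (r n) Hp) as [q [Hq E]].
  pose proof (Hr n ltac:(lia)) as H0.
  rewrite E, H0. rewrite (IH q Hq); [ring| |].
  - intros i j Hi Hj. apply Hinj; lia.
  - intros i Hi. pose proof (Hr i ltac:(lia)) as H1. rewrite E, H0 in H1.
    assert (Hne : (r i - r n)%C <> 0%C).
    { intros E1. apply Ceq_minus in E1. apply Hinj in E1; lia. }
    replace (q (r i)) with (/ (r i - r n) * (0 + (r i - r n) * q (r i)))%C by (field; auto).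
    rewrite H1. ring.
Qed.

Lemma prod_linear_monic n (r : nat -> C) : exists q, Poly n q /\
  forall X, cprod_range n (fun l => X - r l)%C = (X ^ n + q X)%C.
Proof.
  induction n as [|n [q [Hq E]]].
  - exists (fun _ => 0%C). split; [intros X; reflexivity|]. intros X. simpl. ring.
  - exists (fun X => (X * q X + (- r n) * X ^ n) + (- r n) * q X)%C. split.
    + apply (Poly_plus (S n) (fun X => X * q X + (- r n) * X ^ n)%C).
      * apply (Poly_plus (S n) (fun X => X * q X)%C); [apply Poly_mulX; auto|].
        apply (Poly_scal (S n) (- r n)%C (fun X => X ^ n)%C). apply Poly_pow.
      * apply (Poly_scal (S n)). apply Poly_S. auto.
    + intros X. simpl. rewrite E. ring.
Qed.

Lemma cprod_mult n f h : cprod_range n (fun l => f l * h l)%C = (cprod_range n f * cprod_range n h)%C.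
Proof. induction n as [|n IH]; simpl; [ring|]. rewrite IH. ring. Qed.

Lemma cprod_const n c : cprod_range n (fun _ => c) = (c ^ n)%C.
Proof. induction n as [|n IH]; simpl; [reflexivity|]. rewrite IH. ring. Qed.

Lemma cprod_zero n (f : nat -> C) i : (i < n)%nat -> f i = 0%C -> cprod_range n f = 0%C.
Proof.
  induction n as [|n IH]; intros Hi H; [lia|]. simpl.
  destruct (Nat.eq_dec i n) as [->|Hne]; [rewrite H; ring|]. rewrite IH; [ring|lia|auto].
Qed.

Lemma cexp_pow n z : cexp (RtoC (INR n) * z) = (cexp z ^ n)%C.
Proof.
  induction n as [|n IH].
  - simpl. replace (0 * z)%C with (RtoC 0) by ring. apply cexp_0.
  - rewrite S_INR, RtoC_plus. replace ((INR n + 1) * z)%C with (z + INR n * z)%C by ring.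
    rewrite cexp_add, IH. reflexivity.
Qed.

(** The factorisation of [X^N - 1], evaluated at [X = exp (-2 pi i t)] and multiplied by [X^(-N)].
    It holds because the product minus [X^N - 1] has degree below [N] and vanishes at [N] distinct
    points. The roots are numbered from 1 to [N], to match [E_N_steps]. *)
Lemma cprod_roots_of_unity N (t : C) : (1 <= N)%nat ->
  cprod_range N (fun l => 1 - cexp (twopii * (t + RtoC (INR (S l) / INR N))))%C = (1 - cexp (twopii * (RtoC (INR N) * t)))%C.
Proof.
  intros HN. assert (HN' : 0 < INR N) by (apply lt_0_INR; lia).
  pose (r := fun l => cexp (twopii * RtoC (INR (S l) / INR N))).
  assert (Hlt : forall i j, (i < j)%nat -> (j < N)%nat -> r i <> r j).
  { intros i j Hij Hj E. apply (cexp_twopii_neq_1 (RtoC (INR (S j) / INR N - INR (S i) / INR N))).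
    - change (Re (RtoC ?x)) with x.
      replace (INR (S j) / INR N - INR (S i) / INR N) with (INR (S j - S i) / INR N)
        by (rewrite minus_INR by lia; field; lra).
      assert (0 < INR (S j - S i)) by (apply lt_0_INR; lia).
      assert (INR (S j - S i) < INR N) by (apply lt_INR; lia).
      split; [apply Rdiv_lt_0_compat; auto|]. apply Rmult_lt_reg_r with (INR N); auto.
      unfold Rdiv. rewrite Rmult_assoc, Rinv_l; lra.
    - rewrite RtoC_minus. replace (twopii * (RtoC (INR (S j) / INR N) - RtoC (INR (S i) / INR N)))%C with
        (twopii * RtoC (INR (S j) / INR N) - twopii * RtoC (INR (S i) / INR N))%C by ring.
      rewrite cexp_minus. fold (r i) (r j). rewrite E. field. apply cexp_neq_0. }
  assert (Hr : forall l, (r l ^ N = 1)%C).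
  { intros l. unfold r. rewrite <- cexp_pow.
    replace (RtoC (INR N) * (twopii * RtoC (INR (S l) / INR N)))%C with (twopii * RtoC (IZR (Z.of_nat (S l))))%C.
    - apply cexp_twopii_IZR.
    - rewrite <- INR_IZR_INZ, RtoC_div by lra. field. apply RtoC_neq_0. lra. }
  assert (HX : forall X, cprod_range N (fun l => X - r l)%C = (X ^ N - 1)%C).
  { intros X. apply Ceq_minus.
    destruct (prod_linear_monic N r) as [q [Hq E]].
    assert (Hp : Poly N (fun X => q X + 1)%C).
    { destruct N as [|n]; [lia|]. apply (Poly_plus (S n) q (fun _ => 1%C)); auto.
      exists 1%C, (fun _ => 0%C). split; [|intros; ring].
      clear. induction n as [|n IH]; [intros X; reflexivity|]. exists 0%C, (fun _ => 0%C). split; auto. intros; ring. }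
    pose proof (Poly_roots N _ r Hp) as Hroots. cbv beta in Hroots.
    rewrite E. replace (X ^ N + q X - (X ^ N - 1))%C with (q X + 1)%C by ring.
    apply Hroots.
    - intros i j Hi Hj Eij. destruct (Nat.lt_trichotomy i j) as [H|[H|H]]; auto; exfalso.
      + apply (Hlt i j); auto.
      + apply (Hlt j i); auto.
    - intros i Hi. pose proof (E (r i)) as Ei. rewrite (cprod_zero N (fun l => r i - r l)%C i Hi ltac:(cbv beta; ring)) in Ei.
      rewrite Hr in Ei. rewrite (Cplus_comm (q (r i))). symmetry. exact Ei. }
  set (Y := cexp (twopii * t)). assert (HY : Y <> 0%C) by apply cexp_neq_0.
  rewrite (cprod_ext N _ (fun l => Y * (/ Y - r l))%C).
  - rewrite cprod_mult, cprod_const, HX.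
    replace (twopii * (RtoC (INR N) * t))%C with (RtoC (INR N) * (twopii * t))%C by ring.
    rewrite cexp_pow. fold Y.
    assert (E : (Y ^ N * (/ Y) ^ N = 1)%C).
    { clear -HY. clearbody Y. induction N as [|n IH]; simpl; [ring|].
      replace (Y * Y ^ n * (/ Y * (/ Y) ^ n))%C with ((Y * / Y) * (Y ^ n * (/ Y) ^ n))%C by ring.
      rewrite IH, Cinv_r by auto. ring. }
    replace (Y ^ N * ((/ Y) ^ N - 1))%C with (Y ^ N * (/ Y) ^ N - Y ^ N)%C by ring. rewrite E. ring.
  - intros a _. unfold r, Y. rewrite Cmult_plus_distr_l, cexp_add. fold Y. field. exact HY.
Qed.

(** [N] steps of length [1 / N]. Their factors combine into an expression in [exp (2 pi i N t)]
    alone, which is why integer translations of the variables see only the [b_i]. *)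
Lemma E_N_period N t : (1 <= N)%nat -> Im t <> 0 ->
  (E_N N (t + 1) * (1 - cexp (twopii * (RtoC (INR N) * t))) = E_N N t)%C.
Proof.
  intros HN HIm. rewrite <- (E_N_steps N HN t N HIm), cprod_roots_of_unity by auto.
  replace (RtoC (INR N / INR N)) with (RtoC 1); [reflexivity|].
  f_equal. field. apply not_0_INR. lia.
Qed.

(** * Regularity along horizontal lines *)

(** The local form is needed because [E_N] is given by different formulas on different ranges, so
    the derivatives are first known only near each point. *)
Definition C2_at (psi : R -> C) (x : R) : Prop :=
  exists p1 p2 : R -> C, locally x (fun u => Cderiv psi u (p1 u) /\ Cderiv p1 u (p2 u) /\ Ccont p2 u).

Definition C2 (psi : R -> C) : Prop :=
  exists p1 p2 : R -> C, forall u, Cderiv psi u (p1 u) /\ Cderiv p1 u (p2 u) /\ Ccont p2 u.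

Lemma C2_at_ext_loc psi phi x : locally x (fun u => psi u = phi u) -> C2_at psi x -> C2_at phi x.
Proof.
  intros E [p1 [p2 H]]. exists p1, p2. apply locally_locally in E.
  generalize (filter_and _ _ E H). apply filter_imp. intros u [Eu [H1 [H2 H3]]].
  split; [|split]; auto. apply (Cderiv_ext_loc psi); auto.
Qed.

Lemma C2_at_ext psi phi x : (forall u, psi u = phi u) -> C2_at psi x -> C2_at phi x.
Proof. intros E. apply C2_at_ext_loc. apply filter_forall. exact E. Qed.

Lemma C2_C2_at psi x : C2 psi -> C2_at psi x.
Proof. intros [p1 [p2 H]]. exists p1, p2. apply filter_forall. exact H. Qed.

Lemma C2_at_mult psi phi x : C2_at psi x -> C2_at phi x -> C2_at (fun u => psi u * phi u)%C x.
Proof.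
  intros [p1 [p2 H]] [q1 [q2 H']].
  exists (fun u => p1 u * phi u + psi u * q1 u)%C,
    (fun u => (p2 u * phi u + p1 u * q1 u) + (p1 u * q1 u + psi u * q2 u))%C.
  generalize (filter_and _ _ H H'). apply filter_imp. intros u [[A1 [A2 A3]] [B1 [B2 B3]]].
  split; [|split].
  - apply Cderiv_mult; auto.
  - apply Cderiv_plus; apply Cderiv_mult; auto.
  - pose proof (Cderiv_Ccont _ _ _ A1). pose proof (Cderiv_Ccont _ _ _ A2). pose proof (Cderiv_Ccont _ _ _ B1). pose proof (Cderiv_Ccont _ _ _ B2).
    apply Ccont_plus; apply Ccont_plus; apply Ccont_mult; auto.
Qed.

Lemma C2_at_inv (psi : R -> C) x : (forall u, psi u <> 0%C) -> C2_at psi x -> C2_at (fun u => / psi u)%C x.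
Proof.
  intros Hn [p1 [p2 H]].
  exists (fun u => - p1 u / (psi u * psi u))%C,
   (fun u => (- p2 u) * / (psi u * psi u) + (- p1 u) * (- (p1 u * psi u + psi u * p1 u) / ((psi u * psi u) * (psi u * psi u))))%C.
  assert (Hn2 : forall u, (psi u * psi u)%C <> 0%C) by (intros; apply Cmult_neq_0; auto).
  assert (Hn4 : forall u, (psi u * psi u * (psi u * psi u))%C <> 0%C) by (intros; apply Cmult_neq_0; auto).
  generalize H. apply filter_imp. intros u [A1 [A2 A3]].
  split; [|split].
  - apply Cderiv_inv; auto.
  - apply Cderiv_mult; [apply Cderiv_opp; auto|]. apply (Cderiv_inv (fun u => psi u * psi u)%C); auto. apply Cderiv_mult; auto.
  - pose proof (Cderiv_Ccont _ _ _ A1) as C0. pose proof (Cderiv_Ccont _ _ _ A2) as C1.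
    apply Ccont_plus; apply Ccont_mult.
    + apply Ccont_opp; auto.
    + apply Ccont_inv; auto. apply Ccont_mult; auto.
    + apply Ccont_opp; auto.
    + apply Ccont_div; auto.
      * apply Ccont_opp. apply Ccont_plus; apply Ccont_mult; auto.
      * apply Ccont_mult; apply Ccont_mult; auto.
Qed.

Lemma C2_comp_lin psi a b : C2 psi -> C2 (fun u => psi (a * u + b)).
Proof.
  intros [p1 [p2 H]]. exists (fun u => RtoC a * p1 (a * u + b)%R)%C, (fun u => RtoC a * (RtoC a * p2 (a * u + b)%R))%C.
  intros u. destruct (H (a * u + b)) as [H1 [H2 H3]]. split; [|split].
  - apply Cderiv_comp_lin; auto.
  - eapply Cderiv_eq; [|apply Cderiv_mult; [apply Cderiv_const|apply Cderiv_comp_lin; exact H2]]. cbv beta. ring.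
  - apply Ccont_mult; [apply Ccont_const|]. apply Ccont_mult; [apply Ccont_const|].
    apply (Ccont_comp_R p2 (fun u => a * u + b)); auto.
    cont_of_derive.
Qed.

Lemma C2_at_shift psi h x : C2_at psi (x + h) -> C2_at (fun u => psi (u + h)) x.
Proof.
  intros [p1 [p2 [d H]]]. exists (fun u => p1 (u + h)), (fun u => p2 (u + h)). exists d. intros u Hu.
  assert (Hb : ball (x + h) d (u + h)).
  { revert Hu. unfold ball; simpl. unfold AbsRing_ball, abs, minus, plus, opp; simpl. intros Hu.
    replace (u + h + - (x + h)) with (u + - x) by ring. auto. }
  destruct (H _ Hb) as [H1 [H2 H3]].
  assert (E : forall f l, Cderiv f (u + h) l -> Cderiv (fun v => f (v + h)) u l).
  { intros f l Hf. replace (u + h) with (1 * u + h) in Hf by ring. apply Cderiv_comp_lin in Hf.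
    eapply Cderiv_eq; [|eapply Cderiv_ext; [|exact Hf]]; [ring|]. intros v. simpl. f_equal. ring. }
  split; [apply E; auto|split; [apply E; auto|]].
  apply (Ccont_comp_R p2 (fun u => u + h)); auto.
  cont_of_derive.
Qed.

Lemma C2_cexp (c z : C) : C2 (fun u => cexp (c + RtoC u * z)).
Proof.
  assert (HD : forall u, Cderiv (fun u => cexp (c + RtoC u * z)) u (z * cexp (c + RtoC u * z))%C).
  { intros u. eapply Cderiv_eq; [|apply Cderiv_cexp; apply Cderiv_plus; [apply Cderiv_const|apply Cderiv_mult; [apply Cderiv_id|apply Cderiv_const]]].
    cbv beta. ring. }
  exists (fun u => z * cexp (c + RtoC u * z))%C, (fun u => z * (z * cexp (c + RtoC u * z)))%C.
  intros u. split; [auto|split].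
  - eapply Cderiv_eq; [|apply Cderiv_mult; [apply Cderiv_const|apply HD]]. cbv beta. ring.
  - apply Ccont_mult; [apply Ccont_const|]. apply Ccont_mult; [apply Ccont_const|]. eapply Cderiv_Ccont; apply HD.
Qed.

Lemma C2_one_minus_cexp (c z : C) : C2 (fun u => 1 - cexp (c + RtoC u * z))%C.
Proof.
  destruct (C2_cexp c z) as [p1 [p2 H]]. exists (fun u => - p1 u)%C, (fun u => - p2 u)%C.
  intros u. destruct (H u) as [H1 [H2 H3]]. split; [|split].
  - eapply Cderiv_eq; [|apply Cderiv_minus; [apply Cderiv_const|exact H1]]. ring.
  - apply Cderiv_opp; auto.
  - apply Ccont_opp; auto.
Qed.

Definition Cderive_fun (f : R -> C) (x : R) : C :=
  (Derive (fun u => Re (f u)) x, Derive (fun u => Im (f u)) x).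

Lemma Cderiv_Cderive_fun f x l : Cderiv f x l -> Cderive_fun f x = l.
Proof.
  intros [H1 H2]. apply C_ext; simpl.
  - apply (is_derive_unique (fun u => Re (f u))); auto.
  - apply (is_derive_unique (fun u => Im (f u))); auto.
Qed.

Lemma Ccont_ext_loc f g x : locally x (fun u => f u = g u) -> Ccont f x -> Ccont g x.
Proof.
  intros E [H1 H2]. split.
  - apply (continuous_ext_loc (fun u => Re (g u)) (fun u => Re (f u)) x); auto. generalize E. apply filter_imp. intros u Hu. rewrite Hu. reflexivity.
  - apply (continuous_ext_loc (fun u => Im (g u)) (fun u => Im (f u)) x); auto. generalize E. apply filter_imp. intros u Hu. rewrite Hu. reflexivity.
Qed.

(* The global derivative function agrees locally with the given ones, by uniqueness. *)
Lemma C2_global psi : (forall x, C2_at psi x) -> C2 psi.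
Proof.
  intros H. exists (Cderive_fun psi), (Cderive_fun (Cderive_fun psi)). intros x. destruct (H x) as [p1 [p2 Hx]].
  assert (E1 : locally x (fun u => p1 u = Cderive_fun psi u)).
  { generalize Hx. apply filter_imp. intros u [H1 _]. symmetry. apply Cderiv_Cderive_fun; auto. }
  assert (D1 : locally x (fun u => Cderiv (Cderive_fun psi) u (p2 u))).
  { generalize (filter_and _ _ (locally_locally _ _ E1) Hx). apply filter_imp.
    intros u [Eu [_ [H2 _]]]. apply (Cderiv_ext_loc p1); auto. }
  assert (E2 : locally x (fun u => p2 u = Cderive_fun (Cderive_fun psi) u)).
  { generalize D1. apply filter_imp. intros u Hu. symmetry. apply Cderiv_Cderive_fun; auto. }
  pose proof (locally_singleton _ _ Hx) as [H1 [H2 H3]].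
  split; [|split].
  - rewrite (Cderiv_Cderive_fun _ _ _ H1). exact H1.
  - pose proof (locally_singleton _ _ D1) as D. rewrite (Cderiv_Cderive_fun _ _ _ D). exact D.
  - apply (Ccont_ext_loc p2); auto.
Qed.

(** * Mixed Lipschitz bounds from two derivatives *)

Lemma Ccont_bounded f A : (forall x, Ccont f x) -> exists B, forall x, - A <= x <= A -> Cmod (f x) <= B.
Proof.
  intros H.
  destruct (bounded_continuity (K := R_AbsRing) (V := R_NormedModule) (fun u => Re (f u)) (- A) A) as [B1 HB1]; [intros x _; apply H|].
  destruct (bounded_continuity (K := R_AbsRing) (V := R_NormedModule) (fun u => Im (f u)) (- A) A) as [B2 HB2]; [intros x _; apply H|].
  exists (B1 + B2). intros x Hx. eapply Rle_trans; [apply Cmod_Re_Im|].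
  specialize (HB1 x Hx). specialize (HB2 x Hx). unfold norm in *; simpl in *. unfold abs in *; simpl in *. lra.
Qed.

Lemma Cderiv_Lip f df A B : (forall x, Cderiv f x (df x)) -> (forall x, Ccont df x) ->
  (forall x, - A <= x <= A -> Cmod (df x) <= B) ->
  forall x y, - A <= x <= A -> - A <= y <= A -> Cmod (f x - f y) <= B * Rabs (x - y).
Proof.
  intros HD HC HB.
  assert (H : forall x y, - A <= x -> x <= y -> y <= A -> Cmod (f y - f x) <= B * (y - x)).
  { intros x y Hx Hxy Hy. rewrite <- (Cint_FTC f df x y); auto; [|intros z _; apply HC].
    rewrite Rmult_comm. apply Cint_norm_le_const; auto; [intros z _; apply HC|]. intros z Hz. apply HB. lra. }
  intros x y Hx Hy. destruct (Rle_dec x y).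
  - rewrite Cmod_minus_sym, Rabs_left1 by lra. replace (- (x - y)) with (y - x) by ring. apply H; lra.
  - rewrite Rabs_pos_eq by lra. apply H; lra.
Qed.

Lemma mixed_Lip_C2_one d psi p : C2 psi -> exists B, mixed_Lip d (fun g => psi (g p)) B.
Proof.
  intros [p1 [p2 H]].
  assert (C0 : forall x, Ccont psi x) by (intros x; exact (Cderiv_Ccont _ _ _ (proj1 (H x)))).
  assert (C1 : forall x, Ccont p1 x) by (intros x; exact (Cderiv_Ccont _ _ _ (proj1 (proj2 (H x))))).
  destruct (Ccont_bounded psi 2 C0) as [B0 HB0]. destruct (Ccont_bounded p1 2 C1) as [B1 HB1].
  exists (Rmax B0 B1). apply mixed_Lip_one_var.
  - intros x y Hx Hy. apply (Cderiv_Lip psi p1 2); auto; try lra; [apply H|].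
    intros z Hz. eapply Rle_trans; [apply HB1; auto|apply Rmax_r].
  - intros x Hx. eapply Rle_trans; [apply HB0; lra|apply Rmax_l].
Qed.

(** The second derivative is used for the mixed difference: the [y]-derivative of
    [psi (x - y + c) - psi (x' - y + c)] is a difference of two values of [p1], and [p1] is
    Lipschitz. *)
Lemma mixed_Lip_C2_two d psi c p q : C2 psi -> p <> q -> exists B, mixed_Lip d (fun g => psi (g p - g q + c)) B.
Proof.
  (* For [x] and [y] in [[-1, 2]] the difference [x - y] lies in [[-3, 3]]. *)
  intros [p1 [p2 H]] Hpq. set (A := 4 + Rabs c).
  assert (C0 : forall x, Ccont psi x) by (intros x; exact (Cderiv_Ccont _ _ _ (proj1 (H x)))).
  assert (C1 : forall x, Ccont p1 x) by (intros x; exact (Cderiv_Ccont _ _ _ (proj1 (proj2 (H x))))).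
  destruct (Ccont_bounded psi A C0) as [B0 HB0]. destruct (Ccont_bounded p1 A C1) as [B1 HB1].
  destruct (Ccont_bounded p2 A) as [B2 HB2]; [apply H|].
  set (B := Rmax B0 (Rmax B1 B2)).
  assert (L0 : B0 <= B) by apply Rmax_l.
  assert (L1 : B1 <= B) by (eapply Rle_trans; [apply Rmax_l|apply Rmax_r]).
  assert (L2 : B2 <= B) by (eapply Rle_trans; [apply Rmax_r|apply Rmax_r]).
  assert (Hrange : forall x y, -1 <= x <= 2 -> -1 <= y <= 2 -> - A <= x - y + c <= A).
  { intros x y Hx Hy. unfold A. pose proof (Rle_abs c). pose proof (Rle_abs (- c)). rewrite Rabs_Ropp in *. lra. }
  assert (LP : forall x y, - A <= x <= A -> - A <= y <= A -> Cmod (psi x - psi y) <= B * Rabs (x - y)).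
  { apply (Cderiv_Lip psi p1 A B); auto; [apply H|]. intros z Hz. specialize (HB1 z Hz). lra. }
  assert (LP1 : forall x y, - A <= x <= A -> - A <= y <= A -> Cmod (p1 x - p1 y) <= B * Rabs (x - y)).
  { apply (Cderiv_Lip p1 p2 A B); auto; [apply H|apply H|]. intros z Hz. specialize (HB2 z Hz). lra. }
  exists B. apply (mixed_Lip_two_var d (fun x y => psi (x - y + c)) B p q); auto.
  - intros x y Hx Hy. eapply Rle_trans; [apply HB0; auto|auto].
  - intros x Hx y y' Hy Hy'. eapply Rle_trans; [apply LP; auto|].
    right. f_equal. rewrite <- Rabs_Ropp. f_equal. ring.
  - intros y Hy x x' Hx Hx'. eapply Rle_trans; [apply LP; auto|].
    right. f_equal. f_equal. ring.
  - intros x x' Hx Hx' y y' Hy Hy'.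
    assert (HD : forall a z, Cderiv (fun y => psi (a - y + c)) z (- p1 (a - z + c)%R)%C).
    { intros a z. destruct (H (a - z + c)) as [Hz _].
      replace (a - z + c) with (-1 * z + (a + c)) in Hz at 1 by ring. apply Cderiv_comp_lin in Hz.
      eapply Cderiv_eq; [|eapply Cderiv_ext; [|exact Hz]].
      - replace (RtoC (-1)) with (- (1))%C by (apply C_ext; simpl; ring). ring.
      - intros u. simpl. f_equal. ring. }
    assert (HCC : forall a z, Ccont (fun y => - p1 (a - y + c)%R)%C z).
    { intros a z. apply Ccont_opp. apply (Ccont_comp_R p1 (fun y => a - y + c)); auto.
      cont_of_derive. }
    set (f := fun y => (psi (x - y + c)%R - psi (x' - y + c)%R)%C).
    set (df := fun y => (- p1 (x - y + c)%R - - p1 (x' - y + c)%R)%C).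
    assert (Hw : forall u v, -1 <= u -> u <= v -> v <= 2 -> Cmod (f v - f u) <= B * Rabs (x - x') * (v - u)).
    { intros u v H1 H2 H3. rewrite <- (Cint_FTC f df u v); auto.
      - rewrite Rmult_comm. apply Cint_norm_le_const; auto; [intros z _; apply Ccont_minus; apply HCC|].
        intros z Hz. unfold df.
        replace (- p1 (x - z + c)%R - - p1 (x' - z + c)%R)%C with (- (p1 (x - z + c)%R - p1 (x' - z + c)%R))%C by ring.
        rewrite Cmod_opp. eapply Rle_trans; [apply LP1; apply Hrange; lra|].
        right. f_equal. f_equal. ring.
      - intros z _. apply Cderiv_minus; apply HD.
      - intros z _. apply Ccont_minus; apply HCC. }
    change (Cmod (f y - f y') <= B * Rabs (x - x') * Rabs (y - y')).
    destruct (Rle_dec y y').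
    + rewrite Cmod_minus_sym, (Rabs_left1 (y - y')) by lra. replace (- (y - y')) with (y' - y) by ring. apply Hw; lra.
    + rewrite (Rabs_pos_eq (y - y')) by lra. apply Hw; lra.
Qed.

(** [None] stands for a boundary segment, whose value is fixed at 0. *)
Definition opt_var (o : option nat) (g : nat -> R) : R := match o with Some i => g i | None => 0 end.

Lemma mixed_Lip_C2 d psi o1 o2 : C2 psi -> exists B, mixed_Lip d (fun g => psi (opt_var o1 g - opt_var o2 g)) B.
Proof.
  intros H. destruct o1 as [p|], o2 as [q|]; simpl.
  (* A segment may meet the same crossing twice, as at a kink; the two variables then cancel and the
     factor is constant. *)
  - destruct (Nat.eq_dec p q) as [->|Hpq].
    + exists (Cmod (psi 0)). eapply mixed_Lip_ext; [|apply mixed_Lip_const]. intros g. simpl. f_equal. ring.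
    + destruct (mixed_Lip_C2_two d psi 0 p q H Hpq) as [B HB]. exists B. eapply mixed_Lip_ext; [|exact HB].
      intros g. simpl. f_equal. ring.
  - destruct (mixed_Lip_C2_one d psi p H) as [B HB]. exists B. eapply mixed_Lip_ext; [|exact HB]. intros g. simpl. f_equal. ring.
  - destruct (mixed_Lip_C2_one d _ q (C2_comp_lin psi (-1) 0 H)) as [B HB]. exists B.
    eapply mixed_Lip_ext; [|exact HB]. intros g. simpl. f_equal. ring.
  - exists (Cmod (psi (0 - 0))). apply mixed_Lip_const.
Qed.

Section ENsmooth.
Variable N : nat.
Hypothesis HN : (1 <= N)%nat.

(** Regularity spreads from the strip in steps of [1 / N]: to the left by multiplying with
    [1 - exp (2 pi i t)], to the right by dividing by it, which is harmless since it has no zeros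
    off the real axis. *)
Lemma E_N_C2 (y : R) : y <> 0 -> C2 (fun u => E_N N (u, y)).
Proof.
  intros Hy. pose proof (INR_inv_bounds N HN) as Hi. pose proof (INR_ge_1 N HN) as HN1.
  apply C2_global.
  assert (H0 : forall x, - / INR N < x < 1 -> C2_at (fun u => E_N N (u, y)) x).
  { intros x Hx.
    assert (Hloc : locally x (fun u => - / INR N < u < 1)).
    { apply (filter_and (fun u => - / INR N < u) (fun u => u < 1)).
      - apply (open_gt (- / INR N)). lra.
      - apply (open_lt 1). lra. }
    apply (C2_at_ext_loc (fun u => E_strip N (u, y))).
    - generalize Hloc. apply filter_imp. intros u Hu. symmetry. apply E_N_strip; auto.
    - exists (fun u => E_strip_1 N (u, y)), (fun u => E_strip_2 N (u, y)).
      generalize Hloc. apply filter_imp. intros u Hu. apply E_strip_derive; auto. }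
  assert (Hstep : forall u : R, (E_N N ((u + / INR N)%R, y) * (1 - cexp (twopii * ((/ INR N)%R, y) + RtoC u * twopii)) = E_N N (u, y))%C).
  { intros u. pose proof (E_N_step N HN (u, y) Hy) as E.
    replace ((u, y) + RtoC (/ INR N))%C with ((u + / INR N)%R, y) in E by (apply C_ext; simpl; ring).
    rewrite <- E. f_equal. f_equal. f_equal.
    replace ((u + / INR N)%R, y) with (RtoC u + ((/ INR N)%R, y))%C by (apply C_ext; simpl; ring). ring. }
  assert (Hdown : forall (n : nat) x, - / INR N - INR n * / INR N < x < 1 -> C2_at (fun u => E_N N (u, y)) x).
  { induction n as [|m IH]; intros x Hx.
    - apply H0. simpl in Hx. lra.
    - rewrite S_INR in Hx. destruct (Rlt_dec (- / INR N - INR m * / INR N) x); [apply IH; lra|].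
      apply (C2_at_ext (fun u => E_N N ((u + / INR N)%R, y) * (1 - cexp (twopii * ((/ INR N)%R, y) + RtoC u * twopii)))%C);
        [apply Hstep|].
      apply C2_at_mult.
      + apply (C2_at_shift (fun u => E_N N (u, y))). apply IH. pose proof (pos_INR m). nra.
      + apply C2_C2_at. apply C2_one_minus_cexp. }
  assert (Hup : forall n x, - / INR N < x < 1 + INR n * / INR N -> C2_at (fun u => E_N N (u, y)) x).
  { induction n as [|m IH]; intros x Hx.
    - apply H0. simpl in Hx. lra.
    - rewrite S_INR in Hx. destruct (Rlt_dec x (1 + INR m * / INR N)); [apply IH; lra|].
      assert (Hne : forall u, (1 - cexp (twopii * (0%R, y) + RtoC u * twopii))%C <> 0%C).
      { intros u. replace (twopii * (0%R, y) + RtoC u * twopii)%C with (twopii * (u, y))%C.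
        - apply one_minus_cexp_neq_0; auto.
        - replace (u, y) with (RtoC u + (0%R, y))%C by (apply C_ext; simpl; ring). ring. }
      apply (C2_at_ext (fun u => E_N N ((u + - / INR N)%R, y) * / (1 - cexp (twopii * (0%R, y) + RtoC u * twopii)))%C).
      + intros u. rewrite <- (Hstep (u + - / INR N)).
        replace (u + - / INR N + / INR N) with u by ring.
        replace (twopii * ((/ INR N)%R, y) + RtoC (u + - / INR N) * twopii)%C with (twopii * (0%R, y) + RtoC u * twopii)%C.
        * field. apply Hne.
        * replace ((/ INR N)%R, y) with (RtoC (/ INR N) + (0%R, y))%C by (apply C_ext; simpl; ring).
          rewrite RtoC_plus, RtoC_opp. ring.
      + apply C2_at_mult.
        * apply (C2_at_shift (fun u => E_N N (u, y))). apply IH. pose proof (pos_INR m). nra.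
        * apply C2_at_inv; auto. apply C2_C2_at. apply C2_one_minus_cexp. }
  intros x. destruct (Rlt_dec x 1).
  - destruct (nfloor_ex (Rmax 0 (- INR N * x))) as [n [_ Hn]]; [apply Rmax_l|].
    apply (Hdown n). split; [|auto].
    pose proof (Rmax_r 0 (- INR N * x)).
    apply Rmult_lt_reg_l with (INR N); [lra|].
    replace (INR N * (- / INR N - INR n * / INR N)) with (- 1 - INR n) by (field; lra). lra.
  - destruct (nfloor_ex (INR N * (x - 1))) as [k [_ Hn]]; [nra|].
    apply (Hup (S k)). split; [lra|]. rewrite S_INR.
    apply Rmult_lt_reg_l with (INR N); [lra|].
    replace (INR N * (1 + (INR k + 1) * / INR N)) with (INR N + (INR k + 1)) by (field; lra). lra.
Qed.

Lemma mixed_Lip_E_N d o1 o2 (z : C) : Im z <> 0 ->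
  (exists B, mixed_Lip d (fun g => E_N N (RtoC (opt_var o1 g) - RtoC (opt_var o2 g) + z)) B) /\
  (exists B, mixed_Lip d (fun g => / E_N N (RtoC (opt_var o1 g) - RtoC (opt_var o2 g) + z))%C B).
Proof.
  intros Hz.
  assert (E : forall g, (RtoC (opt_var o1 g) - RtoC (opt_var o2 g) + z)%C = ((1 * (opt_var o1 g - opt_var o2 g) + Re z)%R, Im z)).
  { intros g. apply C_ext; simpl; unfold Re, Im; ring. }
  pose proof (E_N_C2 (Im z) Hz) as HC.
  assert (HCi : C2 (fun u => / E_N N (u, Im z))%C).
  { apply C2_global. intros x. apply C2_at_inv; [|apply C2_C2_at; auto]. intros u. apply E_N_neq_0; auto. }
  split.
  - destruct (mixed_Lip_C2 d _ o1 o2 (C2_comp_lin _ 1 (Re z) HC)) as [B HB]. exists B.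
    eapply mixed_Lip_ext; [|exact HB]. intros g. rewrite E. reflexivity.
  - destruct (mixed_Lip_C2 d _ o1 o2 (C2_comp_lin _ 1 (Re z) HCi)) as [B HB]. exists B.
    eapply mixed_Lip_ext; [|exact HB]. intros g. rewrite E. reflexivity.
Qed.
End ENsmooth.

Lemma mixed_Lip_cexp d o1 o2 (c z : C) : exists B, mixed_Lip d (fun g => cexp (c + (RtoC (opt_var o1 g) - RtoC (opt_var o2 g)) * z)) B.
Proof.
  destruct (mixed_Lip_C2 d _ o1 o2 (C2_cexp c z)) as [B HB]. exists B. eapply mixed_Lip_ext; [|exact HB].
  intros g. cbv beta. rewrite RtoC_minus. reflexivity.
Qed.

(** * Crossing weights *)

Definition ex_mixed_Lip d F := exists B, mixed_Lip d F B.

Lemma ex_mixed_Lip_mult d F G : ex_mixed_Lip d F -> ex_mixed_Lip d G -> ex_mixed_Lip d (fun g => F g * G g)%C.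
Proof. intros [B HB] [B' HB']. eexists. apply mixed_Lip_mult; eauto. Qed.

Lemma ex_mixed_Lip_ext d F G : (forall g, F g = G g) -> ex_mixed_Lip d F -> ex_mixed_Lip d G.
Proof. intros E [B HB]. exists B. eapply mixed_Lip_ext; eauto. Qed.

Definition e2pi (t : C) : C := cexp (twopii * t).

Lemma e2pi_add s t : e2pi (s + t) = (e2pi s * e2pi t)%C.
Proof. unfold e2pi. rewrite <- cexp_add. f_equal. ring. Qed.
Lemma e2pi_minus s t : e2pi (s - t) = (e2pi s / e2pi t)%C.
Proof. unfold e2pi. rewrite <- cexp_minus. f_equal. ring. Qed.
Lemma e2pi_neq_0 t : e2pi t <> 0%C.
Proof. apply cexp_neq_0. Qed.
Lemma e2pi_IZR z : e2pi (RtoC (IZR z)) = 1%C.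
Proof. apply cexp_twopii_IZR. Qed.
Lemma e2pi_INR n : e2pi (RtoC (INR n)) = 1%C.
Proof. rewrite INR_IZR_INZ. apply e2pi_IZR. Qed.
(** This is how the hypothesis on the modulus of shape parameters is used: it keeps the dilogarithm
    arguments away from the real line, which carries all zeros and poles. *)
Lemma Im_neq_0_of_Cmod (x : R) (t z : C) : e2pi (RtoC x * t) = z -> Cmod z <> 1 -> Im t <> 0.
Proof.
  intros E H H0. apply H. rewrite <- E. unfold e2pi. rewrite Cmod_cexp, Re_twopii_mult.
  replace (Im (RtoC x * t)%C) with (x * Im t) by (simpl; unfold Im; ring).
  rewrite H0, !Rmult_0_r, Ropp_0. apply exp_0.
Qed.

Lemma one_minus_neq_0 (z : C) : Cmod z <> 1 -> (1 - z <> 0)%C.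
Proof. intros H E. apply H. replace z with (RtoC 1); [apply Cmod_1|]. apply Ceq_minus. exact E. Qed.

Lemma Cmod_inv_neq_1 (z : C) : z <> 0%C -> Cmod z <> 1 -> Cmod (/ z) <> 1.
Proof.
  intros Hz H E. rewrite Cmod_inv in E by auto. apply H.
  rewrite <- (Rinv_inv (Cmod z)), E. apply Rinv_1.
Qed.

Section Lambda.
Variable N : nat.
Hypothesis HN : (1 <= N)%nat.
Variable mu : C.
Let NR : C := RtoC (INR N).
Let m : C := merid mu.

Lemma NR_neq_0 : NR <> 0%C.
Proof. apply RtoC_neq_0. apply not_0_INR. lia. Qed.

(** The summand [1 - 1 / N] in several dilogarithm arguments becomes the integer [N - 1] after
    multiplication by [N], and so leaves no trace in the shape parameters. *)
Lemma e2pi_Nm1 : e2pi (NR - 1) = 1%C.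
Proof.
  unfold NR. rewrite INR_IZR_INZ, <- RtoC_minus. change 1 with (IZR 1). rewrite <- minus_IZR. apply e2pi_IZR.
Qed.

Lemma m_eq : m = e2pi mu.
Proof. reflexivity. Qed.

Lemma E_up t z : e2pi (NR * t) = z -> Cmod z <> 1 -> E_N N (t + 1) = (E_N N t / (1 - z))%C.
Proof.
  intros E H. pose proof (Im_neq_0_of_Cmod _ _ _ E H) as HI.
  rewrite <- (E_N_period N t HN HI). unfold e2pi in E. fold NR. rewrite E. field. apply one_minus_neq_0; auto.
Qed.

Lemma E_down t z : e2pi (NR * t) = z -> Cmod z <> 1 -> E_N N (t - 1) = (E_N N t * (1 - z))%C.
Proof.
  intros E H.
  assert (E' : e2pi (NR * (t - 1)) = z).
  { replace (NR * (t - 1))%C with (NR * t - NR)%C by ring. rewrite e2pi_minus, E. unfold NR. rewrite e2pi_INR. field. }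
  pose proof (E_up (t - 1) z E' H) as U. replace (t - 1 + 1)%C with t in U by ring. rewrite U. field.
  apply one_minus_neq_0; auto.
Qed.

Section Crossing.
Variables t1 t2 t1' t2' b1 b2 b1' b2' : C.
Hypothesis (H1 : e2pi (NR * t1) = b1) (H2 : e2pi (NR * t2) = b2) (H1' : e2pi (NR * t1') = b1') (H2' : e2pi (NR * t2') = b2').

Lemma b_neq_0 : b1 <> 0%C /\ b2 <> 0%C /\ b1' <> 0%C /\ b2' <> 0%C.
Proof. rewrite <- H1, <- H2, <- H1', <- H2'. repeat split; apply e2pi_neq_0. Qed.

(** Stated with the shape parameters of a positive crossing. Those of a negative crossing are the
    inverses, for which modulus 1 is excluded by the same conditions. *)
Definition crossing_generic : Prop :=
  Cmod (b2' / b1) <> 1 /\ Cmod (b2 / b1') <> 1 /\ Cmod (b2 / (m * b1)) <> 1 /\ Cmod (m * b2' / b1') <> 1.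
Hypothesis Hg : crossing_generic.

Lemma m_neq_0 : m <> 0%C.
Proof. apply e2pi_neq_0. Qed.

(** The four arguments in [Lambda_pos] exponentiate to [zN], [zS], [zW], [zE] in the order [d1] to
    [d4]. The lemmas [e2pi_c1] to [e2pi_c4] treat the arguments in [Lambda_neg], which give [zW],
    [zE], [zN], [zS] of a negative crossing. *)
Lemma e2pi_d1 : e2pi (NR * (t2' - t1)) = (b2' / b1)%C.
Proof. rewrite <- H1, <- H2', <- e2pi_minus. f_equal. ring. Qed.
Lemma e2pi_d2 : e2pi (NR * (t2 - t1')) = (b2 / b1')%C.
Proof. rewrite <- H1', <- H2, <- e2pi_minus. f_equal. ring. Qed.
Lemma e2pi_d3 : e2pi (NR * (t2 - t1 - mu / NR + 1 - 1 / NR)) = (b2 / (m * b1))%C.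
Proof.
  replace (NR * (t2 - t1 - mu / NR + 1 - 1 / NR))%C with ((NR * t2 - (mu + NR * t1)) + (NR - 1))%C by (field; apply NR_neq_0).
  rewrite e2pi_add, e2pi_Nm1, e2pi_minus, e2pi_add, H1, H2, <- m_eq. ring.
Qed.
Lemma e2pi_d4 : e2pi (NR * (t2' - t1' + mu / NR)) = (m * b2' / b1')%C.
Proof.
  replace (NR * (t2' - t1' + mu / NR))%C with (mu + NR * t2' - NR * t1')%C by (field; apply NR_neq_0).
  rewrite e2pi_minus, e2pi_add, H2', H1', <- m_eq. reflexivity.
Qed.
Lemma e2pi_c1 : e2pi (NR * (t1 - t2 + mu / NR)) = (/ (b2 / (m * b1)))%C.
Proof.
  replace (NR * (t1 - t2 + mu / NR))%C with (mu + NR * t1 - NR * t2)%C by (field; apply NR_neq_0).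
  rewrite e2pi_minus, e2pi_add, H1, H2, <- m_eq. destruct b_neq_0 as [? [? [? ?]]]. pose proof m_neq_0. field. auto.
Qed.
Lemma e2pi_c2 : e2pi (NR * (t1' - t2' - mu / NR + 1 - 1 / NR)) = (/ (m * b2' / b1'))%C.
Proof.
  replace (NR * (t1' - t2' - mu / NR + 1 - 1 / NR))%C with ((NR * t1' - (mu + NR * t2')) + (NR - 1))%C by (field; apply NR_neq_0).
  rewrite e2pi_add, e2pi_Nm1, e2pi_minus, e2pi_add, H1', H2', <- m_eq. destruct b_neq_0 as [? [? [? ?]]]. pose proof m_neq_0. field. auto.
Qed.
Lemma e2pi_c3 : e2pi (NR * (t1 - t2' + 1 - 1 / NR)) = (/ (b2' / b1))%C.
Proof.
  replace (NR * (t1 - t2' + 1 - 1 / NR))%C with ((NR * t1 - NR * t2') + (NR - 1))%C by (field; apply NR_neq_0).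
  rewrite e2pi_add, e2pi_Nm1, e2pi_minus, H1, H2'. destruct b_neq_0 as [? [? [? ?]]]. field. auto.
Qed.
Lemma e2pi_c4 : e2pi (NR * (t1' - t2 + 1 - 1 / NR)) = (/ (b2 / b1'))%C.
Proof.
  replace (NR * (t1' - t2 + 1 - 1 / NR))%C with ((NR * t1' - NR * t2) + (NR - 1))%C by (field; apply NR_neq_0).
  rewrite e2pi_add, e2pi_Nm1, e2pi_minus, H1', H2. destruct b_neq_0 as [? [? [? ?]]]. field. auto.
Qed.

Lemma generic_inv : Cmod (/ (b2' / b1)) <> 1 /\ Cmod (/ (b2 / b1')) <> 1 /\
  Cmod (/ (b2 / (m * b1))) <> 1 /\ Cmod (/ (m * b2' / b1')) <> 1.
Proof.
  destruct Hg as [G1 [G2 [G3 G4]]]. destruct b_neq_0 as [? [? [? ?]]]. pose proof m_neq_0 as Hm.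
  assert (Hd : forall a b : C, a <> 0%C -> b <> 0%C -> (a / b)%C <> 0%C).
  { intros a b Ha Hb E. apply Ha. replace a with (a / b * b)%C by (field; auto). rewrite E. ring. }
  assert ((m * b1)%C <> 0%C) by (apply Cmult_neq_0; auto).
  assert ((m * b2')%C <> 0%C) by (apply Cmult_neq_0; auto).
  repeat split; apply Cmod_inv_neq_1; auto.
Qed.

(** The four [val_] definitions are the segment values of a single crossing, convertible with [a_in]
    and [a_out] once the [b] are those of the diagram. *)
Definition val_1 (eps : bool) : C := (epow eps m * (1 - zW eps m b1 b2 b1' b2') / (1 - zN eps m b1 b2 b1' b2'))%C.
Definition val_2 (eps : bool) : C := (epow (negb eps) m * (1 - zS eps m b1 b2 b1' b2') / (1 - zW eps m b1 b2 b1' b2'))%C.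
Definition val_1' (eps : bool) : C := (epow eps m * (1 - zS eps m b1 b2 b1' b2') / (1 - zE eps m b1 b2 b1' b2'))%C.
Definition val_2' (eps : bool) : C := (epow (negb eps) m * (1 - zE eps m b1 b2 b1' b2') / (1 - zN eps m b1 b2 b1' b2'))%C.

Lemma generic_eps eps : (1 - zN eps m b1 b2 b1' b2' <> 0)%C /\ (1 - zS eps m b1 b2 b1' b2' <> 0)%C /\
  (1 - zW eps m b1 b2 b1' b2' <> 0)%C /\ (1 - zE eps m b1 b2 b1' b2' <> 0)%C.
Proof.
  destruct Hg as [G1 [G2 [G3 G4]]]. destruct generic_inv as [I1 [I2 [I3 I4]]].
  destruct eps; repeat split; apply one_minus_neq_0; assumption.
Qed.

Lemma val_neq_0 eps : val_1 eps <> 0%C /\ val_2 eps <> 0%C /\ val_1' eps <> 0%C /\ val_2' eps <> 0%C.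
Proof.
  destruct (generic_eps eps) as [? [? [? ?]]]. pose proof m_neq_0 as Hm.
  assert (Hm' : forall b, epow b m <> 0%C).
  { intros [|]; simpl; auto. intros E. pose proof (Cinv_r _ Hm) as E2. rewrite E in E2.
    apply (f_equal Re) in E2. simpl in E2. lra. }
  assert (Hd : forall a b : C, a <> 0%C -> b <> 0%C -> (a / b)%C <> 0%C).
  { intros a b Ha Hb E. apply Ha. replace a with (a / b * b)%C by (field; auto). rewrite E. ring. }
  repeat split; apply Hd; auto; apply Cmult_neq_0; auto.
Qed.

(** The elementary factor of the weight; a negative crossing carries its inverse. Unit shifts
    multiply it by [m] or [1 / m] only, since the part with [1 - N] changes by an integer multiple
    of [2 pi i]. *)
Definition wexp (s1 s2 s1' s2' : C) : C :=
  cexp (twopii * (1 - NR) * (s2 - s1 - mu / NR) + twopii * mu * (s2 + s1' - s1 - s2')).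

Lemma wexp_inv s1 s2 s1' s2' :
  cexp (- (twopii * (1 - NR) * (s2 - s1 - mu / NR)) - twopii * mu * (s2 + s1' - s1 - s2')) = (/ wexp s1 s2 s1' s2')%C.
Proof. unfold wexp. rewrite <- cexp_opp. f_equal. ring. Qed.

Lemma wexp_1 s1 s2 s1' s2' : wexp (s1 + 1) s2 s1' s2' = (wexp s1 s2 s1' s2' / m)%C.
Proof.
  transitivity (wexp s1 s2 s1' s2' * e2pi (NR - 1) / m)%C.
  - unfold wexp. rewrite m_eq. unfold e2pi. rewrite <- cexp_add, <- cexp_minus. f_equal. ring.
  - rewrite e2pi_Nm1. unfold Cdiv. ring.
Qed.
Lemma wexp_2 s1 s2 s1' s2' : wexp s1 (s2 + 1) s1' s2' = (wexp s1 s2 s1' s2' * m)%C.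
Proof.
  transitivity (wexp s1 s2 s1' s2' * m / e2pi (NR - 1))%C.
  - unfold wexp. rewrite m_eq. unfold e2pi. rewrite <- cexp_add, <- cexp_minus. f_equal. ring.
  - rewrite e2pi_Nm1. field.
Qed.
Lemma wexp_1' s1 s2 s1' s2' : wexp s1 s2 (s1' + 1) s2' = (wexp s1 s2 s1' s2' * m)%C.
Proof. unfold wexp. rewrite m_eq. unfold e2pi. rewrite <- cexp_add. f_equal. ring. Qed.
Lemma wexp_2' s1 s2 s1' s2' : wexp s1 s2 s1' (s2' + 1) = (wexp s1 s2 s1' s2' / m)%C.
Proof. unfold wexp. rewrite m_eq. unfold e2pi. rewrite <- cexp_minus. f_equal. ring. Qed.

Lemma Lambda_pos_eq s1 s2 s1' s2' : Lambda_pos N mu s1 s2 s1' s2' =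
  (E_N N (s2' - s1) * E_N N (s2 - s1') /
   (E_N N (s2 - s1 - mu / NR + 1 - 1 / NR) * E_N N (s2' - s1' + mu / NR)) * wexp s1 s2 s1' s2')%C.
Proof. reflexivity. Qed.
Lemma Lambda_neg_eq s1 s2 s1' s2' : Lambda_neg N mu s1 s2 s1' s2' =
  (E_N N (s1 - s2 + mu / NR) * E_N N (s1' - s2' - mu / NR + 1 - 1 / NR) /
   (E_N N (s1 - s2' + 1 - 1 / NR) * E_N N (s1' - s2 + 1 - 1 / NR)) * / wexp s1 s2 s1' s2')%C.
Proof. unfold Lambda_neg. fold NR. rewrite wexp_inv. reflexivity. Qed.

Lemma E_values_neq_0 :
  (E_N N (t2' - t1) <> 0 /\ E_N N (t2 - t1') <> 0 /\
  E_N N (t2 - t1 - mu / NR + 1 - 1 / NR) <> 0 /\ E_N N (t2' - t1' + mu / NR) <> 0)%C /\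
  (E_N N (t1 - t2 + mu / NR) <> 0 /\ E_N N (t1' - t2' - mu / NR + 1 - 1 / NR) <> 0 /\
   E_N N (t1 - t2' + 1 - 1 / NR) <> 0 /\ E_N N (t1' - t2 + 1 - 1 / NR) <> 0)%C.
Proof.
  destruct Hg as [G1 [G2 [G3 G4]]]. destruct generic_inv as [I1 [I2 [I3 I4]]].
  assert (Hn : forall t z, e2pi (NR * t) = z -> Cmod z <> 1 -> E_N N t <> 0%C).
  { intros t z E H. apply E_N_neq_0; auto. eapply Im_neq_0_of_Cmod; eauto. }
  split; (split; [|split; [|split]]).
  - eapply Hn; [apply e2pi_d1|auto].
  - eapply Hn; [apply e2pi_d2|auto].
  - eapply Hn; [apply e2pi_d3|auto].
  - eapply Hn; [apply e2pi_d4|auto].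
  - eapply Hn; [apply e2pi_c1|auto].
  - eapply Hn; [apply e2pi_c2|auto].
  - eapply Hn; [apply e2pi_c3|auto].
  - eapply Hn; [apply e2pi_c4|auto].
Qed.

Lemma wexp_neq_0 s1 s2 s1' s2' : wexp s1 s2 s1' s2' <> 0%C.
Proof. apply cexp_neq_0. Qed.

Ltac lambda_start :=
  destruct Hg as [G1 [G2 [G3 G4]]]; destruct generic_inv as [I1 [I2 [I3 I4]]];
  pose proof m_neq_0 as Hm;
  destruct E_values_neq_0 as [[V1 [V2 [V3 V4]]] [V5 [V6 [V7 V8]]]];
  pose proof (wexp_neq_0 t1 t2 t1' t2') as Hw.

(** Translating an incoming end divides the weight by the segment value there, and translating an
    outgoing end multiplies by it: the factors [1 - z] come from the dilogarithms, the power of [m]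
    from [wexp]. A segment thus collects the ratio that its segment equation sets to 1. *)
Lemma Lambda_shift_1 eps : Lambda eps N mu (t1 + 1) t2 t1' t2' = (Lambda eps N mu t1 t2 t1' t2' / val_1 eps)%C.
Proof.
  lambda_start. pose proof (generic_eps eps) as [Q1 [Q2 [Q3 Q4]]].
  destruct eps; simpl Lambda; unfold val_1, zN, zS, zW, zE, epow, negb in *.
  - rewrite !Lambda_pos_eq, wexp_1.
    replace (t2' - (t1 + 1))%C with (t2' - t1 - 1)%C by ring.
    replace (t2 - (t1 + 1) - mu / NR + 1 - 1 / NR)%C with (t2 - t1 - mu / NR + 1 - 1 / NR - 1)%C by ring.
    rewrite (E_down _ _ e2pi_d1 G1), (E_down _ _ e2pi_d3 G3).
    set (x := (b2' / b1)%C) in *. set (y := (b2 / (m * b1))%C) in *. field. repeat split; auto.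
  - rewrite !Lambda_neg_eq, wexp_1.
    replace (t1 + 1 - t2 + mu / NR)%C with (t1 - t2 + mu / NR + 1)%C by ring.
    replace (t1 + 1 - t2' + 1 - 1 / NR)%C with (t1 - t2' + 1 - 1 / NR + 1)%C by ring.
    rewrite (E_up _ _ e2pi_c1 I3), (E_up _ _ e2pi_c3 I1).
    set (x := (/ (b2' / b1))%C) in *. set (y := (/ (b2 / (m * b1)))%C) in *. field. repeat split; auto.
Qed.

Lemma Lambda_shift_2 eps : Lambda eps N mu t1 (t2 + 1) t1' t2' = (Lambda eps N mu t1 t2 t1' t2' / val_2 eps)%C.
Proof.
  lambda_start. pose proof (generic_eps eps) as [Q1 [Q2 [Q3 Q4]]].
  destruct eps; simpl Lambda; unfold val_2, zN, zS, zW, zE, epow, negb in *.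
  - rewrite !Lambda_pos_eq, wexp_2.
    replace (t2 + 1 - t1')%C with (t2 - t1' + 1)%C by ring.
    replace (t2 + 1 - t1 - mu / NR + 1 - 1 / NR)%C with (t2 - t1 - mu / NR + 1 - 1 / NR + 1)%C by ring.
    rewrite (E_up _ _ e2pi_d2 G2), (E_up _ _ e2pi_d3 G3).
    set (x := (b2 / b1')%C) in *. set (y := (b2 / (m * b1))%C) in *. field. repeat split; auto.
  - rewrite !Lambda_neg_eq, wexp_2.
    replace (t1 - (t2 + 1) + mu / NR)%C with (t1 - t2 + mu / NR - 1)%C by ring.
    replace (t1' - (t2 + 1) + 1 - 1 / NR)%C with (t1' - t2 + 1 - 1 / NR - 1)%C by ring.
    rewrite (E_down _ _ e2pi_c1 I3), (E_down _ _ e2pi_c4 I2).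
    set (x := (/ (b2 / b1'))%C) in *. set (y := (/ (b2 / (m * b1)))%C) in *. field. repeat split; auto.
Qed.

Lemma Lambda_shift_1' eps : Lambda eps N mu t1 t2 (t1' + 1) t2' = (Lambda eps N mu t1 t2 t1' t2' * val_1' eps)%C.
Proof.
  lambda_start. pose proof (generic_eps eps) as [Q1 [Q2 [Q3 Q4]]].
  destruct eps; simpl Lambda; unfold val_1', zN, zS, zW, zE, epow, negb in *.
  - rewrite !Lambda_pos_eq, wexp_1'.
    replace (t2 - (t1' + 1))%C with (t2 - t1' - 1)%C by ring.
    replace (t2' - (t1' + 1) + mu / NR)%C with (t2' - t1' + mu / NR - 1)%C by ring.
    rewrite (E_down _ _ e2pi_d2 G2), (E_down _ _ e2pi_d4 G4).
    set (x := (b2 / b1')%C) in *. set (y := (m * b2' / b1')%C) in *. field. repeat split; auto.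
  - rewrite !Lambda_neg_eq, wexp_1'.
    replace (t1' + 1 - t2' - mu / NR + 1 - 1 / NR)%C with (t1' - t2' - mu / NR + 1 - 1 / NR + 1)%C by ring.
    replace (t1' + 1 - t2 + 1 - 1 / NR)%C with (t1' - t2 + 1 - 1 / NR + 1)%C by ring.
    rewrite (E_up _ _ e2pi_c2 I4), (E_up _ _ e2pi_c4 I2).
    set (x := (/ (b2 / b1'))%C) in *. set (y := (/ (m * b2' / b1'))%C) in *. field. repeat split; auto.
Qed.

Lemma Lambda_shift_2' eps : Lambda eps N mu t1 t2 t1' (t2' + 1) = (Lambda eps N mu t1 t2 t1' t2' * val_2' eps)%C.
Proof.
  lambda_start. pose proof (generic_eps eps) as [Q1 [Q2 [Q3 Q4]]].
  destruct eps; simpl Lambda; unfold val_2', zN, zS, zW, zE, epow, negb in *.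
  - rewrite !Lambda_pos_eq, wexp_2'.
    replace (t2' + 1 - t1)%C with (t2' - t1 + 1)%C by ring.
    replace (t2' + 1 - t1' + mu / NR)%C with (t2' - t1' + mu / NR + 1)%C by ring.
    rewrite (E_up _ _ e2pi_d1 G1), (E_up _ _ e2pi_d4 G4).
    set (x := (b2' / b1)%C) in *. set (y := (m * b2' / b1')%C) in *. field. repeat split; auto.
  - rewrite !Lambda_neg_eq, wexp_2'.
    replace (t1' - (t2' + 1) - mu / NR + 1 - 1 / NR)%C with (t1' - t2' - mu / NR + 1 - 1 / NR - 1)%C by ring.
    replace (t1 - (t2' + 1) + 1 - 1 / NR)%C with (t1 - t2' + 1 - 1 / NR - 1)%C by ring.
    rewrite (E_down _ _ e2pi_c2 I4), (E_down _ _ e2pi_c3 I1).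
    set (x := (/ (b2' / b1))%C) in *. set (y := (/ (m * b2' / b1'))%C) in *. field. repeat split; auto.
Qed.
End Crossing.

Lemma e2pi_shift t b : e2pi (NR * t) = b -> e2pi (NR * (t + 1)) = b.
Proof. intros <-. replace (NR * (t + 1))%C with (NR * t + NR)%C by ring. unfold NR. rewrite e2pi_add, e2pi_INR. ring. Qed.

Definition select (s : bool) (a : C) : C := if s then a else 1%C.
Definition shift_by (s : bool) : C := if s then 1%C else 0%C.

(** All sixteen combinations at once, because the translated segment may occupy more than one end of
    the crossing. The shifts compose since a unit translation leaves the exponentiated values [b]
    unchanged. *)
Lemma Lambda_shift t1 t2 t1' t2' b1 b2 b1' b2' eps (s1 s2 s1' s2' : bool) :
  e2pi (NR * t1) = b1 -> e2pi (NR * t2) = b2 -> e2pi (NR * t1') = b1' -> e2pi (NR * t2') = b2' ->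
  crossing_generic b1 b2 b1' b2' ->
  Lambda eps N mu (t1 + shift_by s1) (t2 + shift_by s2) (t1' + shift_by s1') (t2' + shift_by s2') =
  (Lambda eps N mu t1 t2 t1' t2' *
    (select s1 (/ val_1 b1 b2 b1' b2' eps) * select s2 (/ val_2 b1 b2 b1' b2' eps) *
     (select s1' (val_1' b1 b2 b1' b2' eps) * select s2' (val_2' b1 b2 b1' b2' eps))))%C.
Proof.
  intros H1 H2 H1' H2' Hg.
  assert (Hs : forall t b s, e2pi (NR * t) = b -> e2pi (NR * (t + shift_by s)) = b).
  { intros t b [|] H; simpl; [apply e2pi_shift; auto|]. replace (t + 0)%C with t by ring. auto. }
  assert (S1 : Lambda eps N mu (t1 + shift_by s1) (t2 + shift_by s2) (t1' + shift_by s1') (t2' + shift_by s2') =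
     (Lambda eps N mu t1 (t2 + shift_by s2) (t1' + shift_by s1') (t2' + shift_by s2') * select s1 (/ val_1 b1 b2 b1' b2' eps))%C).
  { destruct s1; simpl select; simpl (shift_by true); simpl (shift_by false).
    - apply (Lambda_shift_1 t1 _ _ _ b1 b2 b1' b2'); auto.
    - replace (t1 + 0)%C with t1 by ring. ring. }
  assert (S2 : Lambda eps N mu t1 (t2 + shift_by s2) (t1' + shift_by s1') (t2' + shift_by s2') =
     (Lambda eps N mu t1 t2 (t1' + shift_by s1') (t2' + shift_by s2') * select s2 (/ val_2 b1 b2 b1' b2' eps))%C).
  { destruct s2; simpl select; simpl (shift_by true); simpl (shift_by false).
    - apply (Lambda_shift_2 t1 _ _ _ b1 b2 b1' b2'); auto.
    - replace (t2 + 0)%C with t2 by ring. ring. }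
  assert (S3 : Lambda eps N mu t1 t2 (t1' + shift_by s1') (t2' + shift_by s2') =
     (Lambda eps N mu t1 t2 t1' (t2' + shift_by s2') * select s1' (val_1' b1 b2 b1' b2' eps))%C).
  { destruct s1'; simpl select; simpl (shift_by true); simpl (shift_by false).
    - apply (Lambda_shift_1' t1 _ _ _ b1 b2 b1' b2'); auto.
    - replace (t1' + 0)%C with t1' by ring. ring. }
  assert (S4 : Lambda eps N mu t1 t2 t1' (t2' + shift_by s2') =
     (Lambda eps N mu t1 t2 t1' t2' * select s2' (val_2' b1 b2 b1' b2' eps))%C).
  { destruct s2'; simpl select; simpl (shift_by true); simpl (shift_by false).
    - apply (Lambda_shift_2' t1 _ _ _ b1 b2 b1' b2'); auto.
    - replace (t2' + 0)%C with t2' by ring. ring. }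
  rewrite S1, S2, S3, S4. ring.
Qed.

Lemma mixed_Lip_Lambda d eps (o1 o2 o1' o2' : option nat) (z1 z2 z1' z2' b1 b2 b1' b2' : C) :
  e2pi (NR * z1) = b1 -> e2pi (NR * z2) = b2 -> e2pi (NR * z1') = b1' -> e2pi (NR * z2') = b2' ->
  crossing_generic b1 b2 b1' b2' ->
  ex_mixed_Lip d (fun g => Lambda eps N mu (RtoC (opt_var o1 g) + z1) (RtoC (opt_var o2 g) + z2)
     (RtoC (opt_var o1' g) + z1') (RtoC (opt_var o2' g) + z2')).
Proof.
  intros H1 H2 H1' H2' Hg.
  destruct (generic_inv z1 z2 z1' z2' _ _ _ _ H1 H2 H1' H2' Hg) as [I1 [I2 [I3 I4]]].
  pose proof Hg as [G1 [G2 [G3 G4]]].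
  assert (ME : forall o o' z q, e2pi (NR * z) = q -> Cmod q <> 1 ->
    Im z <> 0 /\
    ex_mixed_Lip d (fun g => E_N N (RtoC (opt_var o g) - RtoC (opt_var o' g) + z)) /\
    ex_mixed_Lip d (fun g => / E_N N (RtoC (opt_var o g) - RtoC (opt_var o' g) + z))%C).
  { intros o o' z q E H. pose proof (Im_neq_0_of_Cmod _ _ _ E H) as HI. split; auto. apply mixed_Lip_E_N; auto. }
  assert (Hne : forall a b z, Im z <> 0 -> E_N N (RtoC a - RtoC b + z) <> 0%C).
  { intros a b z H. apply E_N_neq_0; auto. simpl. unfold Im in *. lra. }
  assert (MX : ex_mixed_Lip d (fun g => wexp (RtoC (opt_var o1 g) + z1) (RtoC (opt_var o2 g) + z2) (RtoC (opt_var o1' g) + z1') (RtoC (opt_var o2' g) + z2'))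
    /\ ex_mixed_Lip d (fun g => / wexp (RtoC (opt_var o1 g) + z1) (RtoC (opt_var o2 g) + z2) (RtoC (opt_var o1' g) + z1') (RtoC (opt_var o2' g) + z2'))%C).
  (* The exponent is linear in [t2 - t1] and [t1' - t2'], so [wexp] is a product of two factors of
     two variables each. *)
  { set (c := (twopii * (1 - NR) * (z2 - z1 - mu / NR) + twopii * mu * (z2 + z1' - z1 - z2'))%C).
    split.
    - eapply ex_mixed_Lip_ext; [|apply ex_mixed_Lip_mult; [apply (mixed_Lip_cexp d o2 o1 c (twopii * (1 - NR) + twopii * mu))|apply (mixed_Lip_cexp d o1' o2' 0 (twopii * mu))]].
      intros g. simpl. unfold wexp. rewrite <- cexp_add. f_equal. unfold c. ring.
    - eapply ex_mixed_Lip_ext; [|apply ex_mixed_Lip_mult; [apply (mixed_Lip_cexp d o2 o1 (- c) (- (twopii * (1 - NR) + twopii * mu)))|apply (mixed_Lip_cexp d o1' o2' 0 (- (twopii * mu)))]].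
      intros g. simpl. unfold wexp. rewrite <- cexp_opp, <- cexp_add. f_equal. unfold c. ring. }
  destruct MX as [MX MXi].
  destruct eps; simpl Lambda.
  - destruct (ME o2' o1 _ _ (e2pi_d1 z1 z2' _ _ H1 H2') G1) as [K1 [M1 _]].
    destruct (ME o2 o1' _ _ (e2pi_d2 z2 z1' _ _ H2 H1') G2) as [K2 [M2 _]].
    destruct (ME o2 o1 _ _ (e2pi_d3 z1 z2 _ _ H1 H2) G3) as [K3 [_ M3]].
    destruct (ME o2' o1' _ _ (e2pi_d4 z1' z2' _ _ H1' H2') G4) as [K4 [_ M4]].
    eapply ex_mixed_Lip_ext; [|apply ex_mixed_Lip_mult; [apply ex_mixed_Lip_mult; [apply ex_mixed_Lip_mult; [exact M1|exact M2]|apply ex_mixed_Lip_mult; [exact M3|exact M4]]|exact MX]].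
    intros g. cbv beta. rewrite Lambda_pos_eq.
    set (x1 := opt_var o1 g). set (x2 := opt_var o2 g). set (x1' := opt_var o1' g). set (x2' := opt_var o2' g).
    replace (x2' + z2' - (x1 + z1))%C with (x2' - x1 + (z2' - z1))%C by ring.
    replace (x2 + z2 - (x1' + z1'))%C with (x2 - x1' + (z2 - z1'))%C by ring.
    replace (x2 + z2 - (x1 + z1) - mu / NR + 1 - 1 / NR)%C with (x2 - x1 + (z2 - z1 - mu / NR + 1 - 1 / NR))%C by ring.
    replace (x2' + z2' - (x1' + z1') + mu / NR)%C with (x2' - x1' + (z2' - z1' + mu / NR))%C by ring.
    pose proof (Hne x2 x1 _ K3). pose proof (Hne x2' x1' _ K4). field. auto.
  - destruct (ME o1 o2 _ _ (e2pi_c1 z1 z2 z1' z2' _ _ _ _ H1 H2 H1' H2') I3) as [K1 [M1 _]].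
    destruct (ME o1' o2' _ _ (e2pi_c2 z1 z2 z1' z2' _ _ _ _ H1 H2 H1' H2') I4) as [K2 [M2 _]].
    destruct (ME o1 o2' _ _ (e2pi_c3 z1 z2 z1' z2' _ _ _ _ H1 H2 H1' H2') I1) as [K3 [_ M3]].
    destruct (ME o1' o2 _ _ (e2pi_c4 z1 z2 z1' z2' _ _ _ _ H1 H2 H1' H2') I2) as [K4 [_ M4]].
    eapply ex_mixed_Lip_ext; [|apply ex_mixed_Lip_mult; [apply ex_mixed_Lip_mult; [apply ex_mixed_Lip_mult; [exact M1|exact M2]|apply ex_mixed_Lip_mult; [exact M3|exact M4]]|exact MXi]].
    intros g. cbv beta. rewrite Lambda_neg_eq.
    set (x1 := opt_var o1 g). set (x2 := opt_var o2 g). set (x1' := opt_var o1' g). set (x2' := opt_var o2' g).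
    replace (x1 + z1 - (x2 + z2) + mu / NR)%C with (x1 - x2 + (z1 - z2 + mu / NR))%C by ring.
    replace (x1' + z1' - (x2' + z2') - mu / NR + 1 - 1 / NR)%C with (x1' - x2' + (z1' - z2' - mu / NR + 1 - 1 / NR))%C by ring.
    replace (x1 + z1 - (x2' + z2') + 1 - 1 / NR)%C with (x1 - x2' + (z1 - z2' + 1 - 1 / NR))%C by ring.
    replace (x1' + z1' - (x2 + z2) + 1 - 1 / NR)%C with (x1' - x2 + (z1' - z2 + 1 - 1 / NR))%C by ring.
    pose proof (Hne x1 x2' _ K3). pose proof (Hne x1' x2 _ K4).
    pose proof (wexp_neq_0 (x1 + z1) (x2 + z2) (x1' + z1') (x2' + z2')).
    field. auto.
Qed.
End Lambda.

(** * Combinatorics of the traversal *)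

Section Traversal.
Local Open Scope nat_scope.

Lemma slot_eqb_spec (a b : slot) : slot_eqb a b = true <-> a = b.
Proof.
  destruct a as [a1 a2], b as [b1 b2]. unfold slot_eqb. simpl. rewrite Bool.andb_true_iff, !Nat.eqb_eq.
  split; [intros [-> ->]; reflexivity|intros H; injection H; auto].
Qed.

Lemma slot_eqb_refl a : slot_eqb a a = true.
Proof. apply slot_eqb_spec. reflexivity. Qed.

Definition final (w : list event) : slot := (length w, 0).

Section Trace.
Variable w : list event.

Definition reaches (f : nat) (sl : slot) : Prop := In (final w) (map fst (trace_aux w f sl)).

Lemma trace_aux_S f sl : trace_aux w (S f) sl =
  if slot_eqb sl (final w) then [(sl, MNone)] else (sl, snd (step w sl)) :: trace_aux w f (fst (step w sl)).
Proof. simpl. unfold final. destruct (slot_eqb sl (length w, 0)); [reflexivity|]. destruct (step w sl); reflexivity. Qed.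

(** The traversal stops at the final slot, so a fuel sufficient to reach it determines the trace. *)
Lemma reaches_mono f f' sl : reaches f sl -> f <= f' -> trace_aux w f' sl = trace_aux w f sl.
Proof.
  revert f' sl. induction f as [|f IH]; intros f' sl H Hle; [destruct H|].
  destruct f' as [|f']; [lia|]. unfold reaches in H. rewrite !trace_aux_S in *.
  destruct (slot_eqb sl (final w)) eqn:E; [reflexivity|]. f_equal. apply IH; [|lia].
  destruct H as [H|H]; [|exact H]. simpl in H. subst sl. rewrite slot_eqb_refl in E. discriminate.
Qed.

(** The traversal is deterministic, hence what follows a visited slot is the traversal started
    there. Recording the fuel is what allows lengths to be compared in [trace_NoDup]. *)
Lemma trace_suffix f sl s : reaches f sl -> In s (map fst (trace_aux w f sl)) ->
  exists pre f', length pre + f' <= f /\ trace_aux w f sl = pre ++ trace_aux w f' s /\ reaches f' s.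
Proof.
  revert sl. induction f as [|f IH]; intros sl H Hin; [destruct H|].
  pose proof H as H0. unfold reaches in H. rewrite trace_aux_S in H, Hin.
  destruct (slot_eqb sl (final w)) eqn:E.
  - destruct Hin as [Hin|[]]. simpl in Hin. subst s. exists [], (S f). auto.
  - destruct Hin as [Hin|Hin].
    + simpl in Hin. subst s. exists [], (S f). auto.
    + destruct H as [H|H]; [simpl in H; subst sl; rewrite slot_eqb_refl in E; discriminate|].
      destruct (IH _ H Hin) as [pre [f' [Hl [Heq Hr]]]].
      exists ((sl, snd (step w sl)) :: pre), f'. split; [simpl; lia|]. split; [|exact Hr].
      rewrite trace_aux_S, E, Heq. reflexivity.
Qed.

(* A repeated slot would make the deterministic traversal periodic, so that it never ends. *)
Lemma trace_NoDup f sl : reaches f sl -> NoDup (map fst (trace_aux w f sl)).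
Proof.
  revert sl. induction f as [|f IH]; intros sl H; [destruct H|].
  pose proof H as H0. unfold reaches in H. rewrite trace_aux_S in *.
  destruct (slot_eqb sl (final w)) eqn:E; [simpl; constructor; [auto|constructor]|].
  destruct H as [H|H]; [simpl in H; subst sl; rewrite slot_eqb_refl in E; discriminate|].
  simpl. constructor; [|apply IH; exact H].
  intros Hin. destruct (trace_suffix _ _ _ H Hin) as [pre [f' [Hl [Heq Hr]]]].
  assert (E2 : trace_aux w (S f) sl = trace_aux w f' sl) by (apply reaches_mono; [exact Hr|lia]).
  rewrite trace_aux_S, E in E2.
  apply (f_equal (@length _)) in E2. apply (f_equal (@length _)) in Heq. rewrite length_app in Heq. simpl in E2. lia.
Qed.

Definition n_cross_marks (l : list (slot * mark)) : nat := length (filter (fun x => is_cross (snd x)) l).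

Lemma n_cross_marks_app l l' : n_cross_marks (l ++ l') = n_cross_marks l + n_cross_marks l'.
Proof. unfold n_cross_marks. rewrite filter_app, length_app. reflexivity. Qed.

(** A segment number is the count of crossing marks before the first visit of the slot; the mark at
    the slot itself is not yet counted. *)
Lemma seg_go_spec pre s mk post c : ~ In s (map fst pre) ->
  seg_go (pre ++ (s, mk) :: post) s c = c + n_cross_marks pre.
Proof.
  revert c. induction pre as [|[s' m'] pre IH]; intros c Hn; simpl.
  - rewrite slot_eqb_refl. unfold n_cross_marks. simpl. lia.
  - destruct (slot_eqb s s') eqn:E.
    + apply slot_eqb_spec in E. subst s'. exfalso. apply Hn. left. reflexivity.
    + rewrite IH by (intros H; apply Hn; right; exact H). unfold n_cross_marks. simpl. destruct (is_cross m'); simpl; lia.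
Qed.

Hypothesis Hw : knot_diagram w.

Lemma trace_reaches : reaches (nslots w) (0, 0).
Proof.
  destruct Hw as [_ [H _]]. unfold reaches. apply in_map_iff. exists (final w, MNone). split; auto.
Qed.

Lemma trace_all_slots j p : j <= length w -> p < length (state w j) -> In (j, p) (map fst (trace w)).
Proof.
  intros Hj Hp. destruct Hw as [_ [_ H]]. destruct (H j p Hj Hp) as [mk Hm].
  apply in_map_iff. exists ((j, p), mk). split; auto.
Qed.

Lemma word_ok_nth s w0 j ev : word_ok s w0 -> nth_error w0 j = Some ev ->
  ev_ok (fold_left apply_ev (firstn j w0) s) ev.
Proof.
  revert s j. induction w0 as [|e0 w0 IH]; intros s j H Hn; [destruct j; discriminate|].
  destruct H as [H1 H2]. destruct j as [|j]; simpl in *.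
  - injection Hn as <-. exact H1.
  - apply IH; auto.
Qed.

(** The flag is that of [a_in] and [a_out]: [true] is the strand from 1 to 1', which enters at
    position [k] and leaves at [k + 1]; the other strand does the opposite. *)
Definition slot_in (j k : nat) (r : bool) : slot := (j, if r then k else k + 1).
Definition slot_out (j k : nat) (r : bool) : slot := (S j, if r then k + 1 else k).

Lemma cross_state j k eps : nth_error w j = Some (Cross k eps) ->
  j < length w /\ k + 1 < length (state w j) /\ nth k (state w j) false = true /\ nth (k + 1) (state w j) false = true.
Proof.
  intros H. pose proof (word_ok_nth [true] w j _ (proj1 Hw) H) as E. simpl in E.
  assert (j < length w) by (apply nth_error_Some; congruence). tauto.
Qed.

Lemma step_cross j k eps r : nth_error w j = Some (Cross k eps) ->
  step w (slot_in j k r) = (slot_out j k r, MCross).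
Proof.
  intros H. destruct (cross_state j k eps H) as [_ [_ [H1 H2]]].
  unfold step, slot_in, slot_out. rewrite H. destruct r.
  - rewrite H1, Nat.eqb_refl. reflexivity.
  - rewrite H2. destruct (Nat.eqb_spec (k + 1) k); [lia|]. rewrite Nat.eqb_refl. reflexivity.
Qed.

Lemma step_MCross s s' : step w s = (s', MCross) ->
  exists j k eps r, nth_error w j = Some (Cross k eps) /\ s = slot_in j k r.
Proof.
  destruct s as [j p]. unfold step.
  destruct (nth p (state w j) false).
  - destruct (nth_error w j) as [[k eps|k o|k]|] eqn:E; try discriminate.
    + destruct (Nat.eqb_spec p k) as [->|Hp].
      * intros _. exists j, k, eps, true. auto.
      * destruct (Nat.eqb_spec p (k + 1)) as [->|Hp']; [|discriminate].
        intros _. exists j, k, eps, false. auto.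
    + destruct (Nat.eqb p k); [discriminate|]. destruct (Nat.eqb p (k + 1)); discriminate.
  - destruct j as [|j]; [discriminate|].
    destruct (nth_error w j) as [[k eps|k o|k]|] eqn:E; try discriminate.
    destruct (Nat.eqb p k); [discriminate|]. destruct (Nat.eqb p (k + 1)); discriminate.
Qed.

Lemma trace_aux_MCross f sl s : In (s, MCross) (trace_aux w f sl) -> exists s', step w s = (s', MCross).
Proof.
  revert sl. induction f as [|f IH]; intros sl H; [destruct H|].
  rewrite trace_aux_S in H. destruct (slot_eqb sl (final w)).
  - destruct H as [H|[]]. discriminate.
  - destruct H as [H|H]; [|eapply IH; eauto].
    injection H as <- H. exists (fst (step w sl)). rewrite <- H. destruct (step w sl); reflexivity.
Qed.

(** Entry and exit of a crossing are consecutive in the trace. The absence of earlier visits, by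
    [trace_NoDup], is what makes [seg_go_spec] applicable to both. *)
Lemma trace_cross_split j k eps r : nth_error w j = Some (Cross k eps) ->
  exists pre mk post, trace w = pre ++ (slot_in j k r, MCross) :: (slot_out j k r, mk) :: post /\
    ~ In (slot_in j k r) (map fst pre) /\ ~ In (slot_out j k r) (map fst (pre ++ [(slot_in j k r, MCross)])).
Proof.
  intros H. destruct (cross_state j k eps H) as [Hj [Hk _]].
  assert (Hin : In (slot_in j k r) (map fst (trace w))).
  { apply trace_all_slots; [lia|]. destruct r; lia. }
  destruct (trace_suffix _ _ _ trace_reaches Hin) as [pre [f' [_ [Heq Hr]]]].
  fold (trace w) in Heq.
  pose proof (trace_NoDup _ _ trace_reaches) as HND. fold (trace w) in HND.
  destruct f' as [|f']; [destruct Hr|].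
  unfold reaches in Hr. rewrite trace_aux_S in Heq, Hr. rewrite (step_cross j k eps r H) in Heq, Hr.
  assert (Hnf : slot_in j k r <> final w) by (unfold slot_in, final; intros E; injection E; lia).
  destruct (slot_eqb (slot_in j k r) (final w)) eqn:E; [apply slot_eqb_spec in E; contradiction|].
  cbn [fst snd] in Heq, Hr.
  destruct Hr as [Hr|Hr]; [contradiction|].
  destruct f' as [|f']; [destruct Hr|].
  rewrite trace_aux_S in Heq.
  assert (Hd : exists mk post, trace w = pre ++ (slot_in j k r, MCross) :: (slot_out j k r, mk) :: post).
  { destruct (slot_eqb (slot_out j k r) (final w)); eauto. }
  destruct Hd as [mk [post Hd]]. exists pre, mk, post. split; [exact Hd|].
  rewrite Hd in HND. rewrite map_app in HND. simpl in HND. split.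
  - apply NoDup_remove_2 in HND. rewrite in_app_iff in HND. tauto.
  - change (slot_in j k r :: slot_out j k r :: map fst post) with ([slot_in j k r] ++ slot_out j k r :: map fst post) in HND.
    rewrite app_assoc in HND. apply NoDup_remove_2 in HND. rewrite in_app_iff in HND.
    rewrite map_app. simpl. tauto.
Qed.

Lemma seg_in_slot j k r : seg_in w j k r = seg_of w (slot_in j k r).
Proof. destruct r; reflexivity. Qed.
Lemma seg_out_slot j k r : seg_out w j k r = seg_of w (slot_out j k r).
Proof. destruct r; reflexivity. Qed.

Lemma seg_in_split j k eps r : nth_error w j = Some (Cross k eps) ->
  exists pre post, trace w = pre ++ (slot_in j k r, MCross) :: post /\ seg_in w j k r = n_cross_marks pre.
Proof.
  intros H. destruct (trace_cross_split j k eps r H) as [pre [mk [post [Hd [H1 H2]]]]].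
  exists pre, ((slot_out j k r, mk) :: post). split; auto.
  rewrite seg_in_slot. unfold seg_of. rewrite Hd, seg_go_spec; auto.
Qed.

Lemma seg_out_succ j k eps r : nth_error w j = Some (Cross k eps) -> seg_out w j k r = S (seg_in w j k r).
Proof.
  intros H. destruct (trace_cross_split j k eps r H) as [pre [mk [post [Hd [H1 H2]]]]].
  rewrite seg_in_slot, seg_out_slot. unfold seg_of. rewrite Hd at 2. rewrite seg_go_spec by auto.
  rewrite Hd. change (pre ++ (slot_in j k r, MCross) :: (slot_out j k r, mk) :: post) with
    (pre ++ [(slot_in j k r, MCross)] ++ (slot_out j k r, mk) :: post).
  rewrite app_assoc, seg_go_spec by auto. rewrite n_cross_marks_app. unfold n_cross_marks. simpl. lia.
Qed.

Lemma slot_in_inj j k eps r j' k' eps' r' :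
  nth_error w j = Some (Cross k eps) -> nth_error w j' = Some (Cross k' eps') ->
  slot_in j k r = slot_in j' k' r' -> j = j' /\ r = r'.
Proof.
  unfold slot_in. intros H H' E. injection E as <- E. split; auto.
  rewrite H in H'. injection H' as <- <-. destruct r, r'; auto; lia.
Qed.

(** Of two distinct entries one comes later, and the prefix before it contains the crossing mark of
    the other, so its count is strictly larger. *)
Lemma seg_in_inj j k eps r j' k' eps' r' :
  nth_error w j = Some (Cross k eps) -> nth_error w j' = Some (Cross k' eps') ->
  seg_in w j k r = seg_in w j' k' r' -> j = j' /\ r = r'.
Proof.
  intros H H' E. apply (slot_in_inj j k eps r j' k' eps' r' H H').
  destruct (seg_in_split j k eps r H) as [pre [post [Hd Hn]]].
  destruct (seg_in_split j' k' eps' r' H') as [pre' [post' [Hd' Hn']]].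
  rewrite Hn, Hn' in E. rewrite Hd in Hd'.
  apply app_eq_app in Hd'. destruct Hd' as [l [[E1 E2]|[E1 E2]]].
  - destruct l as [|x l]; cbn [app] in E2; [congruence|].
    assert (Ex : x = (slot_in j' k' r', MCross)) by congruence. subst x pre. rewrite n_cross_marks_app in E. unfold n_cross_marks in E. simpl in E. lia.
  - destruct l as [|x l]; cbn [app] in E2; [congruence|].
    assert (Ex : x = (slot_in j k r, MCross)) by congruence. subst x pre'. rewrite n_cross_marks_app in E. unfold n_cross_marks in E. simpl in E. lia.
Qed.

(** The two entry slots of every crossing, listed independently of the traversal so that they can be
    counted. *)
Fixpoint in_slots (j : nat) (v : list event) : list slot :=
  match v with
  | [] => []
  | Cross k _ :: v' => (j, k) :: (j, k + 1) :: in_slots (S j) v'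
  | _ :: v' => in_slots (S j) v'
  end.

Lemma in_slots_length j v : length (in_slots j v) = 2 * ncross v.
Proof. revert j. induction v as [|[k eps|k o|k] v IH]; intros j; unfold ncross in *; simpl; rewrite ?IH; lia. Qed.

Lemma in_slots_ge j v s : In s (in_slots j v) -> j <= fst s.
Proof.
  revert j. induction v as [|[k eps|k o|k] v IH]; intros j H; simpl in *; [destruct H| | |].
  - destruct H as [<-|[<-|H]]; simpl; [lia|lia|]. apply IH in H. lia.
  - apply IH in H. lia.
  - apply IH in H. lia.
Qed.

Lemma in_slots_NoDup j v : NoDup (in_slots j v).
Proof.
  revert j. induction v as [|[k eps|k o|k] v IH]; intros j; simpl; [constructor| | |]; auto.
  constructor; [|constructor; [|apply IH]].
  - intros [H|H]; [injection H; lia|]. apply in_slots_ge in H. simpl in H. lia.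
  - intros H. apply in_slots_ge in H. simpl in H. lia.
Qed.

Lemma in_slots_spec j v s : In s (in_slots j v) ->
  exists i k eps r, nth_error v i = Some (Cross k eps) /\ s = slot_in (j + i) k r.
Proof.
  revert j. induction v as [|ev v IH]; intros j H; [destruct H|].
  assert (Hrec : In s (in_slots (S j) v) -> exists i k eps r, nth_error (ev :: v) i = Some (Cross k eps) /\ s = slot_in (j + i) k r).
  { intros H'. destruct (IH _ H') as [i [k [eps [r [H1 H2]]]]]. exists (S i), k, eps, r. split; auto.
    rewrite H2. f_equal. lia. }
  destruct ev as [k eps|k o|k]; simpl in H; auto.
  destruct H as [<-|[<-|H]]; auto.
  - exists 0, k, eps, true. rewrite Nat.add_0_r. auto.
  - exists 0, k, eps, false. rewrite Nat.add_0_r. auto.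
Qed.

(** For a knot the traversal visits every slot, in particular the [2 c] distinct entries. The lower
    bound is the direction that guarantees a final end for each of the segments 0 to [2 c - 1]. *)
Lemma n_cross_marks_trace_ge : 2 * ncross w <= n_cross_marks (trace w).
Proof.
  rewrite <- (in_slots_length 0). unfold n_cross_marks.
  rewrite <- (length_map fst (filter (fun x => is_cross (snd x)) (trace w))).
  apply NoDup_incl_length; [apply in_slots_NoDup|].
  intros s Hs. destruct (in_slots_spec _ _ _ Hs) as [i [k [eps [r [H ->]]]]]. simpl.
  destruct (seg_in_split i k eps r H) as [pre [post [Hd _]]].
  apply in_map_iff. exists (slot_in i k r, MCross). split; auto.
  apply filter_In. split; auto. rewrite Hd. apply in_or_app. right. left. reflexivity.
Qed.

Lemma n_cross_marks_split l i : i < n_cross_marks l -> exists pre s mk post, l = pre ++ (s, mk) :: post /\ is_cross mk = true /\ n_cross_marks pre = i.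
Proof.
  revert i. induction l as [|[s mk] l IH]; intros i H; [unfold n_cross_marks in H; simpl in H; lia|].
  unfold n_cross_marks in H. simpl in H. destruct (is_cross mk) eqn:E.
  - destruct i as [|i].
    + exists [], s, mk, l. auto.
    + simpl in H. destruct (IH i) as [pre [s' [mk' [post [H1 [H2 H3]]]]]]; [unfold n_cross_marks; lia|].
      exists ((s, mk) :: pre), s', mk', post. subst l. split; auto. split; auto.
      unfold n_cross_marks in *. simpl. rewrite E. simpl. lia.
  - destruct (IH i) as [pre [s' [mk' [post [H1 [H2 H3]]]]]]; [unfold n_cross_marks; lia|].
    exists ((s, mk) :: pre), s', mk', post. subst l. split; auto. split; auto.
    unfold n_cross_marks in *. simpl. rewrite E. lia.
Qed.

(** The final end of segment [i] is found at the crossing mark preceded by exactly [i] others. *)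
Lemma seg_in_exists i : i < 2 * ncross w ->
  exists j k eps r, nth_error w j = Some (Cross k eps) /\ seg_in w j k r = i.
Proof.
  intros Hi. pose proof n_cross_marks_trace_ge as HT.
  destruct (n_cross_marks_split (trace w) i) as [pre [s [mk [post [Hd [Hm Hn]]]]]]; [lia|].
  destruct mk; try discriminate.
  destruct (trace_aux_MCross (nslots w) (0, 0) s) as [s' Hs].
  { fold (trace w). rewrite Hd. apply in_or_app. right. left. reflexivity. }
  destruct (step_MCross s s' Hs) as [j [k [eps [r [H ->]]]]].
  exists j, k, eps, r. split; auto. rewrite seg_in_slot. unfold seg_of. rewrite Hd, seg_go_spec; auto.
  pose proof (trace_NoDup _ _ trace_reaches) as HND. fold (trace w) in HND. rewrite Hd, map_app in HND. simpl in HND.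
  apply NoDup_remove_2 in HND. rewrite in_app_iff in HND. tauto.
Qed.
End Trace.
End Traversal.

(** * The state integrals *)

Lemma cprod_one n (f : nat -> C) : (forall j, (j < n)%nat -> f j = RtoC 1) -> cprod_range n f = RtoC 1.
Proof. induction n as [|n IH]; intros H; simpl; [reflexivity|]. rewrite IH, H by auto. ring. Qed.

Lemma cprod_single n (f : nat -> C) j0 : (j0 < n)%nat -> (forall j, (j < n)%nat -> j <> j0 -> f j = RtoC 1) ->
  cprod_range n f = f j0.
Proof.
  induction n as [|n IH]; intros Hj H; [lia|]. simpl.
  destruct (Nat.eq_dec j0 n) as [->|Hne].
  - rewrite cprod_one; [ring|]. intros j Hj'. apply H; lia.
  - rewrite IH, (H n); auto; try lia. ring.
Qed.

Lemma ex_mixed_Lip_const d c : ex_mixed_Lip d (fun _ => c).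
Proof. exists (Cmod c). apply mixed_Lip_const. Qed.

Lemma ex_mixed_Lip_cprod d n (f : nat -> (nat -> R) -> C) : (forall j, ex_mixed_Lip d (f j)) -> ex_mixed_Lip d (fun g => cprod_range n (fun j => f j g)).
Proof.
  intros H. induction n as [|n IH].
  - apply (ex_mixed_Lip_const d (RtoC 1)).
  - apply (ex_mixed_Lip_mult d (fun g => cprod_range n (fun j => f j g)) (f n)); auto.
Qed.

Section Assembly.
Variables (w : list event) (N : nat) (mu : C) (b beta : nat -> C).
Hypothesis Hw : knot_diagram w.
Hypothesis HN : (2 <= N)%nat.
Hypothesis Hseg : segment_equations w mu b.
Hypothesis Hsh : shapes_generic w mu b.
Hypothesis Hb : forall i, (i < nE w)%nat -> cexp (twopii * beta i)%C = b i.

Let NR : C := RtoC (INR N).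

Lemma N_ge_1 : (1 <= N)%nat.
Proof. lia. Qed.

Lemma INR_N_pos : 0 < INR N.
Proof. apply lt_0_INR. lia. Qed.

Lemma NR_ne0 : NR <> 0%C.
Proof. apply RtoC_neq_0. pose proof INR_N_pos. lra. Qed.

Definition state_arg (g : nat -> R) : nat -> C := fun i => (RtoC (g i) + beta i / RtoC (INR N))%C.

Definition W_real (g : nat -> R) : C := Wdiag w N mu (state_arg g).

Definition seg_var (sg : nat) : option nat := if internal w sg then Some (sg - 1)%nat else None.
Definition seg_offset (sg : nat) : C := if internal w sg then (beta (sg - 1)%nat / RtoC (INR N))%C else RtoC 0.
(** The value at an end of a segment is a real variable plus a constant complex offset; this is the
    additional constant at the final end. *)
Definition turn_offset (sg : nat) : C := RtoC (IZR (seg_turn w sg) * (1 - / INR N)).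

Lemma internal_lt sg : internal w sg = true -> (1 <= sg)%nat /\ (sg - 1 < nE w)%nat.
Proof.
  unfold internal. rewrite Bool.andb_true_iff, !Nat.leb_le. lia.
Qed.

Lemma v_init_state_arg g sg : v_init w (state_arg g) sg = (RtoC (opt_var (seg_var sg) g) + seg_offset sg)%C.
Proof. unfold v_init, seg_var, seg_offset, state_arg. destruct (internal w sg); simpl; [reflexivity|ring]. Qed.

Lemma v_final_state_arg g sg : v_final w N (state_arg g) sg = (RtoC (opt_var (seg_var sg) g) + (seg_offset sg + turn_offset sg))%C.
Proof. unfold v_final. rewrite v_init_state_arg. unfold turn_offset. ring. Qed.

Lemma e2pi_seg_offset sg : e2pi (NR * seg_offset sg) = bseg w b sg.
Proof.
  unfold seg_offset, bseg. destruct (internal w sg) eqn:E.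
  - rewrite <- Hb by (apply internal_lt; auto). unfold e2pi. f_equal. f_equal. unfold NR. field. apply NR_ne0.
  - replace (NR * RtoC 0)%C with (RtoC (IZR 0)) by ring. apply e2pi_IZR.
Qed.

(** [N (1 - 1 / N)] is the integer [N - 1], so the shifts of turning points do not affect the shape
    parameters, and both ends of a segment carry the same [b]. *)
Lemma e2pi_turn_offset sg : e2pi (NR * turn_offset sg) = 1%C.
Proof.
  unfold turn_offset, NR. rewrite <- RtoC_mult.
  replace (INR N * (IZR (seg_turn w sg) * (1 - / INR N))) with (IZR (seg_turn w sg * (Z.of_nat N - 1))).
  - apply e2pi_IZR.
  - pose proof INR_N_pos. rewrite mult_IZR, minus_IZR, <- INR_IZR_INZ. field. lra.
Qed.

Lemma e2pi_zfinal sg : e2pi (NR * (seg_offset sg + turn_offset sg)) = bseg w b sg.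
Proof. rewrite Cmult_plus_distr_l, e2pi_add, e2pi_seg_offset, e2pi_turn_offset. ring. Qed.

Lemma Cmod_inv_neq_1_rev (q : C) : Cmod (/ q) <> 1 -> Cmod q <> 1.
Proof.
  intros H E. apply H. rewrite Cmod_inv.
  - rewrite E. apply Rinv_1.
  - intros Hq. rewrite Hq, Cmod_0 in E. lra.
Qed.

Lemma crossing_generic_w j k eps : nth_error w j = Some (Cross k eps) ->
  crossing_generic mu (bseg w b (seg1 w j k)) (bseg w b (seg2 w j k)) (bseg w b (seg1' w j k)) (bseg w b (seg2' w j k)).
Proof.
  intros H. specialize (Hsh j k eps H). unfold shapes in Hsh.
  unfold crossing_generic, zN, zS, zW, zE in *.
  assert (Hz : forall q, In (epow eps q) (shapes w mu b j k eps) -> Cmod q <> 1).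
  { intros q Hin. apply Hsh in Hin. destruct Hin as [_ Hin]. destruct eps; simpl in Hin; auto. apply Cmod_inv_neq_1_rev; auto. }
  unfold shapes in Hz. 
  split; [|split; [|split]]; apply Hz; unfold zN, zS, zW, zE; simpl; tauto.
Qed.

Lemma W_real_ex_mixed_Lip d : ex_mixed_Lip d W_real.
Proof.
  unfold W_real, Wdiag. apply (ex_mixed_Lip_cprod d (length w) (fun j g => cross_weight w N mu (state_arg g) j)).
  intros j. unfold cross_weight.
  destruct (nth_error w j) as [[k eps|k o|k]|] eqn:E; try apply ex_mixed_Lip_const.
  eapply ex_mixed_Lip_ext; [|apply (mixed_Lip_Lambda N N_ge_1 mu d eps
     (seg_var (seg1 w j k)) (seg_var (seg2 w j k)) (seg_var (seg1' w j k)) (seg_var (seg2' w j k)) _ _ _ _ _ _ _ _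
     (e2pi_zfinal _) (e2pi_zfinal _) (e2pi_seg_offset _) (e2pi_seg_offset _) (crossing_generic_w j k eps E))].
  intros g. cbv beta. rewrite !v_final_state_arg, !v_init_state_arg. reflexivity.
Qed.

Section Period.
Variables (n : nat -> nat) (i : nat).
Hypothesis Hi : (i < nE w)%nat.

Let g0 : nat -> R := lattice N (upd n i O).
Let g1 : nat -> R := lattice N (upd n i N).

(** Variables are numbered from 0 and internal segments from 1, so variable [i] is that of segment
    [S i]. The lattice index [N] stands for the coordinate 1. *)
Lemma opt_var_shift sg : RtoC (opt_var (seg_var sg) g1) = (RtoC (opt_var (seg_var sg) g0) + shift_by (Nat.eqb sg (S i)))%C.
Proof.
  pose proof INR_N_pos. unfold seg_var. destruct (internal w sg) eqn:E; simpl.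
  - apply internal_lt in E. destruct E as [E1 E2]. unfold g0, g1, lattice.
    destruct (Nat.eqb_spec sg (S i)) as [->|Hne].
    + replace (S i - 1)%nat with i by lia. rewrite !upd_same. simpl shift_by. rewrite <- RtoC_plus. f_equal. simpl. field. lra.
    + rewrite !upd_other by lia. simpl shift_by. ring.
  - destruct (Nat.eqb_spec sg (S i)) as [->|Hne]; simpl shift_by; [|ring].
    exfalso. unfold internal in E. rewrite Bool.andb_false_iff, !Nat.leb_gt in E. lia.
Qed.

Lemma v_init_shift sg : v_init w (state_arg g1) sg = (v_init w (state_arg g0) sg + shift_by (Nat.eqb sg (S i)))%C.
Proof. rewrite !v_init_state_arg, opt_var_shift. ring. Qed.

Lemma v_final_shift sg : v_final w N (state_arg g1) sg = (v_final w N (state_arg g0) sg + shift_by (Nat.eqb sg (S i)))%C.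
Proof. unfold v_final. rewrite v_init_shift. ring. Qed.

Lemma e2pi_lattice_opt_var sg : e2pi (NR * RtoC (opt_var (seg_var sg) g0)) = 1%C.
Proof.
  pose proof INR_N_pos. unfold seg_var. destruct (internal w sg); simpl.
  - unfold g0, lattice, NR. rewrite <- RtoC_mult.
    replace (INR N * (INR (upd n i 0%nat (sg - 1)%nat) / INR N)) with (INR (upd n i 0%nat (sg - 1)%nat)) by (field; lra).
    apply e2pi_INR.
  - replace (NR * 0)%C with (RtoC (IZR 0)) by ring. apply e2pi_IZR.
Qed.

Lemma e2pi_v_init sg : e2pi (NR * v_init w (state_arg g0) sg) = bseg w b sg.
Proof. rewrite v_init_state_arg, Cmult_plus_distr_l, e2pi_add, e2pi_lattice_opt_var, e2pi_seg_offset. ring. Qed.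

Lemma e2pi_v_final sg : e2pi (NR * v_final w N (state_arg g0) sg) = bseg w b sg.
Proof. rewrite v_final_state_arg, Cmult_plus_distr_l, e2pi_add, e2pi_lattice_opt_var, e2pi_zfinal. ring. Qed.

(** What the incoming end of strand [r] at event [j] contributes when variable [i] is raised by 1;
    [out_factor] is the analogue for outgoing ends. Splitting by strand lets each product be reduced
    to a single factor. *)
Definition in_factor (r : bool) (j : nat) : C :=
  match nth_error w j with
  | Some (Cross k eps) => select (Nat.eqb (seg_in w j k r) (S i)) (/ a_in w mu b j k eps r)
  | _ => RtoC 1
  end.
Definition out_factor (r : bool) (j : nat) : C :=
  match nth_error w j with
  | Some (Cross k eps) => select (Nat.eqb (seg_out w j k r) (S i)) (a_out w mu b j k eps r)
  | _ => RtoC 1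
  end.

Lemma cross_weight_shift j : cross_weight w N mu (state_arg g1) j =
  (cross_weight w N mu (state_arg g0) j * (in_factor true j * in_factor false j * (out_factor true j * out_factor false j)))%C.
Proof.
  unfold cross_weight, in_factor, out_factor. destruct (nth_error w j) as [[k eps|k o|k]|] eqn:E; try ring.
  rewrite !v_final_shift, !v_init_shift.
  apply (Lambda_shift N N_ge_1 mu _ _ _ _ _ _ _ _ eps _ _ _ _ (e2pi_v_final _) (e2pi_v_final _) (e2pi_v_init _) (e2pi_v_init _)
    (crossing_generic_w j k eps E)).
Qed.

Lemma cprod_bool_pair (f : bool -> nat -> C) L r0 j0 : (j0 < L)%nat ->
  (forall r j, (j < L)%nat -> ~ (j = j0 /\ r = r0) -> f r j = RtoC 1) ->
  (cprod_range L (f true) * cprod_range L (f false))%C = f r0 j0.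
Proof.
  intros Hj H. destruct r0.
  - rewrite (cprod_single L (f true) j0), (cprod_one L (f false)); auto; [ring| |].
    + intros j Hj'. apply H; auto. intros [_ E]; discriminate.
    + intros j Hj' Hne. apply H; auto. intros [E _]; auto.
  - rewrite (cprod_single L (f false) j0), (cprod_one L (f true)); auto; [ring| |].
    + intros j Hj'. apply H; auto. intros [_ E]; discriminate.
    + intros j Hj' Hne. apply H; auto. intros [E _]; auto.
Qed.

Lemma a_in_neq_0 j k eps r : nth_error w j = Some (Cross k eps) -> a_in w mu b j k eps r <> 0%C.
Proof.
  intros E.
  pose proof (val_neq_0 N mu _ _ _ _ _ _ _ _ (e2pi_v_final (seg1 w j k)) (e2pi_v_final (seg2 w j k)) (e2pi_v_init (seg1' w j k)) (e2pi_v_init (seg2' w j k))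
     (crossing_generic_w j k eps E) eps) as [HA1 [HA2 _]].
  destruct r; [exact HA1|exact HA2].
Qed.

(** Segment [S i] has exactly one final end and one initial end, so among all in- and out-factors
    only [1 / a_in] at the former and [a_out] at the latter differ from 1 in form. The segment
    equation makes them cancel. *)
Lemma W_real_period : W_real g1 = W_real g0.
Proof.
  assert (Hc : (S i < 2 * ncross w)%nat) by (unfold nE in Hi; lia).
  destruct (seg_in_exists w Hw (S i) Hc) as [j0 [k0 [eps0 [r0 [E0 S0]]]]].
  (* The initial end of segment [S i] is the exit of the strand on which segment [i] ends. The bound
     name [dirichlet_err] denotes the sign of that crossing here. *)
  destruct (seg_in_exists w Hw i ltac:(lia)) as [j1 [k1 [dirichlet_err [r1 [E1 S1]]]]].
  pose proof (seg_out_succ w Hw j1 k1 dirichlet_err r1 E1) as O1. rewrite S1 in O1.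
  assert (L0 : (j0 < length w)%nat) by (apply nth_error_Some; congruence).
  assert (L1 : (j1 < length w)%nat) by (apply nth_error_Some; congruence).
  assert (Pin : (cprod_range (length w) (in_factor true) * cprod_range (length w) (in_factor false))%C = in_factor r0 j0).
  { apply cprod_bool_pair; auto. intros r j Hj Hn. unfold in_factor.
    destruct (nth_error w j) as [[k eps|k o|k]|] eqn:E; auto.
    destruct (Nat.eqb_spec (seg_in w j k r) (S i)) as [Es|Es]; auto.
    exfalso. apply Hn. apply (seg_in_inj w Hw j k eps r j0 k0 eps0 r0); auto. congruence. }
  assert (Pout : (cprod_range (length w) (out_factor true) * cprod_range (length w) (out_factor false))%C = out_factor r1 j1).
  { apply cprod_bool_pair; auto. intros r j Hj Hn. unfold out_factor.
    destruct (nth_error w j) as [[k eps|k o|k]|] eqn:E; auto.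
    destruct (Nat.eqb_spec (seg_out w j k r) (S i)) as [Es|Es]; auto.
    exfalso. apply Hn. apply (seg_in_inj w Hw j k eps r j1 k1 dirichlet_err r1); auto.
    pose proof (seg_out_succ w Hw j k eps r E). lia. }
  assert (Ein : in_factor r0 j0 = (/ a_in w mu b j0 k0 eps0 r0)%C).
  { unfold in_factor. rewrite E0, S0, Nat.eqb_refl. reflexivity. }
  assert (Eout : out_factor r1 j1 = a_out w mu b j1 k1 dirichlet_err r1).
  { unfold out_factor. rewrite E1, O1, Nat.eqb_refl. reflexivity. }
  assert (Ea : a_in w mu b j0 k0 eps0 r0 = a_out w mu b j1 k1 dirichlet_err r1).
  { apply Hseg; auto. rewrite S0, O1. reflexivity. }
  unfold W_real, Wdiag.
  rewrite (cprod_ext _ (cross_weight w N mu (state_arg g1)) (fun j => cross_weight w N mu (state_arg g0) j * (in_factor true j * in_factor false j * (out_factor true j * out_factor false j)))%C)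
    by (intros; apply cross_weight_shift).
  rewrite cprod_mult, (cprod_mult _ (fun j => in_factor true j * in_factor false j)%C), !cprod_mult.
  change (fun l => in_factor true l) with (in_factor true). 
  rewrite Pin, Pout, Ein, Eout, <- Ea.
  field. apply (a_in_neq_0 _ _ _ _ E0).
Qed.
End Period.

Lemma N_powers : / Rpower (INR N) ((INR (nE w) + 1) / 2) = Rpower (INR N) ((INR (nE w) - 1) / 2) * / INR N ^ nE w.
Proof.
  pose proof INR_N_pos as HP.
  rewrite <- Rpower_pow by auto. rewrite <- !Rpower_Ropp, <- Rpower_plus. f_equal. field.
Qed.

Lemma poisson_state_integrals : exists L : C,
    filterlim (fun M : nat => cube_sumZ M (nE w) (I_N w N mu beta) (fun _ => 0%Z))
      eventually (locally L) /\
    Z_N w N mu beta = (RtoC (Rpower (INR N) ((INR (nE w) - 1) / 2)) * L)%C.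
Proof.
  destruct (W_real_ex_mixed_Lip (nE w)) as [B HB].
  eexists. split.
  - apply (poisson_box N (nE w) W_real B); [lia|exact HB|].
    intros n i Hi. apply W_real_period; auto.
  - unfold Z_N. rewrite N_powers, RtoC_mult.
    rewrite (box_sum_ext N _ _ (fun n => W_real (lattice N n))).
    + ring.
    + intros n. unfold W_real. f_equal. apply functional_extensionality. intros i. unfold state_arg, lattice.
      pose proof INR_N_pos. rewrite RtoC_div by lra. unfold Cdiv. ring.
Qed.
End Assembly.

Theorem mainTheorem4 (w : list event) (N : nat) (mu : C) (b beta : nat -> C) :
  knot_diagram w ->
  (2 <= N)%nat ->
  segment_equations w mu b ->
  (forall i, (i < nE w)%nat -> b i <> 0%C) ->
  shapes_generic w mu b ->
  (forall i, (i < nE w)%nat -> cexp (twopii * beta i)%C = b i) ->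
  exists L : C,
    filterlim (fun M : nat => cube_sumZ M (nE w) (I_N w N mu beta) (fun _ => 0%Z))
      eventually (locally L) /\
    Z_N w N mu beta = (RtoC (Rpower (INR N) ((INR (nE w) - 1) / 2)) * L)%C.
Proof.
  intros Hw HN Hseg _ Hsh Hb. exact (poisson_state_integrals w N mu b beta Hw HN Hseg Hsh Hb).
Qed.
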